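(* Let $d\geq 2$, $0<s<1$, $p>1$, $q\geq 1$, $\tau\geq 1$, $0<a\leq 1$, $\alpha,\beta,\gamma\in\mathbb{R}$, $\mu>1$, and $\Lambda>1$. Assume that $\tau\leq\mu$. Define $\sigma\in\mathbb{R}$ by $\gamma=a\sigma+(1-a)\beta$. Assume $$\frac{1}{\tau}+\frac{\gamma}{d}=a\left(\frac{1}{p}+\frac{\alpha-s}{d}\right)+(1-a)\left(\frac{1}{q}+\frac{\beta}{d}\right)$$ and $$-(d-1)s\leq\alpha-\sigma<0.$$ There exists a positive constant $C$ such that for all radial $u\in L^1_{loc}(\mathbb{R}^d\setminus\{0\})$ and for all $R_1,R_2>0$: (i) if $\frac{1}{\tau}+\frac{\gamma}{d}=0$ and $\mathrm{supp}\,u\subset B_{R_2}$, then $$\left(\int_{\mathbb{R}^d}\frac{|x|^{\gamma\tau}}{\ln^{\mu}(2R_2/|x|)}|u|^\tau\,dx\right)^{\frac{1}{\tau}}\leq C\,\|u\|^a_{\dot W^{s,p,\alpha,\Lambda}(\mathbb{R}^d)}\left\||x|^\beta u\right\|^{1-a}_{L^q(\mathbb{R}^d)};$$ (ii) if $\frac{1}{\tau}+\frac{\gamma}{d}=0$ and $\mathrm{supp}\,u\cap B_{R_1}=\emptyset$, then $$\left(\int_{\mathbb{R}^d}\frac{|x|^{\gamma\tau}}{\ln^{\mu}(2|x|/R_1)}|u|^\tau\,dx\right)^{\frac{1}{\tau}}\leq C\,\|u\|^a_{\dot W^{s,p,\alpha,\Lambda}(\mathbb{R}^d)}\left\||x|^\beta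 u\right\|^{1-a}_{L^q(\mathbb{R}^d)}.$$
   Context: $B_R$ denotes the open ball in $\mathbb{R}^d$ centered at the origin with radius $R$. For $p>1$, $0<s<1$, $\alpha\in\mathbb{R}$, $\Lambda>1$, an open set $\Omega\subset\mathbb{R}^d$ and a measurable function $g$ on $\Omega$, $$\|g\|^p_{\dot W^{s,p,\alpha,\Lambda}(\Omega)}=\int_\Omega\int_\Omega\frac{|g(x)-g(y)|^p|x|^{\alpha p}}{|x-y|^{d+sp}}\chi_\Lambda(|x|,|y|)\,dx\,dy,$$ where, for $r_1,r_2\geq 0$, $\chi_\Lambda(r_1,r_2)=1$ if $\Lambda^{-1}r_1\leq r_2\leq\Lambda r_1$ and $\chi_\Lambda(r_1,r_2)=0$ otherwise. The quantities in the inequalities may be infinite; the conventions are $+\infty\cdot 0=0\cdot(+\infty)=0$, $(+\infty)^0=1$ (this corresponds to the case $a=1$), and $+\infty\leq+\infty$. The integrands on the left-hand sides are understood to be $0$ where $u=0$. *)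

(* Defs.v *)
From HB Require Import structures.
From mathcomp Require Import all_boot all_order all_algebra.
From mathcomp Require Import all_classical all_reals all_analysis.
Set Implicit Arguments.
Unset Strict Implicit.
Unset Printing Implicit Defensive.
Import Order.TTheory GRing.Theory Num.Theory.
Import numFieldNormedType.Exports.
Local Open Scope classical_set_scope.
Local Open Scope ring_scope.

(* R^d is 'rV[R]_d.  Its topology is the library's (product) one.  Its
   sigma-algebra is the one generated by the coordinates, i.e. the product of
   the Borel sigma-algebras, as the library does for tuples; since R is second
   countable this is the Borel sigma-algebra of 'rV[R]_d. *)
Definition measure_rV_display : measure_display.
Proof. exact: default_measure_display. Qed.

Section measurable_rV.
Context {R : realType} {n : nat}.

Definition rV_coord (i : 'I_n) (x : 'rV[R]_n) : R := x ord0 i.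

Let rV_set0 : g_sigma_preimage rV_coord set0.
Proof. exact: sigma_algebra0. Qed.

Let rV_setC A : g_sigma_preimage rV_coord A -> g_sigma_preimage rV_coord (~` A).
Proof. exact: sigma_algebraC. Qed.

Let rV_bigcup (F : _^nat) : (forall i, g_sigma_preimage rV_coord (F i)) ->
  g_sigma_preimage rV_coord (\bigcup_i (F i)).
Proof. exact: sigma_algebra_bigcup. Qed.

HB.instance Definition _ := @isMeasurable.Build measure_rV_display
  'rV[R]_n (g_sigma_preimage rV_coord) rV_set0 rV_setC rV_bigcup.

Lemma measurable_rV_coord (i : 'I_n) : measurable_fun [set: 'rV[R]_n] (rV_coord i).
Proof.
move=> _ Y mY; rewrite setTI; apply: sub_sigma_algebra => /=.
rewrite -bigcup_seq/=; exists i => /=; first by rewrite mem_index_enum.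
by exists Y => //; rewrite setTI.
Qed.

Lemma measurable_fun_rVP d1 (T1 : measurableType d1) (f : T1 -> 'rV[R]_n) :
  measurable_fun [set: T1] f <->
  forall i, measurable_fun [set: T1] (rV_coord i \o f).
Proof.
split=> [mf i|mf].
  by apply: measurableT_comp => //; exact: measurable_rV_coord.
have sub : g_sigma_preimage (fun i => rV_coord i \o f) `<=` measurable.
  apply: smallest_sub; first exact: sigma_algebra_measurable.
  rewrite -bigcup_seq; apply: bigcup_sub => i _ A [B mB <-].
  exact: mf.
rewrite g_sigma_preimage_comp in sub.
by move=> _ A mA; apply: sub; exists A.
Qed.

End measurable_rV.

Section cons_rV.
Context {R : realType} {n : nat}.

Definition cons_rV (p : R * 'rV[R]_n) : 'rV[R]_n.+1 :=
  row_mx (p.1%:M : 'rV[R]_1) p.2.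

Definition uncons_rV (x : 'rV[R]_n.+1) : R * 'rV[R]_n :=
  (x ord0 ord0, \row_j x ord0 (lift ord0 j)).

Lemma cons_rV0 p : cons_rV p ord0 ord0 = p.1.
Proof.
rewrite (_ : ord0 = lshift n (ord0 : 'I_1) :> 'I_n.+1); last exact: val_inj.
transitivity ((p.1%:M : 'M[R]_1) ord0 ord0); first exact: row_mxEl.
by rewrite mxE eqxx mulr1n.
Qed.

Lemma cons_rVS p j : cons_rV p ord0 (lift ord0 j) = p.2 ord0 j.
Proof.
rewrite (_ : lift ord0 j = rshift 1 j); last exact: val_inj.
exact: row_mxEr.
Qed.

Lemma cons_rVK : cancel cons_rV uncons_rV.
Proof.
move=> [a v]; rewrite /uncons_rV cons_rV0; congr pair.
by apply/rowP => j; rewrite mxE cons_rVS.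
Qed.

Lemma measurable_cons_rV : measurable_fun [set: R * 'rV[R]_n] cons_rV.
Proof.
apply/measurable_fun_rVP => i.
case: (unliftP ord0 i) => [j|] ->.
  rewrite (_ : _ \o _ = rV_coord j \o snd); last first.
    by apply/funext => p; rewrite /= /rV_coord cons_rVS.
  by apply: measurableT_comp => //; exact: measurable_rV_coord.
rewrite (_ : _ \o _ = fst); first exact: measurable_fst.
by apply/funext => p; rewrite /= /rV_coord cons_rV0.
Qed.

Lemma measurable_uncons_rV : measurable_fun [set: 'rV[R]_n.+1] uncons_rV.
Proof.
apply/measurable_fun_pair; first exact: (@measurable_rV_coord R n.+1 ord0).
apply/measurable_fun_rVP => i.
rewrite (_ : _ \o _ = rV_coord (lift ord0 i)); last first.
  by apply/funext => x; rewrite /= /rV_coord mxE.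
exact: measurable_rV_coord.
Qed.

Variable m : {sigma_finite_measure set 'rV[R]_n -> \bar R}.

(* the product of the Lebesgue measure on R with m, carried over to R^(n+1) *)
Definition cons_measure : set 'rV[R]_n.+1 -> \bar R :=
  pushforward (@lebesgue_measure R \x m)%E cons_rV.

Let cons_measure0 : cons_measure set0 = 0%E.
Proof. by rewrite /cons_measure /pushforward preimage_set0 measure0. Qed.

Let cons_measure_ge0 A : (0 <= cons_measure A)%E.
Proof. by rewrite /cons_measure /pushforward; exact: measure_ge0. Qed.

Let cons_measure_sigma_additive : semi_sigma_additive cons_measure.
Proof.
apply: (@measure_semi_sigma_additive _ _ _
  (pushforward (@lebesgue_measure R \x m)%E cons_rV)).
exact: measurable_cons_rV.
Qed.

HB.instance Definition _ := isMeasure.Build _ _ _ cons_measure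
  cons_measure0 cons_measure_ge0 cons_measure_sigma_additive.

Let cons_measure_sigma_finite : sigma_finite setT cons_measure.
Proof.
have /sigma_finiteP[F [FT ndF Foo]] := sigma_finiteT (@lebesgue_measure R).
have /sigma_finiteP[G [GT ndG Goo]] := sigma_finiteT m.
exists (fun k => uncons_rV @^-1` (F k `*` G k)).
  apply/esym; rewrite -subTset => x _.
  have [k _ Fk] : (\bigcup_k F k) (uncons_rV x).1 by rewrite -FT.
  have [l _ Gl] : (\bigcup_k G k) (uncons_rV x).2 by rewrite -GT.
  exists (maxn k l) => //; split => /=.
  - by move: Fk; exact/subsetPset/ndF/leq_maxl.
  - by move: Gl; exact/subsetPset/ndG/leq_maxr.
move=> k; have [mFk Fk] := Foo k; have [mGk Gk] := Goo k; split.
  rewrite -[X in measurable X]setTI; apply: measurable_uncons_rV => //.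
  exact: measurableX.
rewrite /cons_measure /pushforward -comp_preimage.
rewrite (_ : uncons_rV \o _ = id); last first.
  by apply/funext => p /=; rewrite cons_rVK.
by rewrite preimage_id product_measure1E// lte_mul_pinfty// ge0_fin_numE.
Qed.

HB.instance Definition _ := Measure_isSigmaFinite.Build _ _ _ cons_measure
  cons_measure_sigma_finite.

End cons_rV.

(* Lebesgue measure on R^n, see lebesgue_rV_box. *)
Fixpoint lebesgue_rV (R : realType) (n : nat) :
    {sigma_finite_measure set 'rV[R]_n -> \bar R} :=
  if n is n'.+1 then cons_measure (lebesgue_rV R n') else \d_(0 : 'rV[R]_0).

Lemma lebesgue_rV_box (R : realType) (n : nat) (A : 'I_n -> set R) :
  (forall i, measurable (A i)) ->
  lebesgue_rV R n [set x | forall i, A i (x ord0 i)] =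
  (\big[*%E/1]_(i < n) lebesgue_measure (A i))%E.
Proof.
elim: n A => [|n IH] A mA.
  rewrite big_ord0 /= diracE mem_set//= => -[] //.
rewrite big_ord_recl -(IH (A \o lift ord0)) => [|i]; last exact: mA.
rewrite /= /cons_measure /pushforward -product_measure1E//.
  congr (product_measure1 _ _ _); apply/seteqP; split => p /=.
    move=> Ap; split; first by have := Ap ord0; rewrite cons_rV0.
    by move=> i; have := Ap (lift ord0 i); rewrite cons_rVS.
  move=> [A0 AS] i; case: (unliftP ord0 i) => [j|] ->.
    by rewrite cons_rVS.
  by rewrite cons_rV0.
  exact: mA.
rewrite [X in measurable X](_ : _ = \bigcap_(j in [set: 'I_n])
    (rV_coord j @^-1` A (lift ord0 j))).
  apply: fin_bigcap_measurable => // j _.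
  by rewrite -[X in measurable X]setTI; exact: measurable_rV_coord.
by apply/seteqP; split => x /= Ax i; [move=> _; exact: Ax | exact: (Ax i)].
Qed.

Section function_spaces.
Context {R : realType} {d : nat}.
Implicit Types (x y : 'rV[R]_d) (u : 'rV[R]_d -> R) (D : set 'rV[R]_d).

(* `|x| is the sup norm on 'rV[R]_d, hence the Euclidean norm below. *)
Definition enorm x : R := Num.sqrt (\sum_(i < d) x ord0 i ^+ 2).

Definition eball (r : R) : set 'rV[R]_d := [set x | enorm x < r].

Definition radial u := forall x y, enorm x = enorm y -> u x = u y.

(* same as locally_integrable, which is only for functions on R *)
Definition locally_integrable_rV D u :=
  [/\ measurable_fun D u, open D & forall K, K `<=` D -> compact K ->
    (\int[lebesgue_rV R d]_(x in K) `|u x|%:E < +oo)%E].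

(* the support of the class of u modulo equality almost everywhere *)
Definition ess_support u : set 'rV[R]_d :=
  [set x | forall U : set 'rV[R]_d, open U -> U x ->
    ~ {ae lebesgue_rV R d, forall y, U y -> u y = 0}].

Definition chi (Lambda r1 r2 : R) : R :=
  if (Lambda^-1 * r1 <= r2) && (r2 <= Lambda * r1) then 1 else 0.

(* At x = y, and at x = 0 if alpha * p < 0, the integrand is not given the
   value +oo: these are null sets. *)
Definition sobolev_seminorm (s p alpha Lambda : R) D u : \bar R :=
  ((\int[lebesgue_rV R d]_(y in D) \int[lebesgue_rV R d]_(x in D)
     ((`|u x - u y| `^ p * enorm x `^ (alpha * p)
       / enorm (x - y) `^ (d%:R + s * p)
       * chi Lambda (enorm x) (enorm y))%:E)) `^ p^-1)%E.

End function_spaces.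

(* Main.v *)
(* Write lambda = sqrt Lambda and cut R^d into the shells
   rho_j <= |x| < lambda rho_j, with rho_j = lambda^(j - 1) R_1 or lambda^(- j) R_2.
   On the union of two consecutive shells, a radial u behaves like a function of
   one variable: for |x| close to |y|, averaging the kernel |x - y|^(-d - s p) over
   a thin cone around y leaves the one-dimensional kernel, of exponent 1 + s p.
   With t = (s + sigma - alpha) / d, the assumption on alpha - sigma says that
   0 < t <= s, and the balance condition says that
   1 / tau = a (1 / p - t) + (1 - a) / q, so the L^tau oscillation of u on the two
   shells is controlled by the one-dimensional Gagliardo-Nirenberg inequality, in
   which all powers of rho_j cancel because 1 / tau + gamma / d = 0.

   That inequality is proved a la Hedberg: u(x) differs from its mean over the
   points at distance de from x by at most de^s times the local difference
   quotient at x; the mean is at most de^(- 1 / tau) times the L^tau norm;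
   optimizing de and integrating, a power of the L^tau norm is absorbed in the
   left-hand side.

   Let S_j be the resulting bound for the j-th pair of shells.  Since u vanishes
   on the shell with j = 0, its L^tau norm on the m-th one is at most
   C (S_0 + ... + S_(m - 1)), and Hoelder bounds this by m^(1 - a / p - (1 - a) / q)
   times the right-hand side.  As 1 / tau < a / p + (1 - a) / q and tau <= mu, the
   weights m^(- mu) make the sum over m of the tau-th powers converge. *)
Require Import Defs.
From mathcomp Require Import all_boot all_order all_algebra finmap.
From mathcomp Require Import all_classical all_reals all_analysis.
From mathcomp Require Import measurable_realfun ring lra.
Import Order.TTheory GRing.Theory Num.Theory.
Import numFieldNormedType.Exports.
Local Open Scope classical_set_scope.
Local Open Scope ring_scope.
Set Implicit Arguments.
Unset Strict Implicit.
Unset Printing Implicit Defensive.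

(** * Euclidean norm and scaling of the Lebesgue measure *)

(** The square root of Lambda is taken so that two consecutive shells together have ratio Lambda:
    for two points of such a pair the cut-off [chi] equals 1. A constant, suitably normalized, has
    the same norm on both shells of the pair, so the norms of u on them differ by at most a multiple
    of the oscillation on the pair. Each shell lies in at most two pairs, so the bounds can be added
    up.

    Polar coordinates are never introduced. All integrals stay in dimension d, and the
    one-dimensional structure enters through two facts about a shell contracted by the factor de
    towards |y|: its measure is at least of order de, and, up to a power of the radius, the mean
    over it of |u - u(y)|^p is at most a multiple of de^(s p) times the Gagliardo integral at y. As
    de <= 1, the order s may be lowered to t, which is what t <= s is for.

    That t is positive makes the last series converge even for mu = tau: the tau-th power of the
    m-th norm grows at most like m^(tau - 1 - a t tau), and the weight m^(- mu) leaves at most m^(-1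
    - a t tau). *)

Section euclidean_norm.
Context {R : realType} {d : nat}.
Implicit Types (x y z : 'rV[R]_d) (t : R).

Local Notation dot x y := (\sum_(i < d) x ord0 i * y ord0 i).

Lemma enorm_ge0 x : 0 <= enorm x.
Proof. exact: sqrtr_ge0. Qed.

Lemma enorm_sqr x : enorm x ^+ 2 = \sum_(i < d) x ord0 i ^+ 2.
Proof. by rewrite sqr_sqrtr// sumr_ge0// => i _; rewrite sqr_ge0. Qed.

Lemma enormZ t x : enorm (t *: x) = `|t| * enorm x.
Proof.
rewrite /enorm -sqrtr_sqr -sqrtrM ?sqr_ge0//; congr Num.sqrt.
by rewrite mulr_sumr; apply: eq_bigr => i _; rewrite mxE exprMn.
Qed.

Lemma enorm0 : enorm (0 : 'rV[R]_d) = 0.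
Proof. by rewrite -(scale0r 0) enormZ normr0 mul0r. Qed.

Lemma enormN x : enorm (- x) = enorm x.
Proof. by rewrite -scaleN1r enormZ normrN1 mul1r. Qed.

Lemma enormB x y : enorm (x - y) = enorm (y - x).
Proof. by rewrite -enormN opprB. Qed.

Lemma enorm_coord x i : `|x ord0 i| <= enorm x.
Proof.
rewrite -sqrtr_sqr ler_wsqrtr// (bigD1 i)//= lerDl.
by apply: sumr_ge0 => j _; rewrite sqr_ge0.
Qed.

Lemma enorm_eq0 x : enorm x = 0 -> x = 0.
Proof.
move=> x0; apply/rowP => i; rewrite mxE; apply/normr0_eq0/le_anti.
by rewrite normr_ge0 andbT -x0 enorm_coord.
Qed.

Lemma enorm_gt0 x : x != 0 -> 0 < enorm x.
Proof.
move=> x0; rewrite lt_neqAle enorm_ge0 andbT eq_sym.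
by apply: contra x0 => /eqP/enorm_eq0 ->.
Qed.

(** The squares of |y| x_i - |x| y_i add up to 2 |x| |y| (|x| |y| - x.y). *)
Lemma cauchy_schwarz_rV x y : dot x y <= enorm x * enorm y.
Proof.
have [x0|x0] := eqVneq (enorm x) 0.
  rewrite x0 mul0r (enorm_eq0 x0) big1// => i _.
  by rewrite mxE mul0r.
have [y0|y0] := eqVneq (enorm y) 0.
  rewrite y0 mulr0 (enorm_eq0 y0) big1// => i _.
  by rewrite mxE mulr0.
have xp : 0 < enorm x by rewrite lt_neqAle eq_sym x0 enorm_ge0.
have yp : 0 < enorm y by rewrite lt_neqAle eq_sym y0 enorm_ge0.
have : 0 <= \sum_(i < d) (enorm y * x ord0 i - enorm x * y ord0 i) ^+ 2.
  by apply: sumr_ge0 => i _; rewrite sqr_ge0.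
rewrite (eq_bigr (fun i => enorm y ^+ 2 * x ord0 i ^+ 2 +
  enorm x ^+ 2 * y ord0 i ^+ 2 +
  - (2 * enorm x * enorm y) * (x ord0 i * y ord0 i))); last by move=> i _; ring.
rewrite !big_split/= -!mulr_sumr -!enorm_sqr => h.
rewrite -(ler_pM2l (mulr_gt0 xp yp)); nra.
Qed.

Lemma enorm_triangle x y : enorm (x + y) <= enorm x + enorm y.
Proof.
rewrite -ler_sqr ?nnegrE ?enorm_ge0 ?addr_ge0 ?enorm_ge0//.
rewrite enorm_sqr (eq_bigr (fun i => x ord0 i ^+ 2 + y ord0 i ^+ 2 +
  2 * (x ord0 i * y ord0 i))); last by move=> i _; rewrite mxE; ring.
rewrite !big_split/= -mulr_sumr -!enorm_sqr.
have := cauchy_schwarz_rV x y; nra.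
Qed.

Lemma enorm_dist x y : `|enorm x - enorm y| <= enorm (x - y).
Proof.
have h1 := enorm_triangle (x - y) y; have h2 := enorm_triangle (y - x) x.
rewrite !subrK (enormB y) in h1 h2.
by rewrite ler_norml; apply/andP; split; lra.
Qed.

(** The factor [d], cruder than its square root, is enough for the comparisons of balls and cubes
    below. *)
Lemma enorm_le_coord x t : 0 <= t -> (forall i, `|x ord0 i| <= t) ->
  enorm x <= d%:R * t.
Proof.
move=> t0 xt; rewrite -ler_sqr ?nnegrE ?mulr_ge0 ?enorm_ge0//.
rewrite enorm_sqr (@le_trans _ _ (\sum_(i < d) t ^+ 2))//.
  apply: ler_sum => i _; rewrite -real_normK ?num_real//.
  by rewrite ler_sqr ?nnegrE.
rewrite sumr_const card_ord -[leLHS]mulr_natl exprMn ler_wpM2r ?sqr_ge0//.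
by rewrite -natrX ler_nat; case: (d) => // n; rewrite -[leqLHS]expn1 leq_pexp2l.
Qed.

Lemma measurable_enorm : measurable_fun [set: 'rV[R]_d] (@enorm R d).
Proof.
rewrite (_ : @enorm R d =
    (fun t => t `^ 2^-1) \o (fun x => \sum_(i < d) x ord0 i ^+ 2)); last first.
  apply/funext => x; rewrite /= powR12_sqrt// sumr_ge0// => i _.
  by rewrite sqr_ge0.
apply: measurableT_comp; first exact: measurable_powR.
apply: measurable_sum => i; apply: measurable_funX.
exact: (@measurable_rV_coord R d i).
Qed.

Lemma measurable_eball t : measurable (@eball R d t).
Proof.
rewrite (_ : eball t = @enorm R d @^-1` `]-oo, t[%classic).
  by rewrite -[X in measurable X]setTI; exact: measurable_enorm.
by apply/seteqP; split => x /=; rewrite in_itv.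
Qed.

Lemma measurable_scale_rV t :
  measurable_fun [set: 'rV[R]_d] (fun x => t *: x).
Proof.
apply/measurable_fun_rVP => i.
rewrite (_ : _ \o _ = (fun x : 'rV[R]_d => t * rV_coord i x)); last first.
  by apply/funext => x; rewrite /= /rV_coord mxE.
apply: measurable_funM; first exact: measurable_cst.
exact: measurable_rV_coord.
Qed.

End euclidean_norm.

Section scaling.
Context {R : realType}.
Local Open Scope ereal_scope.

(** By uniqueness of the Lebesgue measure: [t] times its pushforward under [r -> t * r] gives every
    half-open interval its length. *)
Lemma lebesgue_measure_scale (t : R) (A : set R) : (0 < t)%R ->
  measurable A ->
  lebesgue_measure ((fun r => t * r)%R @^-1` A) = t^-1%:E * lebesgue_measure A.
Proof.
move=> t0 mA.
have mt : measurable_fun [set: R] (fun r => t * r)%R.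
  by apply: measurable_funM; [exact: measurable_cst|exact: measurable_id].
have mt' : measurable_fun [set: measurableTypeR R]
  ((fun r => t * r)%R : _ -> measurableTypeR R) by [].
pose m_ : _ -> {measure set (measurableTypeR R) -> \bar R} :=
  fun k => mscale k (pushforward lebesgue_measure
    ((fun r => t * r)%R : measurableTypeR R -> measurableTypeR R)).
pose m := m_ mt' (NngNum (ltW t0)).
have : lebesgue_measure A = m A.
  apply: lebesgue_measure_unique => // _ [[a b]] _ <-.
  rewrite /m /m_ /mscale /= /pushforward.
  rewrite [X in _ = _ * lebesgue_measure X](_ : _ =
      `](a / t)%R, (b / t)%R]%classic); last first.
    apply/seteqP; split => x /=; rewrite !in_itv/= ltr_pdivrMr// ler_pdivlMr//;
      by rewrite ![(t * x)%R]mulrC.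
  rewrite !lebesgue_measure_itv/= !lte_fin ltr_pM2r ?invr_gt0//.
  case: ifPn => _; last by rewrite mule0.
  by rewrite -!EFinB -EFinM; congr EFin; field; rewrite gt_eqF.
move=> ->; rewrite /m /m_ /mscale /= /pushforward muleA -EFinM mulVf ?gt_eqF//.
by rewrite mul1e.
Qed.

Lemma ge0_integral_scale (t : R) (f : R -> \bar R) : (0 < t)%R ->
  measurable_fun setT f -> (forall x, 0 <= f x) ->
  \int[lebesgue_measure]_x f (t * x)%R
  = t^-1%:E * \int[lebesgue_measure]_x f x.
Proof.
move=> t0 mf f0.
have mt : measurable_fun [set: measurableTypeR R]
    ((fun r => t * r)%R : _ -> measurableTypeR R).
  by apply: measurable_funM; [exact: measurable_cst|exact: measurable_id].
have it0 : (0 <= t^-1)%R by rewrite invr_ge0 ltW.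
transitivity (\int[pushforward lebesgue_measure
    ((fun r => t * r)%R : measurableTypeR R -> measurableTypeR R)]_x f x).
  by rewrite (ge0_integral_pushforward mt).
rewrite (@eq_measure_integral _ _ _ _
  (mscale (NngNum it0) (@lebesgue_measure R)))//.
  by rewrite ge0_integral_mscale.
by move=> A mA _; exact: lebesgue_measure_scale.
Qed.

Lemma ge0_integral_cons_rV n (f : 'rV[R]_n.+1 -> \bar R) :
  measurable_fun setT f -> (forall x, 0 <= f x) ->
  \int[lebesgue_rV R n.+1]_x f x =
  \int[lebesgue_measure]_r \int[lebesgue_rV R n]_v f (cons_rV (r, v)).
Proof.
move=> mf f0 /=; rewrite /cons_measure ge0_integral_pushforward//; last first.
  exact: measurable_cons_rV.
rewrite preimage_setT fubini_tonelli1//.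
by apply: measurableT_comp => //; exact: measurable_cons_rV.
by move=> x; exact: f0.
Qed.

(** Induction on the dimension: by Tonelli each coordinate contributes one factor [t^-1]. *)
Lemma ge0_integral_scale_rV n (t : R) (f : 'rV[R]_n -> \bar R) : (0 < t)%R ->
  measurable_fun setT f -> (forall x, 0 <= f x) ->
  \int[lebesgue_rV R n]_x f (t *: x) =
  (t ^- n)%:E * \int[lebesgue_rV R n]_x f x.
Proof.
move=> t0; elim: n f => [|n IH] f mf f0.
  rewrite expr0 invr1 mul1e; apply: eq_integral => x _.
  by congr f; apply/rowP => -[].
have mfc : measurable_fun [set: R * 'rV[R]_n] (fun z => f (cons_rV z)).
  by apply: measurableT_comp => //; exact: measurable_cons_rV.
pose F (r : R) := \int[lebesgue_rV R n]_v f (cons_rV (r, v)).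
have mF : measurable_fun setT F.
  exact: (measurable_fun_fubini_tonelli_F (m2 := lebesgue_rV R n)
    (fun z => f (cons_rV z))).
have F0 r : 0 <= F r by apply: integral_ge0.
rewrite !ge0_integral_cons_rV//; last first.
  by apply: measurableT_comp => //; exact: measurable_scale_rV.
have tE (r : R) v : t *: cons_rV (r, v) = cons_rV (t * r, t *: v)%R.
  apply/rowP => i; rewrite mxE; case: (unliftP ord0 i) => [j|] ->.
    by rewrite !cons_rVS mxE.
  by rewrite !cons_rV0.
transitivity (\int[lebesgue_measure]_r ((t ^- n)%:E * F (t * r)%R)).
  apply: eq_integral => r _; under eq_integral do rewrite tE.
  rewrite (IH (fun v => f (cons_rV (t * r, v)%R)))//.
  exact: (measurableT_comp mfc (measurable_pair1 (t * r)%R)).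
rewrite -/F; move: F F0 mF => F F0 mF.
have mtr : measurable_fun [set: R] (fun r => t * r)%R.
  by apply: measurable_funM; [exact: measurable_cst|exact: measurable_id].
have it0 : (0 <= t ^- n)%R by rewrite invr_ge0 exprn_ge0// ltW.
rewrite [LHS](_ : _ = (t ^- n)%:E * \int[lebesgue_measure]_r F (t * r)%R).
  2: by apply: ge0_integralZl_EFin => //; exact: (measurableT_comp mF).
rewrite ge0_integral_scale// muleA -EFinM; congr (_%:E * _).
by rewrite exprSr invfM mulrC.
Qed.

End scaling.

(** * Cones, shells and radial integrals *)

Section polar.
Context {R : realType} {n : nat}.
Implicit Types (K A : set 'rV[R]_n) (t : R).
Local Notation lam := (lebesgue_rV R n).
Local Open Scope ereal_scope.

Lemma lebesgue_rV_scale t A : (0 < t)%R -> measurable A ->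
  lam ((fun x => t *: x) @^-1` A) = (t ^- n)%:E * lam A.
Proof.
move=> t0 mA.
have mtA : measurable ((fun x => t *: x) @^-1` A).
  by rewrite -[X in measurable X]setTI; exact: measurable_scale_rV.
have iE B : measurable B -> lam B = \int[lam]_x (\1_B x)%:E.
  by move=> mB; rewrite integral_indic// setIT.
rewrite !iE//.
rewrite -(@ge0_integral_scale_rV R n t (fun x => (\1_A x)%:E) t0)//.
exact/measurable_EFinP/measurable_indic.
Qed.

Lemma lebesgue_rV_cube (c : 'rV[R]_n) (e : R) : (0 < e)%R ->
  lam [set x | forall i, `|x ord0 i - c ord0 i| < e]%R = ((2 * e) ^+ n)%:E.
Proof.
move=> e0.
have := @lebesgue_rV_box R n
  (fun i => `](c ord0 i - e)%R, (c ord0 i + e)%R[%classic) (fun=> measurable_itv _).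
rewrite (_ : [set x | _] =
    [set x | forall i, `|x ord0 i - c ord0 i| < e]%R); last first.
  by apply/seteqP; split => x /= h i; have := h i;
    rewrite in_itv/= ltr_distl.
move=> ->; rewrite (eq_bigr (fun=> (2 * e)%:E)); last first.
  move=> i _; rewrite lebesgue_measure_itv/= lte_fin ifT; last by lra.
  by rewrite -EFinB; congr EFin; ring.
by rewrite prodEFin prodr_const card_ord.
Qed.

Lemma measurable_cube (c : 'rV[R]_n) (e : R) :
  measurable [set x : 'rV[R]_n | forall i, `|x ord0 i - c ord0 i| < e]%R.
Proof.
rewrite [X in measurable X](_ : _ = \bigcap_(j in [set: 'I_n])
    (rV_coord j @^-1` `](c ord0 j - e)%R, (c ord0 j + e)%R[%classic)).
  apply: fin_bigcap_measurable => // j _.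
  by rewrite -[X in measurable X]setTI; exact: measurable_rV_coord.
apply/seteqP; split => x /= h i.
  by move=> _ /=; rewrite in_itv/= -ltr_distl; exact: h.
by have /= := h i I; rewrite in_itv/= -ltr_distl.
Qed.

Lemma lebesgue_rV_eball1_fin : lam (eball 1) < +oo.
Proof.
have := lebesgue_rV_cube (0 : 'rV[R]_n) ltr01.
move=> h; apply: (@le_lt_trans _ _ ((2 * 1) ^+ n)%:E); last exact: ltry.
rewrite -h; apply: le_measure; rewrite ?inE.
- exact: measurable_eball.
- exact: measurable_cube.
- move=> x /= x1 i; rewrite mxE subr0; apply: le_lt_trans x1.
  exact: enorm_coord.
Qed.

Lemma lebesgue_rV_eball1_gt0 : 0 < lam (eball 1).
Proof.
(* This is the half-side of a cube inside the unit ball; [n.+1] instead of [n] keeps it meaningful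
   in dimension 0. *)
have e0 : (0 < (2 * n.+1%:R)^-1 :> R)%R by rewrite invr_gt0 mulr_gt0.
have := lebesgue_rV_cube (0 : 'rV[R]_n) e0.
move=> h; apply: (@lt_le_trans _ _ ((2 * (2 * n.+1%:R)^-1) ^+ n)%:E).
  by rewrite lte_fin exprn_gt0// mulr_gt0.
rewrite -h; apply: le_measure; rewrite ?inE.
- exact: measurable_cube.
- exact: measurable_eball.
- move=> x /= hx; apply: (@le_lt_trans _ _ (n%:R * (2 * n.+1%:R)^-1)%R).
    by apply: enorm_le_coord => [|i]; [exact: ltW|rewrite -[x ord0 i]subr0;
      have := hx i; rewrite mxE => /ltW].
  rewrite ltr_pdivrMr ?mulr_gt0// mul1r -natrM ltr_nat.
  by rewrite mul2n -addnn; apply: (leq_trans (ltnSn n)); exact: leq_addr.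
Qed.

Definition is_cone K := forall t x, (0 < t)%R -> K x -> K (t *: x).

(* This is the usual solid angle divided by the dimension. *)
Definition solid_angle K : R := fine (lam (K `&` eball 1)).

Lemma solid_angleE K : measurable K ->
  lam (K `&` eball 1) = (solid_angle K)%:E.
Proof.
move=> mK; rewrite fineK// ge0_fin_numE//.
apply: le_lt_trans lebesgue_rV_eball1_fin.
by apply: le_measure; rewrite ?inE//;
  [apply: measurableI => //|]; exact: measurable_eball.
Qed.

Lemma solid_angle_ge0 K : (0 <= solid_angle K)%R.
Proof. exact: fine_ge0. Qed.

Lemma solid_angleT_gt0 : (0 < solid_angle setT)%R.
Proof.
rewrite -lte_fin -solid_angleE// setTI; exact: lebesgue_rV_eball1_gt0.
Qed.

Lemma lebesgue_cone_eball K t : measurable K -> is_cone K -> (0 < t)%R ->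
  lam (K `&` eball t) = (t ^+ n * solid_angle K)%:E.
Proof.
move=> mK cK t0.
have := @lebesgue_rV_scale t (K `&` eball t) t0.
rewrite [X in lam X](_ : _ = K `&` eball 1); last first.
  rewrite /eball; apply/seteqP; split => x /=.
    rewrite enormZ gtr0_norm// gtr_pMr// => -[h1 h2]; split => //.
    rewrite -[x]scale1r -(mulVf (lt0r_neq0 t0)) -scalerA.
    by apply: cK => //; rewrite invr_gt0.
  by rewrite enormZ gtr0_norm// gtr_pMr// => -[h1 h2]; split => //; exact: cK.
rewrite solid_angleE// => h.
have mKt : measurable (K `&` eball t).
  by apply: measurableI => //; exact: measurable_eball.
rewrite EFinM h// muleA -EFinM divff ?mul1e// expf_neq0//.
by rewrite gt_eqF.
Qed.

(* This replaces polar coordinates: by homogeneity the two measures of [B]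
   agree on the rays [`]-oo, x[], hence everywhere. *)
Lemma lebesgue_cone_pushforward K (B : set R) : measurable K -> is_cone K ->
  measurable B ->
  lam (K `&` @enorm R n @^-1` B) =
  (solid_angle K / solid_angle setT)%:E * lam (@enorm R n @^-1` B).
Proof.
move=> mK cK mB.
have me : measurable_fun setT
  (@enorm R n : 'rV[R]_n -> measurableTypeR R) by exact: measurable_enorm.
have k0 : (0 <= solid_angle K / solid_angle setT)%R.
  by rewrite divr_ge0// solid_angle_ge0.
pose m1_ := pushforward (mrestr lam mK)
  (@enorm R n : 'rV[R]_n -> measurableTypeR R)
  : {measure set (measurableTypeR R) -> \bar R}.
pose m2_ := mscale (NngNum k0)
    (pushforward lam (@enorm R n : 'rV[R]_n -> measurableTypeR R))
  : {measure set (measurableTypeR R) -> \bar R}.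
have preE (x : R) : @enorm R n @^-1` `]-oo, x[%classic = eball x.
  by apply/seteqP; split => y /=; rewrite in_itv.
have m1E x : m1_ me `]-oo, x[%classic = lam (K `&` eball x).
  by rewrite /m1_ /= /pushforward /= preE /mrestr setIC.
have eball0 (x : R) : (x <= 0)%R -> eball x = set0 :> set 'rV[R]_n.
  move=> x0; rewrite -subset0 => y /= yx.
  by have := lt_le_trans yx x0; rewrite ltNge enorm_ge0.
suff : m1_ me B = m2_ me B.
  by rewrite /m1_ /m2_ /= /mrestr /pushforward /= /mscale setIC.
apply: (@measure_unique _ R (measurableTypeR R) (@RGenInftyO.G R)
  (fun k => `]-oo, k%:R[%classic)) => //.
- exact: RGenInftyO.measurableE.
- move=> _ _ [x ->] [y ->]; exists (Num.min x y).
  by apply/seteqP; split => z /=; rewrite !in_itv/= lt_min => /andP.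
- by move=> k; exists k%:R.
- rewrite -subTset => x _; exists (Num.bound `|x|) => //=.
  by rewrite in_itv/= (le_lt_trans (ler_norm x))// archi_boundP.
- move=> _ [x ->]; rewrite [LHS]m1E /m2_ /= /mscale /= /pushforward preE.
  have [x0|x0] := leP x 0%R; first by rewrite eball0// setI0 !measure0 mule0.
  rewrite lebesgue_cone_eball// -[eball x]setTI lebesgue_cone_eball//.
  rewrite -EFinM; congr EFin; field; exact: lt0r_neq0 solid_angleT_gt0.
- move=> k; rewrite [X in X < _]m1E; have [->|k0'] := eqVneq k 0%N.
    by rewrite eball0// setI0 measure0 ltry.
  by rewrite lebesgue_cone_eball ?ltry// ltr0n lt0n.
Qed.

Lemma ge0_integral_cone K (f : R -> \bar R) : measurable K -> is_cone K ->
  measurable_fun setT f -> (forall r, 0 <= f r) ->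
  \int[lam]_(x in K) f (enorm x) =
  (solid_angle K / solid_angle setT)%:E * \int[lam]_x f (enorm x).
Proof.
move=> mK cK mf f0.
have me : measurable_fun setT
  (@enorm R n : 'rV[R]_n -> measurableTypeR R) by exact: measurable_enorm.
have k0 : (0 <= solid_angle K / solid_angle setT)%R.
  by rewrite divr_ge0// solid_angle_ge0.
have mfe : measurable_fun setT (fun x : 'rV[R]_n => f (enorm x)).
  exact: measurableT_comp.
transitivity (\int[mrestr lam mK]_x f (enorm x)).
  rewrite [RHS](@ge0_negligible_integral _ _ _ (mrestr lam mK) setT (~` K))//.
  - rewrite setTD setCK; apply/esym/eq_measure_integral => A mA AK.
    by rewrite /= /mrestr setIidl.
  - exact: measurableC.
  - by rewrite /= /mrestr setICl measure0.
pose m1 := pushforward (mrestr lam mK)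
  (@enorm R n : 'rV[R]_n -> measurableTypeR R)
  : {measure set (measurableTypeR R) -> \bar R}.
pose m2 := pushforward lam (@enorm R n : 'rV[R]_n -> measurableTypeR R)
  : {measure set (measurableTypeR R) -> \bar R}.
transitivity (\int[m1 me]_x f x).
  by rewrite (ge0_integral_pushforward me).
transitivity (\int[mscale (NngNum k0) (m2 me)]_x f x).
  apply: eq_measure_integral => A mA _.
  by rewrite /= /pushforward /mrestr setIC lebesgue_cone_pushforward.
rewrite ge0_integral_mscale//; congr (_ * _).
by rewrite (ge0_integral_pushforward me).
Qed.

End polar.

Section shells.
Context {R : realType} {n : nat}.
Local Notation lam := (lebesgue_rV R n.+1).
Implicit Types (K : set 'rV[R]_n.+1) (x w : 'rV[R]_n.+1).

Definition shell (a b : R) : set 'rV[R]_n.+1 := [set x | a <= enorm x < b].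

Lemma measurable_shell a b : measurable (shell a b).
Proof.
rewrite (_ : shell a b = @enorm R n.+1 @^-1` `[a, b[%classic).
  by rewrite -[X in measurable X]setTI; exact: measurable_enorm.
by apply/seteqP; split => x /=; rewrite in_itv.
Qed.

Lemma lebesgue_cone_shell K a b : measurable K -> is_cone K ->
  0 < a -> a <= b ->
  lam (K `&` shell a b) = ((b ^+ n.+1 - a ^+ n.+1) * solid_angle K)%:E.
Proof.
move=> mK cK a0 ab; have b0 := lt_le_trans a0 ab.
have mKb t : measurable (K `&` eball t).
  by apply: measurableI => //; exact: measurable_eball.
rewrite (_ : K `&` shell a b = (K `&` eball b) `\` (K `&` eball a)); last first.
  apply/seteqP; split => x /=.
    by move=> [Kx /andP[ax xb]]; split => // -[_]; rewrite /eball/= ltNge ax.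
  move=> [[Kx xb]] /not_andP[//|/negP]; rewrite -leNgt => ax.
  by split => //; rewrite /shell/= ax.
rewrite measureD; [|exact: mKb|exact: mKb|by rewrite [ltLHS]lebesgue_cone_eball ?ltry].
rewrite [X in (_ - lam X)%E](_ : _ = K `&` eball a); last first.
  apply: setIidr => x [Kx xa]; split => //; exact: lt_le_trans ab.
have Eb := lebesgue_cone_eball mK cK b0; have Ea := lebesgue_cone_eball mK cK a0.
rewrite [X in (X - _)%E]Eb [X in (_ - X)%E]Ea.
by rewrite -EFinB -mulrBl.
Qed.

Lemma lebesgue_shell a b : 0 < a -> a <= b ->
  lam (shell a b) = ((b ^+ n.+1 - a ^+ n.+1) * solid_angle [set: 'rV[R]_n.+1])%:E.
Proof.
by move=> a0 ab; rewrite -(lebesgue_cone_shell measurableT)// setTI.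
Qed.

Lemma ge0_integral_radial_cone (g : 'rV[R]_n.+1 -> \bar R) K a b :
  measurable K -> is_cone K -> measurable_fun setT g ->
  (forall x, 0 <= g x)%E -> (forall x y, enorm x = enorm y -> g x = g y) ->
  (\int[lam]_(x in K `&` shell a b) g x =
  (solid_angle K / solid_angle [set: 'rV[R]_n.+1])%:E *
    \int[lam]_(x in shell a b) g x)%E.
Proof.
move=> mK cK mg g0 rg.
(* A radial function is recovered from its values on the ray through [e0]; this gives the measurable
   profile of one variable that [ge0_integral_cone] needs. *)
pose e0 : 'rV[R]_n.+1 := delta_mx ord0 ord0.
have ne0 : enorm e0 = 1.
  rewrite /enorm (bigD1 ord0)//= mxE !eqxx expr1n big1 ?addr0 ?sqrtr1// => i i0.
  by rewrite mxE (negbTE i0) andbF expr0n.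
have gE x : g x = g (enorm x *: e0).
  by apply: rg; rewrite enormZ ne0 mulr1 ger0_norm// enorm_ge0.
pose f (r : R) : \bar R := g (r *: e0).
have mf : measurable_fun setT f.
  apply: measurableT_comp => //; apply/measurable_fun_rVP => i.
  rewrite (_ : _ \o _ = (fun r : R => r * e0 ord0 i)); last first.
    by apply/funext => r; rewrite /= /rV_coord mxE.
  by apply: measurable_funM.
have mfi : measurable_fun setT (f \_ `[a, b[).
  by apply/(measurable_restrictT _ _).1 => //; exact: measurable_funS mf.
have E x : (g \_ (shell a b)) x = (f \_ `[a, b[) (enorm x).
  rewrite /patch; have -> : (x \in shell a b) = (enorm x \in `[a, b[%classic).
    by rewrite /shell; apply/idP/idP; rewrite !inE/=.
  by rewrite /f -gE.
rewrite [LHS]integral_mkcondr [X in (_ = _ * X)%E]integral_mkcond.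
rewrite (eq_integral _ _ (fun x _ => E x)) [in RHS](eq_integral _ _ (fun x _ => E x)).
apply: ge0_integral_cone => // r.
by apply: erestrict_ge0 => t _; exact: g0.
Qed.

(** For nonzero [x], this says that the direction x / |x| is at distance less than [e] from [w].
    Multiplying by |x| avoids the division and excludes the origin. *)
Definition dcone w (e : R) : set 'rV[R]_n.+1 :=
  [set x | enorm (x - enorm x *: w) < e * enorm x].

Lemma measurable_dcone w e : measurable (dcone w e).
Proof.
have m1 : measurable_fun [set: 'rV[R]_n.+1] (fun x => enorm (x - enorm x *: w)).
  apply: (measurableT_comp (@measurable_enorm R n.+1)).
  apply/measurable_fun_rVP => i.
  rewrite (_ : _ \o _ = (fun x => rV_coord i x - enorm x * w ord0 i)); last first.
    by apply/funext => x; rewrite /= /rV_coord !mxE.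
  apply: measurable_funB; first exact: measurable_rV_coord.
  by apply: measurable_funM => //; exact: measurable_enorm.
have m2 : measurable_fun [set: 'rV[R]_n.+1] (fun x => e * enorm x).
  by apply: measurable_funM => //; exact: measurable_enorm.
rewrite [X in measurable X](_ : _ =
  (fun x => enorm (x - enorm x *: w) < e * enorm x) @^-1` [set true]).
  rewrite -[X in measurable X]setTI.
  by apply: (measurable_fun_ltr m1 m2).
by apply/seteqP; split => x.
Qed.

Lemma is_cone_dcone w e : is_cone (dcone w e).
Proof.
move=> t x t0 /= h; rewrite /dcone /= enormZ gtr0_norm//.
rewrite -scalerA -scalerBr enormZ gtr0_norm// mulrCA ltr_pM2l//.
Qed.

Lemma bernoulli_le (e : R) m : 0 <= e <= 1 -> 1 - (1 - e) ^+ m <= m%:R * e.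
Proof.
move=> /andP[e0 e1]; elim: m => [|m IH]; first by rewrite expr0 subrr mul0r.
have h : 0 <= (1 - e) ^+ m by rewrite exprn_ge0 ?subr_ge0.
have h1 : (1 - e) ^+ m <= 1 by rewrite exprn_ile1 ?subr_ge0// gerBl.
rewrite exprS -natr1; nra.
Qed.

(* A cube of side [e / (8 * n.+1)] fits into the part of the cone in the shell
   [1 - e <= |x| < 1], whose measure is at most [n.+1 * e] times the solid
   angle. *)
Lemma solid_angle_dcone w (e : R) : enorm w = 1 -> 0 < e < 1 ->
  e ^+ n / (n.+1%:R * (8 * n.+1%:R) ^+ n.+1) <= solid_angle (dcone w e).
Proof.
move=> w1 /andP[e0 e1].
set N : R := n.+1%:R; have N0 : 0 < N by rewrite ltr0n.
pose eta := e / (16 * N).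
have eta0 : 0 < eta by rewrite divr_gt0// mulr_gt0.
pose c : 'rV[R]_n.+1 := (1 - e / 2) *: w.
pose Q := [set x : 'rV[R]_n.+1 | forall i, `|x ord0 i - c ord0 i| < eta].
have Qsub : Q `<=` dcone w e `&` shell (1 - e) 1.
  move=> x /= Qx.
  have xc : enorm (x - c) <= e / 16.
    have -> : e / 16 = N * eta by rewrite /eta; field; exact: lt0r_neq0.
    apply: enorm_le_coord => [|i]; first exact: ltW.
    by have := ltW (Qx i); rewrite !mxE.
  have nc : enorm c = 1 - e / 2 by rewrite enormZ w1 mulr1 gtr0_norm//; lra.
  have := enorm_dist x c; rewrite nc => /le_trans/(_ xc); rewrite ler_norml.
  move=> /andP[h1 h2].
  split; last by rewrite /shell/=; apply/andP; split; lra.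
  rewrite /dcone/=.
  (* Both terms have norm at most e / 16, while |x| >= 7 / 16 makes the opening e |x| of the cone at
     [x] larger than e / 8. *)
  have -> : x - enorm x *: w = (x - c) + (1 - e / 2 - enorm x) *: w.
    by rewrite [in RHS]scalerBl -/c addrA subrK.
  apply: (le_lt_trans (enorm_triangle _ _)).
  rewrite enormZ w1 mulr1.
  have h3 : `|1 - e / 2 - enorm x| <= e / 16.
    by rewrite ler_norml; apply/andP; split; lra.
  have h4 : 7 / 16 <= enorm x by lra.
  have : 7 / 16 * e <= enorm x * e by rewrite ler_pM2r.
  lra.
have e1' : 0 < 1 - e by lra.
have mD := measurable_dcone w e.
have : (lam Q <= lam (dcone w e `&` shell (1 - e) 1))%E.
  apply: le_measure => //; rewrite inE; first exact: measurable_cube.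
  by apply: measurableI => //; exact: measurable_shell.
rewrite lebesgue_cone_shell//; [|exact: is_cone_dcone|lra].
rewrite lebesgue_rV_cube// lee_fin expr1n => h.
have B : 1 - (1 - e) ^+ n.+1 <= N * e by apply: bernoulli_le; lra.
have k0 : 0 <= solid_angle (dcone w e) by exact: solid_angle_ge0.
have {}h : (2 * eta) ^+ n.+1 <= N * e * solid_angle (dcone w e).
  by apply: (le_trans h); rewrite ler_wpM2r.
rewrite ler_pdivrMr ?mulr_gt0 ?exprn_gt0 ?mulr_gt0//.
have E : (2 * eta) ^+ n.+1 * (8 * N) ^+ n.+1 = e * e ^+ n.
  by rewrite -exprMn -exprS; congr (_ ^+ _); rewrite /eta; field; exact: lt0r_neq0.
rewrite -(ler_pM2l e0) -E.
apply: (@le_trans _ _ (N * e * solid_angle (dcone w e) * (8 * N) ^+ n.+1)).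
  by rewrite ler_wpM2r// exprn_ge0// mulr_ge0// ltW.
by rewrite le_eqVlt; apply/orP; left; apply/eqP; ring.
Qed.

End shells.

(** * A fractional Gagliardo-Nirenberg inequality *)

Section young.
Context {R : realType}.
Implicit Types x y : R.

(** Weighted arithmetic-geometric mean inequality for [x], [y] and 1, the number 1 carrying the
    weight missing from [th1 + th2]. The proof bounds [ln] by its tangent at the weighted mean
    [m]. *)
Lemma young2 (th1 th2 x y : R) : 0 <= th1 -> 0 <= th2 -> th1 + th2 <= 1 ->
  0 <= x -> 0 <= y ->
  x `^ th1 * y `^ th2 <= th1 * x + th2 * y + (1 - th1 - th2).
Proof.
move=> h1 h2 h3.
have pos x' y' : 0 < x' -> 0 < y' ->
    x' `^ th1 * y' `^ th2 <= th1 * x' + th2 * y' + (1 - th1 - th2).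
  move=> x0 y0; set m := (X in _ <= X).
  have m0 : 0 < m.
    rewrite /m; have [t1|t1] := eqVneq th1 0; last first.
      have : 0 < th1 * x' by rewrite mulr_gt0// lt_neqAle eq_sym t1.
      have : 0 <= th2 * y' by rewrite mulr_ge0// ltW.
      lra.
    have [t2|t2] := eqVneq th2 0; first by rewrite t1 t2; lra.
    have : 0 < th2 * y' by rewrite mulr_gt0// lt_neqAle eq_sym t2.
    have : 0 <= th1 * x' by rewrite mulr_ge0// ltW.
    lra.
  have lnle z : 0 < z -> ln z <= ln m + z / m - 1.
    move=> z0; have zm : 0 < z / m by rewrite divr_gt0.
    have : 1 + (z / m - 1) = z / m by ring.
    have : ln (1 + (z / m - 1)) <= z / m - 1 by apply: le_ln1Dx; lra.
    move=> + E; rewrite E ln_div ?posrE//; lra.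
  have lx := lnle _ x0; have ly := lnle _ y0; have l1 := lnle _ (ltr01 : 0 < 1 :> R).
  rewrite ln1 in l1.
  have mE : th1 * (x' / m) + th2 * (y' / m) + (1 - th1 - th2) * (1 / m) = 1.
    rewrite [LHS](_ : _ = m / m); first by rewrite divff// lt0r_neq0.
    by rewrite [in RHS]/m; ring.
  rewrite -ler_ln ?posrE ?mulr_gt0 ?powR_gt0//.
  rewrite lnM ?posrE ?powR_gt0// !ln_powR.
  have := ler_wpM2l h1 lx; have := ler_wpM2l h2 ly.
  have : 0 <= 1 - th1 - th2 by lra.
  move=> h4; have := ler_wpM2l h4 l1.
  move: mE; set X := x' / m; set Y := y' / m; set Z := 1 / m.
  nra.
move=> x0 y0.
(* A zero base to the power zero is 1; in that case the base is irrelevant and 1 is put in its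
   place. *)
have [xe|xe] := eqVneq x 0.
  have [t1|t1] := eqVneq th1 0; last first.
    rewrite xe powR0// mul0r mulr0 add0r addr_ge0 ?mulr_ge0//; lra.
  have [ye|ye] := eqVneq y 0.
    have [t2|t2] := eqVneq th2 0; first by rewrite t1 t2 !powRr0; lra.
    rewrite ye powR0// !mulr0 xe; lra.
  have := pos 1 y ltr01; rewrite lt_neqAle eq_sym ye y0 => /(_ isT).
  by rewrite t1 !powRr0 !mul0r.
have [ye|ye] := eqVneq y 0.
  have [t2|t2] := eqVneq th2 0; last first.
    rewrite ye powR0// !mulr0 addr0 addr_ge0 ?mulr_ge0//; lra.
  have := pos x 1; rewrite lt_neqAle eq_sym xe x0 => /(_ isT ltr01).
  by rewrite t2 !powRr0 !mul0r.
by apply: pos; rewrite lt_neqAle eq_sym ?xe ?ye.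
Qed.

End young.

Section hoelder.
Context d (T : measurableType d) (R : realType).
Variables (mu : {measure set T -> \bar R}) (D : set T) (mD : measurable D).
Local Open Scope ereal_scope.

Lemma ge0_integral_eq0 (F : T -> \bar R) : measurable_fun D F ->
  (forall x, D x -> 0 <= F x) -> \int[mu]_(x in D) F x = 0 ->
  {ae mu, forall x, D x -> F x = 0}.
Proof.
move=> mF F0 iF.
have /ae_eq_integral_abs := mF; move=> /(_ mu mD) [+ _]; apply.
rewrite -[RHS]iF; apply: eq_integral => x; rewrite inE => Dx.
by rewrite gee0_abs// F0.
Qed.

Lemma ae0_integral (F : T -> \bar R) : measurable_fun D F ->
  (forall x, D x -> 0 <= F x) -> {ae mu, forall x, D x -> F x = 0} ->
  \int[mu]_(x in D) F x = 0.
Proof.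
move=> mF F0 ae0; rewrite (ge0_ae_eq_integral (g := cst 0))//.
  by rewrite integral0.
Qed.

Variables (F : T -> \bar R) (G : T -> R) (th1 th2 A B : R).
Hypotheses (th1_gt0 : (0 < th1)%R) (th2_ge0 : (0 <= th2)%R)
  (th12 : (th1 + th2 = 1)%R).
Hypotheses (mF : measurable_fun D F) (mG : measurable_fun D G).
Hypotheses (F0 : forall x, D x -> 0 <= F x) (G0 : forall x, D x -> (0 <= G x)%R).
Hypotheses (A0 : (0 <= A)%R) (B0 : (0 <= B)%R).
Hypotheses (FA : \int[mu]_(x in D) F x <= A%:E)
  (GB : \int[mu]_(x in D) (G x)%:E <= B%:E).

Let mFG : measurable_fun D (fun x => F x `^ th1 * (G x `^ th2)%:E).
Proof.
apply: emeasurable_funM.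
  exact: (measurableT_comp (@measurable_poweR R th1) mF).
apply/measurable_EFinP.
exact: (measurableT_comp (@measurable_powR R th2) mG).
Qed.

(** Young's inequality for [F / A] and [G / B], integrated. [F] may take the value [+oo], since it
    will be a Gagliardo integral. The exponent [th2] may vanish, which is the case a = 1; when [A]
    or [B] is zero and its exponent is not, the product vanishes almost everywhere. *)
Lemma integral_hoelder :
  \int[mu]_(x in D) (F x `^ th1 * (G x `^ th2)%:E) <= (A `^ th1 * B `^ th2)%:E.
Proof.
have FG0 x : D x -> 0 <= F x `^ th1 * (G x `^ th2)%:E.
  by move=> Dx; rewrite mule_ge0 ?poweR_ge0// lee_fin powR_ge0.
have th1n0 : th1 != 0%R by exact: lt0r_neq0.
have [AE|AE] := eqVneq A 0%R.
  have : \int[mu]_(x in D) F x = 0.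
    by apply/eqP; rewrite eq_le integral_ge0// andbT (le_trans FA)// AE.
  move=> /(ge0_integral_eq0 mF F0) ae0.
  rewrite ae0_integral//; first by rewrite AE powR0// mul0r.
  apply: filterS ae0 => x h Dx; rewrite h// poweR0r// mul0e//.
have [t2|t2] := eqVneq th2 0%R.
  have t1 : th1 = 1%R by rewrite -th12 t2 addr0.
  rewrite t1 t2 powRr0 mulr1 powRr1//.
  rewrite (eq_integral F)// => x /set_mem Dx.
  by rewrite powRr0 mule1 poweRe1 ?F0.
have [BE|BE] := eqVneq B 0%R.
  have mGE : measurable_fun D (EFin \o G) by exact/measurable_EFinP.
  have : \int[mu]_(x in D) (G x)%:E = 0.
    by apply/eqP; rewrite eq_le (le_trans GB) ?BE//= integral_ge0.
  move=> /(ge0_integral_eq0 mGE) ae0.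
  have {}ae0 : {ae mu, forall x, D x -> (G x)%:E = 0}.
    by apply: ae0 => x Dx; rewrite lee_fin G0.
  rewrite ae0_integral//; first by rewrite BE powR0// mulr0.
  apply: filterS ae0 => x h Dx.
  by have [->] := h Dx; rewrite powR0// mule0.
have Ap : (0 < A)%R by rewrite lt_neqAle eq_sym AE.
have Bp : (0 < B)%R by rewrite lt_neqAle eq_sym BE.
set P := (A `^ th1 * B `^ th2)%R.
have P0 : (0 < P)%R by rewrite mulr_gt0// powR_gt0.
pose c1 := (P * th1 / A)%R; pose c2 := (P * th2 / B)%R.
have c10 : (0 < c1)%R by rewrite divr_gt0// mulr_gt0.
have c20 : (0 <= c2)%R by rewrite divr_ge0// mulr_ge0// ltW.
apply: (@le_trans _ _ (\int[mu]_(x in D) (c1%:E * F x + c2%:E * (G x)%:E))).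
  apply: ge0_le_integral => //.
    apply: emeasurable_funD; apply: emeasurable_funM => //.
    exact/measurable_EFinP.
  move=> x Dx; have := F0 Dx; case: (F x) => [f f0| |//]; last first.
    by move=> _; rewrite gt0_muley ?lte_fin// addye ?leey// -EFinM.
  rewrite poweR_EFin -!EFinM -EFinD lee_fin.
  have f0' : (0 <= f / A)%R by rewrite divr_ge0.
  have g0' : (0 <= G x / B)%R by rewrite divr_ge0// G0.
  have := young2 (ltW th1_gt0) th2_ge0 _ f0' g0'.
  rewrite th12 lexx => /(_ isT).
  have -> : (1 - th1 - th2 = 0)%R by rewrite -addrA -opprD th12 subrr.
  rewrite addr0 => h.
  have fE : (f `^ th1 = (f / A) `^ th1 * A `^ th1)%R.
    by rewrite -powRM ?divfK.
  have gE : (G x `^ th2 = (G x / B) `^ th2 * B `^ th2)%R.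
    by rewrite -powRM ?divfK.
  have -> : (c1 * f + c2 * G x = P * (th1 * (f / A) + th2 * (G x / B)))%R.
    by rewrite /c1 /c2; field; rewrite AE BE.
  rewrite fE gE mulrACA [(A `^ th1 * _)%R]mulrC [leLHS]mulrC -/P.
  by rewrite [(B `^ th2 * _)%R]mulrC -/P ler_pM2l.
rewrite ge0_integralD//; last 4 first.
- by move=> x Dx; rewrite mule_ge0 ?F0// lee_fin ltW.
- by apply: emeasurable_funM.
- by move=> x Dx; rewrite mule_ge0 ?lee_fin ?G0.
- by apply: emeasurable_funM => //; exact/measurable_EFinP.
rewrite !ge0_integralZl_EFin ?(ltW c10)//; last exact/measurable_EFinP.
apply: (@le_trans _ _ (c1%:E * A%:E + c2%:E * B%:E)).
  by apply: leeD; apply: lee_wpmul2l => //; rewrite lee_fin// ltW.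
rewrite -!EFinM -EFinD lee_fin /c1 /c2 !divfK// -mulrDr th12 mulr1//.
Qed.

End hoelder.

(** Jensen's inequality for the power [p], obtained from Hoelder against the constant 1; [Z] bounds
    the mean of [phi ^ p]. *)
Lemma power_mean d (T : measurableType d) (R : realType)
    (mu : {measure set T -> \bar R}) (J : set T) (phi : T -> R) (p Z m : R) :
  1 <= p -> measurable J -> measurable_fun J phi ->
  (forall x, J x -> 0 <= phi x) -> 0 < m -> mu J = m%:E -> 0 <= Z ->
  (\int[mu]_(x in J) (phi x `^ p)%:E <= (Z * m)%:E ->
   \int[mu]_(x in J) (phi x)%:E <= (Z `^ p^-1 * m)%:E)%E.
Proof.
move=> p1 mJ mphi phi0 m0 muJ Z0 h.
have p0 : 0 < p by lra.
have ip0 : 0 < p^-1 by rewrite invr_gt0.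
have ip1 : 0 <= 1 - p^-1 by rewrite subr_ge0 invf_le1.
have mF : measurable_fun J (fun x => (phi x `^ p)%:E).
  by apply/measurable_EFinP; exact: (measurableT_comp (@measurable_powR R p)).
have Zm : 0 <= Z * m by rewrite mulr_ge0// ltW.
have F0 x : J x -> (0 <= (phi x `^ p)%:E)%E by rewrite lee_fin powR_ge0.
have G0 x : J x -> 0 <= cst 1 x :> R by [].
have Gm : (\int[mu]_(x in J) (cst 1 x)%:E <= m%:E)%E.
  by have := integral_cst mu mJ 1%E; rewrite mul1e muJ => ->.
have := @integral_hoelder _ _ _ mu J mJ (fun x => (phi x `^ p)%:E) (cst 1)
  p^-1 (1 - p^-1) (Z * m) m ip0 ip1 (subrKC _ _) mF (measurable_cst _)
  F0 G0 Zm (ltW m0) h Gm.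
rewrite (eq_integral (fun x => (phi x)%:E)); last first.
  move=> x /set_mem Jx.
  rewrite /= powR1 mule1 -powRrM divff ?lt0r_neq0// powRr1//.
  exact: phi0.
rewrite (_ : (Z * m) `^ p^-1 * m `^ (1 - p^-1) = Z `^ p^-1 * m)//.
rewrite powRM ?(ltW m0)// -mulrA -powRD; last by rewrite subrKC oner_eq0.
by rewrite subrKC powRr1// ltW.
Qed.

(* [G] is a difference quotient, [H] a norm: choosing [de] so that the two
   terms balance gives the multiplicative bound; if that [de] exceeds 1 then
   [G <= H] and the bound at [de = 1] suffices. *)
Lemma optimal_scale (R : realType) (s tau c0 G H X : R) :
  0 < s -> 0 < tau -> 0 < c0 -> 0 <= G -> 0 < H -> X <= G ->
  (forall de, 0 < de <= 1 ->
    X <= G * de `^ s + (c0 * de) `^ (- tau^-1) * H) ->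
  X <= (1 + c0 `^ (- tau^-1)) *
    (G `^ (1 + s * tau)^-1 * H `^ (1 - (1 + s * tau)^-1)).
Proof.
move=> s0 tau0 c00 G0 H0 XG Xde; set th := (1 + s * tau)^-1.
have st : 0 < s * tau by rewrite mulr_gt0.
have st1 : 0 < 1 + s * tau by rewrite addr_gt0.
have t0 : 0 < th by rewrite invr_gt0.
have t1 : th < 1 by rewrite invf_lt1// ltrDl.
have C0 : 0 <= c0 `^ (- tau^-1) by exact: powR_ge0.
have C11 : 1 <= 1 + c0 `^ (- tau^-1) by rewrite lerDl.
have X0 : 0 <= G `^ th * H `^ (1 - th) by rewrite mulr_ge0// powR_ge0.
have [Ge|Gn] := eqVneq G 0.
  by rewrite Ge in XG; rewrite (le_trans XG)// mulr_ge0 ?addr_ge0// mulr_ge0 ?powR_ge0.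
have Gp : 0 < G by rewrite lt_neqAle eq_sym Gn.
have [HG|HG] := leP G H.
  apply: (le_trans XG); apply: (@le_trans _ _ (G `^ th * H `^ (1 - th))).
    rewrite -{1}[G]powRr1// -{1}(subrKC th 1) powRD; last first.
      by rewrite subrKC oner_eq0.
    rewrite ler_wpM2l ?powR_ge0// ge0_ler_powR ?nnegrE ?(ltW H0)//.
    by rewrite subr_ge0 ltW.
  by rewrite ler_peMl.
pose e := (s + tau^-1)^-1.
have ti0 : 0 < tau^-1 by rewrite invr_gt0.
have sti0 : 0 < s + tau^-1 by rewrite addr_gt0.
have e0 : 0 < e by rewrite invr_gt0.
pose de := (H / G) `^ e.
have HG0 : 0 < H / G by rewrite divr_gt0.
have de01 : 0 < de <= 1.
  have : de <= 1 `^ e.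
    rewrite /de ge0_ler_powR ?nnegrE ?(ltW e0) ?(ltW HG0)//.
    by rewrite ler_pdivrMr// mul1r ltW.
  by rewrite powR1 powR_gt0.
have n1 : s * tau + 1 != 0 by rewrite addrC lt0r_neq0.
have n2 : 1 + s * tau != 0 by rewrite lt0r_neq0.
have n3 : tau != 0 by rewrite lt0r_neq0.
have es : e * s = 1 - th by rewrite /e /th; field; rewrite ?n1 ?n2 ?n3.
have et : e * - tau^-1 = - th by rewrite /e /th; field; rewrite ?n1 ?n2 ?n3.
apply: (le_trans (Xde de de01)).
have d0 : 0 <= de by exact: powR_ge0.
rewrite powRM ?(ltW c00)// /de -!(powRrM (H / G)) es et.
have HGE (b : R) : (H / G) `^ b = H `^ b * G `^ (- b).
  by rewrite powRM ?invr_ge0 ?(ltW H0)// -(powR_inv1 (ltW Gp)) -powRrM mulN1r.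
have -> : G * (H / G) `^ (1 - th) = G `^ th * H `^ (1 - th).
  have -> : G `^ th = G * G `^ (- (1 - th)).
    rewrite -[X in _ = X * _]powRr1// -powRD ?Gn ?implybT//.
    by congr (_ `^ _); ring.
  by rewrite HGE; ring.
have -> : c0 `^ (- tau^-1) * (H / G) `^ (- th) * H =
    c0 `^ (- tau^-1) * (G `^ th * H `^ (1 - th)).
  have -> : H `^ (1 - th) = H `^ (- th) * H.
    rewrite -[X in _ = _ * X]powRr1 ?(ltW H0)// -powRD ?(lt0r_neq0 H0) ?implybT//.
    by congr (_ `^ _); ring.
  by rewrite HGE opprK; ring.
by rewrite mulrDl mul1r.
Qed.

(* A fractional Gagliardo-Nirenberg inequality on a probability space.  The
   hypothesis [hosc] replaces the kernel of a one-dimensional Gagliardo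
   seminorm: [k x] bounds [de ^ (- s p)] times the mean of [|h - h x| ^ p] over
   some set of measure at least [c0 * de]. *)
Section cell.
Context d (T : measurableType d) (R : realType).
Variables (mu : {measure set T -> \bar R}) (D : set T) (mD : measurable D).
Hypothesis muD : mu D = 1%E.
Variables (s p q tau a c0 M : R).
Hypotheses (s0 : 0 < s) (p1 : 1 < p) (q1 : 1 <= q) (tau1 : 1 <= tau)
  (a0 : 0 < a) (a1 : a <= 1) (c00 : 0 < c0)
  (tauE : tau^-1 = a * (p^-1 - s) + (1 - a) * q^-1).
Variables (h : T -> R) (k : T -> \bar R).
Hypotheses (mh : measurable_fun setT h) (hM : forall x, `|h x| <= M)
  (hmean : (\int[mu]_(x in D) (h x)%:E = 0)%E)
  (mk : measurable_fun setT k) (k0 : forall x, (0 <= k x)%E).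
Hypothesis hosc : forall x (de : R), D x -> 0 < de <= 1 ->
  exists J : set T, [/\ measurable J, J `<=` D, ((c0 * de)%:E <= mu J)%E,
    (de = 1 -> J = D) &
    (\int[mu]_(y in J) (`|h y - h x| `^ p)%:E <=
      k x * (de `^ (s * p))%:E * mu J)%E].

Let p0 : 0 < p. Proof. exact: lt_trans p1. Qed.
Let q0 : 0 < q. Proof. exact: lt_le_trans q1. Qed.
Let tau0 : 0 < tau. Proof. exact: lt_le_trans tau1. Qed.

Let mabs (b : R) (E : set T) : measurable E ->
  measurable_fun E (fun x => (`|h x| `^ b)%:E).
Proof.
move=> mE; apply/measurable_EFinP.
apply: (measurableT_comp (@measurable_powR R b)).
apply: (measurableT_comp (@normr_measurable R setT)).
exact: measurable_funS mh.
Qed.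

Let Hint : (\int[mu]_(x in D) (`|h x| `^ tau)%:E)%E \is a fin_num.
Proof.
rewrite ge0_fin_numE; last by apply: integral_ge0 => x _; rewrite lee_fin powR_ge0.
apply: (@le_lt_trans _ _ (\int[mu]_(x in D) (M `^ tau)%:E)%E).
  apply: ge0_le_integral => //.
  - exact: mabs.
  - move=> x _; rewrite lee_fin ge0_ler_powR ?nnegrE//; first exact: ltW.
    exact: le_trans (hM x).
by rewrite integral_cst// muD mule1 ltry.
Qed.

Let I := fine (\int[mu]_(x in D) (`|h x| `^ tau)%:E)%E.
Let IE : (\int[mu]_(x in D) (`|h x| `^ tau)%:E)%E = I%:E.
Proof. by rewrite /I fineK. Qed.
Let I0 : 0 <= I.
Proof. by rewrite fine_ge0// integral_ge0// => x _; rewrite lee_fin powR_ge0. Qed.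
Let H := I `^ tau^-1.

Let H_tau : H `^ tau = I.
Proof. by rewrite -powRrM mulVf ?powRr1// lt0r_neq0. Qed.

Let th := (1 + s * tau)^-1.

(** For [de = 1] the set in [hosc] is all of [D], where [h] has mean zero; hence |h x| is the
    modulus of the mean of [h - h x]. *)
Let pointwise1 x (K : R) : D x -> k x = K%:E -> `|h x| <= K `^ p^-1.
Proof.
move=> Dx kx; have K0 : 0 <= K by rewrite -lee_fin -kx.
have [] := hosc Dx (_ : 0 < 1 <= 1); first by rewrite ltr01 lexx.
move=> J [mJ _ _ /(_ erefl) -> {J mJ}].
rewrite powR1 kx muD !mule1 => osc.
have mphi (E : set T) : measurable E -> measurable_fun E (fun y => `|h y - h x|).
  move=> mE; apply: (measurableT_comp (@normr_measurable R setT)).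
  by apply: measurable_funB => //; exact: measurable_funS mh.
have := @power_mean _ _ _ mu D (fun y => `|h y - h x|) p K 1 (ltW p1) mD
  (mphi _ mD) (fun _ _ => normr_ge0 _) ltr01 muD K0.
rewrite !mulr1 => /(_ osc); rewrite -lee_fin; apply: le_trans.
have ih : mu.-integrable D (EFin \o h).
  apply: measurable_bounded_integrable => //; first by rewrite muD ltry.
    exact: measurable_funS mh.
  exists M; split; first exact: num_real.
  by move=> N MN y _; rewrite /= (le_trans (hM y))// ltW.
have ic : mu.-integrable D (EFin \o cst (h x)).
  apply: measurable_bounded_integrable => //; first by rewrite muD ltry.
  exists `|h x|; split; first exact: num_real.
  by move=> N MN y _; rewrite /= ltW.
have -> : (`|h x|%:E = `| \int[mu]_(y in D) (h y - h x)%:E |)%E.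
  under eq_integral do rewrite EFinB.
  rewrite (integralB_EFin mD ih ic) hmean add0e abseN.
  by have := integral_cst mu mD (h x)%:E; rewrite muD mule1 => ->.
apply: (le_trans (le_abse_integral _ _ _)) => //.
apply/measurable_EFinP; apply: measurable_funB => //; exact: measurable_funS mh.
Qed.

(** |h x| is at most the mean over [J] of |h - h x| plus that of |h|. By Jensen the first is
    controlled by [hosc], the second by the norm [H] and the lower bound on the measure of [J]. *)
Let pointwise2 x (K de : R) : D x -> k x = K%:E -> 0 < de <= 1 ->
  `|h x| <= K `^ p^-1 * de `^ s + (c0 * de) `^ (- tau^-1) * H.
Proof.
move=> Dx kx de01; have K0 : 0 <= K by rewrite -lee_fin -kx.
have de0 : 0 < de by case/andP: de01.
have [J [mJ JD muJ _]] := hosc Dx de01; rewrite kx.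
have Jfin : mu J \is a fin_num.
  rewrite ge0_fin_numE//; apply: (@le_lt_trans _ _ (mu D)).
    by apply: le_measure; rewrite ?inE.
  by rewrite muD ltry.
rewrite -(fineK Jfin) in muJ *; set m := fine (mu J) in muJ *.
have muJE : mu J = m%:E by rewrite fineK.
rewrite lee_fin in muJ; rewrite -!EFinM => osc.
have cd0 : 0 < c0 * de by rewrite mulr_gt0.
have m0 : 0 < m by exact: lt_le_trans muJ.
have mphi : measurable_fun J (fun y => `|h y - h x|).
  apply: (measurableT_comp (@normr_measurable R setT)).
  by apply: measurable_funB => //; exact: measurable_funS mh.
have mabsh : measurable_fun J (fun y => `|h y|).
  apply: (measurableT_comp (@normr_measurable R setT)).
  exact: measurable_funS mh.
have Z0 : 0 <= K * de `^ (s * p) by rewrite mulr_ge0// powR_ge0.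
have h1 := @power_mean _ _ _ mu J (fun y => `|h y - h x|) p _ m (ltW p1) mJ
  mphi (fun _ _ => normr_ge0 _) m0 muJE Z0 osc.
have Im0 : 0 <= I / m by rewrite divr_ge0// ltW.
have h2 : (\int[mu]_(y in J) `|h y|%:E <= ((I / m) `^ tau^-1 * m)%:E)%E.
  apply: power_mean => //.
  rewrite divfK ?lt0r_neq0// -IE; apply: ge0_subset_integral => //.
  exact: mabs.
have : (`|h x|%:E * m%:E <= \int[mu]_(y in J) (`|h y - h x|%:E + `|h y|%:E))%E.
  have := integral_cst mu mJ (`|h x|%:E)%E; rewrite muJE => <-.
  apply: ge0_le_integral => //=.
  - by apply: emeasurable_funD; apply/measurable_EFinP.
  - move=> y _; rewrite -EFinD lee_fin.
    have := ler_normB (h y) (h y - h x); rewrite opprB addrC subrK addrC; lra.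
rewrite ge0_integralD//; last 2 first.
- exact/measurable_EFinP.
- exact/measurable_EFinP.
move=> /le_trans/(_ (leeD h1 h2)); rewrite -EFinD -EFinM lee_fin -mulrDl.
rewrite ler_pM2r// powRM// ?powR_ge0//.
rewrite -(powRrM de) mulfK ?lt0r_neq0// => /le_trans; apply.
rewrite lerD2l [(I / m) `^ _]powRM ?invr_ge0 ?(ltW m0)// mulrC ler_wpM2r ?powR_ge0//.
rewrite -(powR_inv1 (ltW m0)) -powRrM mulN1r !powRN lef_pV2 ?posrE ?powR_gt0//.
by rewrite ge0_ler_powR ?nnegrE ?invr_ge0 ?(ltW m0) ?(ltW tau0) ?(ltW cd0).
Qed.

Let C1 := 1 + c0 `^ (- tau^-1).

Let C10 : 0 < C1.
Proof. by rewrite /C1 ltr_pwDl// powR_ge0. Qed.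

Let pointwise x (K : R) : 0 < H -> D x -> k x = K%:E ->
  `|h x| <= C1 * (K `^ (th / p) * H `^ (1 - th)).
Proof.
move=> H0 Dx kx.
have := @optimal_scale R s tau c0 (K `^ p^-1) H `|h x| s0 tau0 c00
  (powR_ge0 _ _) H0 (pointwise1 Dx kx) (fun de => @pointwise2 x K de Dx kx).
by rewrite -(powRrM K) [p^-1 * _]mulrC.
Qed.

(** In [|h| ^ tau], the pointwise bound is applied to the power [tau * kap], and the rest is kept as
    a power of [|h| ^ q]. The share [kap] is chosen so that the resulting exponents, [e1] of [k] and
    [e2] of [|h| ^ q], add up to 1, as Hoelder requires; that they do is the content of [tauE]. *)
Let W := 1 + a * s * tau.
Let W0 : 0 < W. Proof. by rewrite addr_gt0// !mulr_gt0. Qed.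
Let kap := a * (1 + s * tau) / W.
Let e1 := a * tau / (p * W).
Let e2 := (1 - a) * tau / (q * W).

Let e10 : 0 < e1. Proof. by rewrite divr_gt0// mulr_gt0. Qed.
Let e20 : 0 <= e2.
Proof. by rewrite divr_ge0 ?mulr_ge0 ?subr_ge0 ?(ltW W0) ?(ltW q0) ?(ltW tau0). Qed.
Let e12 : e1 + e2 = 1.
Proof.
have Wn := lt0r_neq0 W0; have pn := lt0r_neq0 p0; have qn := lt0r_neq0 q0.
have tn := lt0r_neq0 tau0.
have -> : e1 + e2 = tau * (tau^-1 + a * s) / W.
  by rewrite tauE /e1 /e2; field; rewrite Wn pn qn.
have -> : tau * (tau^-1 + a * s) = W by rewrite mulrDr divff// /W; ring.
by rewrite divff.
Qed.

Let kap0 : 0 < kap.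
Proof. by rewrite divr_gt0// mulr_gt0// addr_gt0// mulr_gt0. Qed.

Let C2 := C1 `^ (tau * kap) * H `^ (tau * (1 - W^-1)).

Let pointwise_tau x : 0 < H -> D x ->
  ((`|h x| `^ tau)%:E <= C2%:E * (k x `^ e1 * ((`|h x| `^ q) `^ e2)%:E))%E.
Proof.
move=> H0 Dx.
have C20 : 0 < C2 by rewrite mulr_gt0// powR_gt0.
(* Zeros of [h] come first: elsewhere the last factor is positive, so an infinite [k x] makes the
   right-hand side infinite rather than [+oo] times 0. *)
have [->|hx0] := eqVneq (h x) 0.
  rewrite normr0 powR0 ?lt0r_neq0// mule_ge0 ?lee_fin ?(ltW C20)//.
  by rewrite mule_ge0 ?poweR_ge0// lee_fin powR_ge0.
have hp : 0 < `|h x| by rewrite normr_gt0.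
have := k0 x; case E : (k x) => [K | |//] K0; last first.
  rewrite poweRyr ?lt0r_neq0// gt0_mulye ?lte_fin ?powR_gt0//.
  by rewrite gt0_muley ?leey// lte_fin.
rewrite poweR_EFin -!EFinM lee_fin.
have Wn := lt0r_neq0 W0; have pn := lt0r_neq0 p0; have qn := lt0r_neq0 q0.
have tn := lt0r_neq0 tau0.
have n1 : s * tau + 1 != 0 by rewrite lt0r_neq0// addr_gt0// mulr_gt0.
have n2 : 1 + s * tau != 0 by rewrite addrC.
rewrite -(powRrM `|h x|).
have -> : q * e2 = tau * (1 - kap).
  have -> : 1 - kap = (1 - a) / W.
    by rewrite /kap -{1}(divff Wn) -mulrBl; congr (_ / _); rewrite /W; ring.
  by rewrite /e2; field; rewrite qn Wn.
have -> : `|h x| `^ tau = `|h x| `^ (tau * kap) * `|h x| `^ (tau * (1 - kap)).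
  rewrite -powRD; last by rewrite (lt0r_neq0 hp) implybT.
  by congr (_ `^ _); ring.
rewrite mulrA ler_wpM2r ?powR_ge0//.
have h1 := pointwise H0 Dx E.
apply: (@le_trans _ _ ((C1 * (K `^ (th / p) * H `^ (1 - th))) `^ (tau * kap))).
  have tk : 0 <= tau * kap by rewrite ltW// mulr_gt0.
  have Y0 : 0 <= C1 * (K `^ (th / p) * H `^ (1 - th)).
    by rewrite mulr_ge0 ?(ltW C10)// mulr_ge0// powR_ge0.
  by rewrite ge0_ler_powR ?nnegrE.
rewrite powRM ?(ltW C10) ?mulr_ge0 ?powR_ge0// powRM ?powR_ge0//.
rewrite -!(powRrM K) -(powRrM H) /C2.
rewrite (_ : th / p * (tau * kap) = e1); last first.
  by rewrite /th /kap /e1; field; rewrite ?n1 ?n2 ?Wn ?pn.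
rewrite (_ : (1 - th) * (tau * kap) = tau * (1 - W^-1)); last first.
  have -> : 1 - W^-1 = a * s * tau / W.
    have <- : W - 1 = a * s * tau by rewrite /W; ring.
    by rewrite mulrBl divff// mul1r.
  by rewrite /th /kap; field; rewrite ?n1 ?n2 ?Wn.
by rewrite -!mulrA; rewrite [K `^ e1 * _]mulrC.
Qed.

Let mq : measurable_fun D (fun x => `|h x| `^ q).
Proof. exact/measurable_EFinP/mabs. Qed.

Lemma cell_bound :
  ((\int[mu]_(x in D) (`|h x| `^ tau)%:E) `^ tau^-1 <=
   (C1 `^ (a * (1 + s * tau)))%:E * (\int[mu]_(x in D) k x) `^ (a / p) *
     (\int[mu]_(x in D) (`|h x| `^ q)%:E) `^ ((1 - a) / q))%E.
Proof.
have tn := lt0r_neq0 tau0; have Wn := lt0r_neq0 W0.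
rewrite IE poweR_EFin -/H.
have [H0|Hn] := eqVneq H 0.
  by rewrite H0 !mule_ge0 ?poweR_ge0// lee_fin powR_ge0.
have Hp : 0 < H by rewrite lt_neqAle eq_sym Hn powR_ge0.
set B := (\int[mu]_(x in D) (`|h x| `^ q)%:E)%E.
have B0 : (0 <= B)%E by apply: integral_ge0 => x _; rewrite lee_fin powR_ge0.
(* If [B] were zero, [h] would vanish almost everywhere and so would [H]. Positivity of [B] settles
   the case of an infinite [A]. *)
have Bp : (0 < B)%E.
  rewrite lt_neqAle B0 andbT eq_sym; apply/eqP => Be.
  have mqE : measurable_fun D (EFin \o (fun x => `|h x| `^ q)).
    exact/measurable_EFinP.
  have ae0 : {ae mu, forall x, D x -> (`|h x| `^ q)%:E = 0%E}.
    by apply: (ge0_integral_eq0 mD mqE) => // x _; rewrite lee_fin powR_ge0.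
  have : (\int[mu]_(x in D) (`|h x| `^ tau)%:E = 0)%E.
    apply: ae0_integral => //; first exact: mabs.
    apply: filterS ae0 => x hx /hx [] /powR_eq0_eq0 ->.
    by rewrite powR0.
  rewrite IE => -[I00]; move: Hn; rewrite /H I00 powR0 ?eqxx//.
  by rewrite invr_eq0.
have Bfin : B \is a fin_num.
  rewrite ge0_fin_numE//; apply: (@le_lt_trans _ _ (\int[mu]_(x in D) (M `^ q)%:E)%E).
    apply: ge0_le_integral => //; first exact: mabs.
    move=> x _; rewrite lee_fin ge0_ler_powR ?nnegrE//; first exact: ltW.
    exact: le_trans (hM x).
  by rewrite integral_cst// muD mule1 ltry.
have Cp : 0 < C1 `^ (a * (1 + s * tau)) by rewrite powR_gt0.
set A := (\int[mu]_(x in D) k x)%E.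
have A0 : (0 <= A)%E by exact: integral_ge0.
have [Ay|Afin] := eqVneq A +oo%E.
  rewrite Ay poweRyr ?lt0r_neq0 ?divr_gt0// gt0_muley ?lte_fin//.
  by rewrite gt0_mulye ?leey// poweR_gt0.
have {}Afin : A \is a fin_num by rewrite ge0_fin_numE// lt_neqAle Afin leey.
rewrite -(fineK Afin) -(fineK Bfin) !poweR_EFin -!EFinM lee_fin.
set A' := fine A; set B' := fine B.
have A'0 : 0 <= A' by exact: fine_ge0.
have B'0 : 0 <= B' by exact: fine_ge0.
have C20 : 0 <= C2 by rewrite mulr_ge0// powR_ge0.
have mk' : measurable_fun D k by exact: measurable_funS mk.
have mFG : measurable_fun D (fun x => k x `^ e1 * ((`|h x| `^ q) `^ e2)%:E)%E.
  apply: emeasurable_funM.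
    exact: (measurableT_comp (@measurable_poweR R e1) mk').
  apply/measurable_EFinP.
  exact: (measurableT_comp (@measurable_powR R e2) mq).
have FG0 x : D x -> (0 <= k x `^ e1 * ((`|h x| `^ q) `^ e2)%:E)%E.
  by move=> _; rewrite mule_ge0 ?poweR_ge0// lee_fin powR_ge0.
have : (I%:E <= C2%:E * (A' `^ e1 * B' `^ e2)%:E)%E.
  rewrite -IE; apply: (@le_trans _ _ (\int[mu]_(x in D)
      (C2%:E * (k x `^ e1 * ((`|h x| `^ q) `^ e2)%:E)))%E).
    apply: ge0_le_integral => //; first exact: mabs.
      by apply: emeasurable_funM.
    by move=> x Dx; exact: pointwise_tau.
  rewrite ge0_integralZl_EFin//.
  apply: lee_wpmul2l; first by rewrite lee_fin.
  apply: integral_hoelder => //.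
  - by rewrite -/A -(fineK Afin).
  - by rewrite -/B -(fineK Bfin).
rewrite -EFinM lee_fin -H_tau /C2.
(* The absorption: the second factor also occurs in [C2] and cancels, since [H] is positive and
   finite. Raising what remains to the power [W / tau] isolates [H]. *)
have -> : H `^ tau = H `^ (tau / W) * H `^ (tau * (1 - W^-1)).
  rewrite -powRD ?Hn ?implybT//; congr (_ `^ _); ring.
rewrite mulrAC ler_pM2r ?(powR_gt0 _ Hp)// => hW.
have Wt0 : 0 <= W / tau by rewrite divr_ge0 ?(ltW W0) ?(ltW tau0).
have := ge0_ler_powR Wt0; move=> /(_ (H `^ (tau / W)) _ _ _ hW).
rewrite !nnegrE powR_ge0 !mulr_ge0 ?powR_ge0// => /(_ isT isT).
rewrite -(powRrM H) (_ : tau / W * (W / tau) = 1); last by field; rewrite ?Wn ?tn.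
rewrite (powRr1 (ltW Hp)) => /le_trans; apply.
rewrite mulrA !powRM ?mulr_ge0 ?powR_ge0// -!powRrM.
have pn := lt0r_neq0 p0; have qn := lt0r_neq0 q0.
rewrite (_ : tau * kap * (W / tau) = a * (1 + s * tau)); last first.
  by rewrite /kap; field; rewrite ?Wn ?tn.
rewrite (_ : e1 * (W / tau) = a / p); last first.
  by rewrite /e1; field; rewrite ?Wn ?tn ?pn.
rewrite (_ : e2 * (W / tau) = (1 - a) / q); last first.
  by rewrite /e2; field; rewrite ?Wn ?tn ?qn.
by [].
Qed.

End cell.

(** * The inequality on one shell *)

Lemma powR_comparable (R : realType) (Lam e r z : R) :
  1 < Lam -> 0 < r -> r <= z <= Lam * r ->
  Lam `^ (- `|e|) * r `^ e <= z `^ e <= Lam `^ `|e| * r `^ e.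
Proof.
move=> L1 r0 /andP[rz zr].
have L0 : 0 < Lam by lra.
have z0 : 0 < z by lra.
pose t := z / r; have zE : z = t * r by rewrite divfK ?lt0r_neq0.
have t1 : 1 <= t by rewrite ler_pdivlMr// mul1r.
have tL : t <= Lam by rewrite ler_pdivrMr.
have t0 : 0 < t by lra.
rewrite zE powRM ?(ltW t0) ?(ltW r0)//.
rewrite !ler_pM2r ?powR_gt0//.
have lt0 : 0 <= ln t by exact: ln_ge0.
have ltL : ln t <= ln Lam by rewrite ler_ln ?posrE.
have h1 := ler_norm e; have h2 := ler_norm (- e); rewrite normrN in h2.
have h3 := normr_ge0 e.
by apply/andP; split; rewrite -ler_ln ?posrE ?powR_gt0// !ln_powR; nra.
Qed.

Section oscillation.
Context {R : realType} {n : nat}.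
Variables (s p alpha Lambda : R).
Hypotheses (s0 : 0 < s) (p1 : 1 < p) (L1 : 1 < Lambda).
Local Notation lam := (lebesgue_rV R n.+1).
Implicit Types (v : 'rV[R]_n.+1 -> R) (x y : 'rV[R]_n.+1).

Definition gagliardo v x y : R :=
  `|v x - v y| `^ p * enorm x `^ (alpha * p)
       / enorm (x - y) `^ (n.+1%:R + s * p)
       * chi Lambda (enorm x) (enorm y).

Lemma chi_ge0 (r1 r2 : R) : 0 <= chi Lambda r1 r2.
Proof. by rewrite /chi; case: ifP. Qed.

Lemma gagliardo_ge0 v x y : 0 <= gagliardo v x y.
Proof. by rewrite !mulr_ge0 ?powR_ge0 ?chi_ge0// invr_ge0 powR_ge0. Qed.

Lemma measurable_gagliardo v : measurable_fun setT v ->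
  measurable_fun [set: 'rV[R]_n.+1 * 'rV[R]_n.+1]
    (fun z => (gagliardo v z.1 z.2)%:E).
Proof.
move=> mv; apply/measurable_EFinP.
have me := @measurable_enorm R n.+1.
have me1 : measurable_fun [set: 'rV[R]_n.+1 * 'rV[R]_n.+1] (fun z => enorm z.1).
  exact: measurableT_comp.
have me2 : measurable_fun [set: 'rV[R]_n.+1 * 'rV[R]_n.+1] (fun z => enorm z.2).
  exact: measurableT_comp.
have mv1 : measurable_fun [set: 'rV[R]_n.+1 * 'rV[R]_n.+1] (fun z => v z.1).
  exact: measurableT_comp.
have mv2 : measurable_fun [set: 'rV[R]_n.+1 * 'rV[R]_n.+1] (fun z => v z.2).
  exact: measurableT_comp.
have md : measurable_fun [set: 'rV[R]_n.+1 * 'rV[R]_n.+1]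
    (fun z => enorm (z.1 - z.2)).
  apply: (measurableT_comp me); apply/measurable_fun_rVP => i.
  rewrite (_ : _ \o _ = (fun z => rV_coord i z.1 - rV_coord i z.2)); last first.
    by apply/funext => z; rewrite /= /rV_coord !mxE.
  by apply: measurable_funB; (apply: measurableT_comp => //;
    exact: measurable_rV_coord).
apply: measurable_funM; last first.
  rewrite /chi; apply: measurable_fun_ifT => //.
  apply: measurable_and; apply: measurable_fun_ler => //;
    exact: measurable_funM.
apply: measurable_funM; last first.
  have mV : measurable_fun [set: 'rV[R]_n.+1 * 'rV[R]_n.+1]
      (fun z => enorm (z.1 - z.2) `^ (- (n.+1%:R + s * p))).
    exact: (measurableT_comp (@measurable_powR R _) md).
  by apply: eq_measurable_fun mV => z _; rewrite powRN.
apply: measurable_funM.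
  apply: (measurableT_comp (@measurable_powR R _)).
  apply: (measurableT_comp (@normr_measurable R setT)).
  exact: measurable_funB.
exact: (measurableT_comp (@measurable_powR R _) me1).
Qed.

Definition gagliardo_int v y : \bar R := (\int[lam]_x (gagliardo v x y)%:E)%E.

Lemma gagliardo_int_ge0 v y : (0 <= gagliardo_int v y)%E.
Proof. by apply: integral_ge0 => x _; rewrite lee_fin gagliardo_ge0. Qed.

Lemma measurable_gagliardo_int v : measurable_fun setT v ->
  measurable_fun setT (gagliardo_int v).
Proof.
move=> mv.
apply: (measurable_fun_fubini_tonelli_G (m1 := lam)
  (fun z => (gagliardo v z.1 z.2)%:E)).
  exact: measurable_gagliardo.
by move=> z; rewrite lee_fin gagliardo_ge0.
Qed.

(** The first line bounds the ratio of the solid angles of the whole space and of the cone of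
    aperture de / 2, up to de^n. The power of [2 * Lambda] comes from |x - y| <= 2 Lambda de r, and
    the last factor from comparing |x|^(alpha p) with r^(alpha p) on the shell. *)
Definition osc_cst : R :=
  solid_angle [set: 'rV[R]_n.+1] * (n.+1%:R * (8 * n.+1%:R) ^+ n.+1 * 2 ^+ n) *
  (2 * Lambda) `^ (n.+1%:R + s * p) * Lambda `^ `|alpha * p|.

Lemma osc_cst_gt0 : 0 < osc_cst.
Proof.
have L0 : 0 < Lambda by exact: lt_trans L1.
rewrite !mulr_gt0 ?powR_gt0 ?exprn_gt0 ?mulr_gt0 ?ltr0n//.
exact: solid_angleT_gt0.
Qed.

(* The shell is [r, Lambda r[ contracted by the factor [de] towards [|y|].  In it,
   the cone of aperture [de / 2] around [y] lies within [2 Lambda de r] of [y];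
   for radial [v], passing from the shell to this cone only costs a factor
   [de ^ n], so that the exponent [n.+1 + s p] of the kernel drops to [1 + s p]. *)
Lemma radial_oscillation v r (de : R) y :
  measurable_fun setT v -> radial v -> 0 < r -> 0 < de <= 1 ->
  r <= enorm y < Lambda * r ->
  (\int[lam]_(x in shell ((1 - de) * enorm y + de * r)
                         ((1 - de) * enorm y + de * (Lambda * r)))
      (`|v x - v y| `^ p)%:E <=
   (osc_cst * de `^ (1 + s * p) * r `^ (n.+1%:R + s * p - alpha * p))%:E
   * gagliardo_int v y)%E.
Proof.
move=> mv rv r0 /andP[de0 de1] /andP[ry yr].
set J := shell _ _.
have L0 : 0 < Lambda by exact: lt_trans L1.
have p0 : 0 < p by exact: lt_trans p1.
set w := (enorm y)^-1 *: y.
have y0 : 0 < enorm y by lra.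
have w1 : enorm w = 1.
  by rewrite enormZ gtr0_norm ?invr_gt0// mulVf// lt0r_neq0.
set K := dcone w (de / 2).
have mK : measurable K by exact: measurable_dcone.
have de2 : 0 < de / 2 < 1 by lra.
have kK := solid_angle_dcone w1 de2; rewrite -/K in kK.
set N : R := n.+1%:R in kK *.
have N0 : 0 < N by rewrite ltr0n.
set om := solid_angle [set: 'rV[R]_n.+1].
have om0 : 0 < om by exact: solid_angleT_gt0.
have k0 : 0 < solid_angle K.
  apply: lt_le_trans kK; apply: divr_gt0; first by rewrite exprn_gt0//; lra.
  by rewrite mulr_gt0// exprn_gt0// mulr_gt0.
have mphi : measurable_fun setT (fun x => (`|v x - v y| `^ p)%:E).
  apply/measurable_EFinP; apply: (measurableT_comp (@measurable_powR R _)).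
  apply: (measurableT_comp (@normr_measurable R setT)).
  exact: measurable_funB.
have phi0 x : (0 <= (`|v x - v y| `^ p)%:E)%E by rewrite lee_fin powR_ge0.
have mJ : measurable J by exact: measurable_shell.
have mKJ : measurable (K `&` J) by exact: measurableI.
have rphi x z : enorm x = enorm z ->
  (`|v x - v y| `^ p)%:E = (`|v z - v y| `^ p)%:E by move=> /rv ->.
have := @ge0_integral_radial_cone R n (fun x => (`|v x - v y| `^ p)%:E) K
  ((1 - de) * enorm y + de * r) ((1 - de) * enorm y + de * (Lambda * r))
  mK (@is_cone_dcone R n w _) mphi phi0 rphi.
rewrite -/J -/om => polar.
set D : R := N + s * p.
have D0 : 0 < D by rewrite addr_gt0// mulr_gt0.
pose c2 := (2 * Lambda * de * r) `^ D * (Lambda `^ `|alpha * p| * r `^ (- (alpha * p))).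
have B0 : 0 < 2 * Lambda * de * r by rewrite !mulr_gt0.
have c20 : 0 < c2 by rewrite !mulr_gt0 ?powR_gt0.
have pt x : (K `&` J) x -> `|v x - v y| `^ p <= c2 * gagliardo v x y.
  move=> [Kx /andP[Jx1 Jx2]].
  have [->|xy] := eqVneq x y.
    rewrite subrr normr0 powR0 ?lt0r_neq0// mulr_ge0 ?gagliardo_ge0//.
    exact: ltW.
  have xy0 : 0 < enorm (x - y) by rewrite enorm_gt0// subr_eq0.
  have rL : r < Lambda * r by rewrite ltr_pMl.
  have xr : r <= enorm x by nra.
  have xL : enorm x < Lambda * r by nra.
  (* The cone bounds the transversal part of [x - y], the thickness of the contracted shell its
     radial part. *)
  have xyB : enorm (x - y) <= 2 * Lambda * de * r.
    have -> : x - y = (x - enorm x *: w) + (enorm x - enorm y) *: w.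
      rewrite scalerBl /w !scalerA divff ?lt0r_neq0// scale1r.
      by rewrite addrA subrK.
    apply: (le_trans (enorm_triangle _ _)).
    rewrite enormZ w1 mulr1.
    have h1 : enorm (x - enorm x *: w) <= de / 2 * enorm x by exact: ltW.
    have h2 : `|enorm x - enorm y| <= de * (Lambda * r - r).
      by rewrite ler_norml; apply/andP; split; nra.
    have h3 : de / 2 * enorm x <= de / 2 * (Lambda * r).
      by rewrite ler_pM2l ?divr_gt0// ltW.
    have h4 : 0 < de * r by rewrite mulr_gt0.
    have h5 : 0 < de * (Lambda * r) by rewrite !mulr_gt0.
    by apply: (le_trans (lerD (le_trans h1 h3) h2)); lra.
  have chi1 : chi Lambda (enorm x) (enorm y) = 1.
    rewrite /chi ifT//; apply/andP; split.
      by rewrite ler_pdivrMl//; apply: (le_trans (ltW xL)); rewrite ler_pM2l.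
    by apply: (le_trans (ltW yr)); rewrite ler_pM2l.
  rewrite /gagliardo chi1 mulr1 -/N -/D.
  have := @powR_comparable R Lambda (alpha * p) r (enorm x) L1 r0.
  rewrite xr (ltW xL) => /(_ isT) /andP[h1 _].
  have h2 : 1 <= Lambda `^ `|alpha * p| * r `^ (- (alpha * p)) * enorm x `^ (alpha * p).
    apply: (@le_trans _ _ (Lambda `^ `|alpha * p| * r `^ (- (alpha * p)) *
       (Lambda `^ (- `|alpha * p|) * r `^ (alpha * p)))).
      rewrite mulrACA -!powRD ?subrr ?addNr ?powRr0 ?mulr1//.
        by rewrite (lt0r_neq0 r0) implybT.
      by rewrite (lt0r_neq0 L0) implybT.
    by rewrite ler_wpM2l// mulr_ge0// powR_ge0.
  have h3 : 1 <= (2 * Lambda * de * r) `^ D / enorm (x - y) `^ D.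
    rewrite ler_pdivlMr ?powR_gt0// mul1r ge0_ler_powR ?nnegrE ?(ltW D0) ?(ltW xy0)//.
    exact: ltW.
  have -> : c2 * (`|v x - v y| `^ p * enorm x `^ (alpha * p) / enorm (x - y) `^ D)
     = `|v x - v y| `^ p *
      (((2 * Lambda * de * r) `^ D / enorm (x - y) `^ D) *
      (Lambda `^ `|alpha * p| * r `^ (- (alpha * p)) * enorm x `^ (alpha * p))).
    rewrite /c2; ring.
  rewrite ler_peMr ?powR_ge0//; nra.
have mgag : measurable_fun setT (fun x => (gagliardo v x y)%:E).
  exact: (measurableT_comp (measurable_gagliardo mv) (measurable_pair2 y)).
have step : (\int[lam]_(x in K `&` J) (`|v x - v y| `^ p)%:E <=
    c2%:E * gagliardo_int v y)%E.
  apply: (@le_trans _ _ (\int[lam]_(x in K `&` J) (c2 * gagliardo v x y)%:E)%E).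
    apply: ge0_le_integral => //.
    - exact: measurable_funS mphi.
    - under eq_fun do rewrite EFinM.
      apply: emeasurable_funM => //; exact: measurable_funS mgag.
  under eq_integral do rewrite EFinM.
  rewrite ge0_integralZl_EFin ?(ltW c20)//; last 2 first.
  - by move=> x _; rewrite lee_fin gagliardo_ge0.
  - exact: measurable_funS mgag.
  apply: lee_wpmul2l; first by rewrite lee_fin ltW.
  by apply: ge0_subset_integral => // x _; rewrite lee_fin gagliardo_ge0.
(* Radiality enters here: the integrand depends on |x| only, so its integrals over [J] and over the
   part of [J] in the cone are in the ratio of the solid angles. *)
have -> : (\int[lam]_(x in J) (`|v x - v y| `^ p)%:E =
    (om / solid_angle K)%:E * \int[lam]_(x in K `&` J) (`|v x - v y| `^ p)%:E)%E.
  rewrite polar muleA -EFinM (_ : _ * _ = 1) ?mul1e//.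
  by field; rewrite !lt0r_neq0.
have ok0 : 0 <= om / solid_angle K by rewrite divr_ge0// ltW.
apply: (le_trans (lee_wpmul2l _ step)); first by rewrite lee_fin.
rewrite muleA -EFinM; apply: lee_wpmul2r; first exact: gagliardo_int_ge0.
rewrite lee_fin.
set Q := N * (8 * N) ^+ n.+1 in kK *.
have Q0 : 0 < Q by rewrite !mulr_gt0 ?exprn_gt0 ?mulr_gt0.
have dn0 : 0 < de ^+ n by rewrite exprn_gt0.
have kinv : (solid_angle K)^-1 <= Q * 2 ^+ n / de ^+ n.
  rewrite -[leRHS]invrK lef_pV2 ?posrE//; last first.
    by rewrite invr_gt0 divr_gt0// mulr_gt0// exprn_gt0.
  apply: le_trans kK; rewrite le_eqVlt; apply/orP; left; apply/eqP.
  rewrite expr_div_n; field.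
  by rewrite !lt0r_neq0// exprn_gt0.
apply: (@le_trans _ _ (om * (Q * 2 ^+ n / de ^+ n) * c2)).
  by rewrite ler_pM2r// ler_pM2l.
rewrite le_eqVlt; apply/orP; left; apply/eqP.
rewrite /osc_cst -/om -/N -/D /c2 -/Q.
have -> : de `^ (1 + s * p) = de `^ D / de ^+ n.
  rewrite -powR_mulrn ?(ltW de0)// -powRN -powRD ?(lt0r_neq0 de0) ?implybT//.
  by congr (_ `^ _); rewrite /D /N -natr1; ring.
rewrite -[D - alpha * p]/(D + - (alpha * p)) powRD ?(lt0r_neq0 r0) ?implybT//.
rewrite (powRM _ (_ : 0 <= 2 * Lambda * de) (ltW r0)) ?mulr_ge0 ?(ltW L0) ?(ltW de0)//.
rewrite (powRM _ (_ : 0 <= 2 * Lambda) (ltW de0)) ?mulr_ge0 ?(ltW L0)//.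
by rewrite /Q; ring.
Qed.

End oscillation.

(** [ra] and [rb] stand for the powers of the radius, which cancel by scale invariance. *)
Lemma mule_regroup (R : realType) (e1 e2 e3 e4 ra rb : R) (X Y : \bar R) :
  ra * rb = 1 ->
  (e1%:E * (e2%:E * ((e3 * ra)%:E * X) * ((e4 * rb)%:E * Y)) =
   (e1 * e2 * e3 * e4)%:E * X * Y)%E.
Proof.
move=> rab; rewrite [(e2%:E * _)%E]muleA muleACA !muleA -!EFinM.
congr (_%:E * _ * _)%E.
by rewrite -[RHS]mulr1 -rab; ring.
Qed.

Section cell_inequality.
Context {R : realType} {n : nat}.
Variables (s t p q tau a alpha beta Lambda : R).
Hypotheses (s0 : 0 < s) (t0 : 0 < t) (ts : t <= s) (p1 : 1 < p) (q1 : 1 <= q)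
  (tau1 : 1 <= tau) (a0 : 0 < a) (a1 : a <= 1) (L1 : 1 < Lambda).
(* [t] is the order of smoothness for which the one-dimensional
   Gagliardo-Nirenberg inequality is scale invariant; [expE] makes the weighted
   inequality scale invariant in dimension [n.+1]. *)
Hypothesis tauE : tau^-1 = a * (p^-1 - t) + (1 - a) * q^-1.
Hypothesis expE : a * (n.+1%:R / p + alpha - s) +
  (1 - a) * (n.+1%:R / q + beta) = 0.
Local Notation lam := (lebesgue_rV R n.+1).
Implicit Types (v : 'rV[R]_n.+1 -> R) (x y : 'rV[R]_n.+1).
Local Notation N := (n.+1%:R : R).

Let om : R := solid_angle [set: 'rV[R]_n.+1].
(** [V0 * r ^+ n.+1] is the measure of the shell of inner radius [r]. The contracted shell fills at
    least the proportion [c0 * de] of it, and dividing [radial_oscillation] by the lower bound on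
    its measure produces [Ck]. *)
Let V0 : R := om * (Lambda ^+ n.+1 - 1).
Let c0 : R := (Lambda - 1) / (Lambda ^+ n.+1 - 1).
Let Ck : R := @osc_cst R n s p alpha Lambda / (om * (Lambda - 1)).

Let om0 : 0 < om. Proof. exact: solid_angleT_gt0. Qed.
Let L0 : 0 < Lambda. Proof. exact: lt_trans L1. Qed.
Let LN0 : 0 < Lambda ^+ n.+1 - 1.
Proof. by rewrite subr_gt0 exprn_egt1. Qed.
Let Lm0 : 0 < Lambda - 1. Proof. by rewrite subr_gt0. Qed.
Let V00 : 0 < V0. Proof. by rewrite mulr_gt0. Qed.
Let c00 : 0 < c0. Proof. by rewrite divr_gt0. Qed.
Let Ck0 : 0 < Ck.
Proof. by apply: divr_gt0; [exact: osc_cst_gt0|exact: mulr_gt0]. Qed.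

Let lamW r : 0 < r -> lam (shell r (Lambda * r)) = (V0 * r ^+ n.+1)%:E.
Proof.
move=> r0; rewrite lebesgue_shell//; last by rewrite ler_peMl ?(ltW r0)// ltW.
by congr EFin; rewrite exprMn /V0 -/om; ring.
Qed.

(** The contracted shell has thickness de (Lambda - 1) r and inner radius [A >= r], and B^(n+1) -
    A^(n+1) >= (B - A) A^n. *)
Let lamJ r (de : R) y : 0 < r -> 0 < de <= 1 -> r <= enorm y < Lambda * r ->
  ((om * (Lambda - 1) * de * r ^+ n.+1)%:E <=
   lam (shell ((1 - de) * enorm y + de * r)
              ((1 - de) * enorm y + de * (Lambda * r))))%E.
Proof.
move=> r0 /andP[de0 de1] /andP[ry yr].
set A := (1 - de) * enorm y + de * r; set B := (1 - de) * enorm y + _.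
have rA : r <= A by rewrite /A; nra.
have AB : B - A = de * (Lambda - 1) * r by rewrite /A /B; ring.
have BA : A <= B by rewrite -subr_ge0 AB !mulr_ge0 ?(ltW de0) ?(ltW Lm0) ?(ltW r0).
have A0 : 0 < A by exact: lt_le_trans rA.
have B0 : 0 < B by exact: lt_le_trans BA.
rewrite lebesgue_shell// lee_fin -/om.
have -> : om * (Lambda - 1) * de * r ^+ n.+1 = (B - A) * r ^+ n * om.
  by rewrite AB exprS; ring.
rewrite ler_pM2r//.
have h1 : r ^+ n <= A ^+ n by rewrite lerXn2r ?nnegrE ?(ltW r0) ?(ltW A0).
have h2 : A ^+ n <= B ^+ n by rewrite lerXn2r ?nnegrE ?(ltW B0) ?(ltW A0).
rewrite !exprS.
have h3 : (B - A) * r ^+ n <= (B - A) * A ^+ n by rewrite ler_wpM2l// subr_ge0.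
have h4 : B * A ^+ n <= B * B ^+ n by rewrite ler_pM2l.
by apply: (le_trans h3); rewrite mulrBl lerB.
Qed.

Lemma powR_sum_le (x y : R) : 0 <= x -> 0 <= y ->
  (x + y) `^ q <= 2 `^ q * (x `^ q + y `^ q).
Proof.
move=> x0 y0; have q0 : 0 <= q by exact: le_trans q1.
wlog xy : x y x0 y0 / x <= y => [h|].
  have [xy|yx] := leP x y; first exact: h.
  by rewrite addrC [x `^ q + _]addrC; apply: h => //; exact: ltW.
apply: (@le_trans _ _ ((2 * y) `^ q)).
  by rewrite ge0_ler_powR ?nnegrE ?addr_ge0 ?mulr_ge0//; lra.
by rewrite powRM// ler_wpM2l ?powR_ge0// lerDr powR_ge0.
Qed.

Definition weighted_int v r : \bar R :=
  (\int[lam]_(x in shell r (Lambda * r))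
     (enorm x `^ (beta * q) * `|v x| `^ q)%:E)%E.

(** [cell_bound] is applied, with the order [t] in place of [s], to the normalized measure on the
    shell, to [v] minus its mean [w], and to a rescaled Gagliardo integral as [k]. *)
Lemma cell_inequality : exists2 C : R, 0 < C & forall v (M : R),
  measurable_fun setT v -> radial v -> (forall x, `|v x| <= M) ->
  forall r : R, 0 < r -> exists w : R,
  ((r `^ (- (N / tau)))%:E *
   (\int[lam]_(x in shell r (Lambda * r)) (`|v x - w| `^ tau)%:E) `^ tau^-1
   <= C%:E * (\int[lam]_(y in shell r (Lambda * r))
                gagliardo_int s p alpha Lambda v y) `^ (a / p)
      * (weighted_int v r) `^ ((1 - a) / q))%E.
Proof.
pose C1 := (1 + c0 `^ (- tau^-1)) `^ (a * (1 + t * tau)).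
pose CA := Ck / V0.
pose CB := 2 `^ q * 2 / V0 * Lambda `^ `|beta * q|.
have C10 : 0 < C1 by rewrite powR_gt0// ltr_pwDl// powR_ge0.
have CA0 : 0 < CA by rewrite divr_gt0.
have CB0 : 0 < CB by rewrite mulr_gt0 ?powR_gt0// divr_gt0// mulr_gt0// powR_gt0.
exists (V0 `^ tau^-1 * C1 * CA `^ (a / p) * CB `^ ((1 - a) / q)).
  apply: mulr_gt0; last exact: powR_gt0.
  apply: mulr_gt0; last exact: powR_gt0.
  by apply: mulr_gt0; [exact: powR_gt0|exact: C10].
move=> v M mv rv vM r r0.
have p0 : 0 < p by exact: lt_trans p1.
have q0 : 0 < q by exact: lt_le_trans q1.
have tau0 : 0 < tau by exact: lt_le_trans tau1.
set D := shell r (Lambda * r).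
have mD : measurable D by exact: measurable_shell.
pose V := V0 * r ^+ n.+1.
have V_gt0 : 0 < V by rewrite mulr_gt0// exprn_gt0.
have iV0 : 0 <= V^-1 by rewrite invr_ge0 ltW.
have lamD : lam D = V%:E by exact: lamW.
pose mu : {measure set 'rV[R]_n.+1 -> \bar R} := mscale (NngNum iV0) lam.
have muE A : mu A = (V^-1%:E * lam A)%E by [].
have muD : mu D = 1%E.
  by rewrite muE lamD -EFinM mulVf// lt0r_neq0.
have mabs (E : set 'rV[R]_n.+1) (b w : R) : measurable E ->
    measurable_fun E (fun x => (`|v x - w| `^ b)%:E).
  move=> mE; apply/measurable_EFinP.
  apply: (measurableT_comp (@measurable_powR R b)).
  apply: (measurableT_comp (@normr_measurable R setT)).
  apply: measurable_funB => //; exact: measurable_funS mv.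
have intmu (E : set 'rV[R]_n.+1) (f : 'rV[R]_n.+1 -> \bar R) : measurable E ->
    measurable_fun E f -> (forall x, 0 <= f x)%E ->
    (\int[mu]_(x in E) f x = V^-1%:E * \int[lam]_(x in E) f x)%E.
  by move=> mE mf f0; rewrite ge0_integral_mscale.
have iv : mu.-integrable D (EFin \o v).
  apply: measurable_bounded_integrable => //; first by rewrite muD ltry.
    exact: measurable_funS mv.
  exists M; split; first exact: num_real.
  by move=> L ML y _; rewrite /= (le_trans (vM y))// ltW.
pose w := fine (\int[mu]_(x in D) (v x)%:E)%E.
have wE : (\int[mu]_(x in D) (v x)%:E = w%:E)%E.
  by rewrite /w fineK// integrable_fin_num.
exists w.
have hmean : (\int[mu]_(x in D) (v x - w)%:E = 0)%E.
  have ic : mu.-integrable D (EFin \o cst w).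
    apply: measurable_bounded_integrable => //; first by rewrite muD ltry.
    exists `|w|; split; first exact: num_real.
    by move=> L ML y _; rewrite /= ltW.
  under eq_integral do rewrite EFinB.
  rewrite (integralB_EFin mD iv ic) wE.
  by have := integral_cst mu mD w%:E; rewrite muD mule1 => ->; rewrite subee.
pose k y : \bar R := ((Ck * r `^ ((s - alpha) * p))%:E *
  gagliardo_int s p alpha Lambda v y)%E.
have Ckr0 : 0 <= Ck * r `^ ((s - alpha) * p).
  by rewrite mulr_ge0 ?powR_ge0// ltW.
have mgag := measurable_gagliardo_int s p alpha Lambda mv.
have mk : measurable_fun setT k by exact: emeasurable_funM.
have k0 y : (0 <= k y)%E.
  by rewrite mule_ge0 ?lee_fin//; exact: gagliardo_int_ge0.
have hosc x (de : R) : D x -> 0 < de <= 1 ->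
  exists J : set 'rV[R]_n.+1, [/\ measurable J, J `<=` D,
    ((c0 * de)%:E <= mu J)%E, (de = 1 -> J = D) &
    (\int[mu]_(y in J) (`|(v y - w) - (v x - w)| `^ p)%:E <=
      k x * (de `^ (t * p))%:E * mu J)%E].
  move=> Dx de01; have /andP[de0 de1] := de01; have /andP[Dx1 Dx2] := Dx.
  exists (shell ((1 - de) * enorm x + de * r)
              ((1 - de) * enorm x + de * (Lambda * r))).
  have mJ : measurable (shell ((1 - de) * enorm x + de * r)
    ((1 - de) * enorm x + de * (Lambda * r)) : set 'rV[R]_n.+1).
    exact: measurable_shell.
  have LJ := lamJ r0 de01 Dx.
  split=> //.
  - move=> z /andP[z1 z2]; apply/andP; split.
      by apply: le_trans z1; nra.
    by apply: (lt_le_trans z2); nra.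
  - rewrite muE; apply: (@le_trans _ _
      (V^-1%:E * (om * (Lambda - 1) * de * r ^+ n.+1)%:E)%E); last first.
      by apply: lee_wpmul2l => //; rewrite lee_fin.
    rewrite -EFinM lee_fin le_eqVlt; apply/orP; left; apply/eqP.
    rewrite /c0 /V /V0; field.
    by rewrite !lt0r_neq0// exprn_gt0.
  - by move=> ->; rewrite subrr !mul0r !add0r !mul1r.
  have mosc : measurable_fun setT (fun z => (`|(v z - w) - (v x - w)| `^ p)%:E).
    apply/measurable_EFinP; apply: (measurableT_comp (@measurable_powR R p)).
    apply: (measurableT_comp (@normr_measurable R setT)).
    by apply: measurable_funB => //; exact: measurable_funB.
  rewrite intmu //; last exact: measurable_funS mosc.
  under eq_integral => z _.
    have -> : v z - w - (v x - w) = v z - v x by ring.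
    over.
  have G0 := gagliardo_int_ge0 s p alpha Lambda v x.
  rewrite muE [leRHS]muleCA; apply: lee_wpmul2l; first by rewrite lee_fin.
  apply: (le_trans (radial_oscillation alpha s0 p1 L1 mv rv r0 de01 Dx)).
  apply: (@le_trans _ _ (k x * (de `^ (t * p))%:E *
      (om * (Lambda - 1) * de * r ^+ n.+1)%:E)%E); last first.
    by apply: lee_wpmul2l => //; rewrite mule_ge0// lee_fin powR_ge0.
  rewrite /k -!muleA [(gagliardo_int _ _ _ _ _ _ * (_ * _))%E]muleC !muleA -!EFinM.
  apply: lee_wpmul2r => //; rewrite lee_fin.
  rewrite [leRHS](_ : _ = @osc_cst R n s p alpha Lambda *
      (de * de `^ (t * p)) * (r ^+ n.+1 * r `^ ((s - alpha) * p))); last first.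
    by rewrite /Ck; field; rewrite !lt0r_neq0.
  have -> : de * de `^ (t * p) = de `^ (1 + t * p).
    by rewrite powRD ?(lt0r_neq0 de0) ?implybT// powRr1// ltW.
  have -> : r ^+ n.+1 * r `^ ((s - alpha) * p) = r `^ (N + (s - alpha) * p).
    by rewrite powRD ?(lt0r_neq0 r0) ?implybT// powR_mulrn// ltW.
  rewrite (_ : N + s * p - alpha * p = N + (s - alpha) * p); last by ring.
  rewrite ler_wpM2r ?powR_ge0// ler_wpM2l ?(ltW (osc_cst_gt0 _ _ _ L1))//.
  (* As [de <= 1], lowering the order from [s] to [t] increases the power of [de]. *)
  apply: ger_powR => //.
  by rewrite lerD2l ler_pM2r.
have hM x : `|v x - w| <= M + `|w|.
  by apply: (le_trans (ler_normB _ _)); rewrite lerD2r.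
have mh : measurable_fun setT (fun x => v x - w) by exact: measurable_funB.
have := cell_bound mD muD t0 p1 q1 tau1 a0 a1 c00 tauE mh hM hmean mk k0 hosc.
rewrite -/C1 => main.
have T1 : (\int[mu]_(x in D) k x = (CA * r `^ ((s - alpha) * p - N))%:E *
   \int[lam]_(y in D) gagliardo_int s p alpha Lambda v y)%E.
  have mgD : measurable_fun D (gagliardo_int s p alpha Lambda v).
    exact: measurable_funS mgag.
  rewrite intmu//; last exact: measurable_funS mk.
  rewrite ge0_integralZl_EFin//; last first.
    by move=> x _; exact: gagliardo_int_ge0.
  rewrite muleA -EFinM; congr (_%:E * _)%E.
  rewrite powRB ?(lt0r_neq0 r0) ?implybT// powR_mulrn ?(ltW r0)// /CA /V.
  by field; rewrite !lt0r_neq0// exprn_gt0.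
have mvq : measurable_fun setT (fun x => (`|v x| `^ q)%:E).
  apply/measurable_EFinP; apply: (measurableT_comp (@measurable_powR R q)).
  exact: (measurableT_comp (@normr_measurable R setT)).
have vq0 x : (0 <= (`|v x| `^ q)%:E)%E by rewrite lee_fin powR_ge0.
pose Z := fine (\int[mu]_(x in D) (`|v x| `^ q)%:E)%E.
have ZE : (\int[mu]_(x in D) (`|v x| `^ q)%:E)%E = Z%:E.
  rewrite /Z fineK// ge0_fin_numE; last exact: integral_ge0.
  apply: (@le_lt_trans _ _ (\int[mu]_(x in D) (M `^ q)%:E)%E).
    apply: ge0_le_integral => //; first exact: measurable_funS mvq.
    move=> x _; rewrite lee_fin ge0_ler_powR ?nnegrE ?(ltW q0)//.
    exact: le_trans (vM x).
  by rewrite integral_cst// muD mule1 ltry.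
have Z0 : 0 <= Z by rewrite fine_ge0// integral_ge0.
have mva : measurable_fun D (fun x => `|v x|).
  apply: (measurableT_comp (@normr_measurable R setT)).
  exact: measurable_funS mv.
(* The mean is itself controlled by the L^q norm of [v], so in the second factor passing from
   [v - w] to [v] only costs a constant. *)
have wZ : `|w| `^ q <= Z.
  have h1 : `|w| <= Z `^ q^-1.
    have := @power_mean _ _ _ mu D (fun x => `|v x|) q Z 1 q1 mD mva
      (fun _ _ => normr_ge0 _) ltr01 muD Z0.
    rewrite !mulr1 ZE => /(_ (lexx _)); rewrite -lee_fin; apply: le_trans.
    rewrite -[X in (X <= _)%E]/(`|w%:E|)%E -wE.
    apply: le_abse_integral => //; apply/measurable_EFinP.
    exact: measurable_funS mv.
  apply: (@le_trans _ _ ((Z `^ q^-1) `^ q)).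
    by rewrite ge0_ler_powR ?nnegrE ?powR_ge0 ?(ltW q0).
  by rewrite -powRrM mulVf ?lt0r_neq0// powRr1.
have ZB : (Z%:E <= (V^-1 * (Lambda `^ `|beta * q| * r `^ (- (beta * q))))%:E *
    weighted_int v r)%E.
  have mw : measurable_fun D (fun x => (enorm x `^ (beta * q) * `|v x| `^ q)%:E).
    apply: (@measurable_funS _ _ _ _ setT) => //.
    under eq_fun do rewrite EFinM.
    apply: emeasurable_funM => //; apply/measurable_EFinP.
    apply: (measurableT_comp (@measurable_powR R _)).
    exact: measurable_enorm.
  have Lr0 : 0 <= Lambda `^ `|beta * q| * r `^ (- (beta * q)).
    by rewrite mulr_ge0// powR_ge0.
  have w0 x : D x -> (0 <= (enorm x `^ (beta * q) * `|v x| `^ q)%:E)%E.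
    by move=> _; rewrite lee_fin mulr_ge0// powR_ge0.
  rewrite -ZE intmu//; last exact: measurable_funS mvq.
  rewrite EFinM -muleA; apply: lee_wpmul2l; first by rewrite lee_fin.
  rewrite /weighted_int -/D -ge0_integralZl_EFin//.
  apply: ge0_le_integral => //.
  - exact: measurable_funS mvq.
  - exact: emeasurable_funM.
  move=> x /andP[x1 x2]; rewrite -EFinM lee_fin mulrA ler_peMl ?powR_ge0//.
  have := @powR_comparable R Lambda (beta * q) r (enorm x) L1 r0.
  rewrite x1 (ltW x2) => /(_ isT) /andP[h1 _].
  apply: (@le_trans _ _ (Lambda `^ `|beta * q| * r `^ (- (beta * q)) *
       (Lambda `^ (- `|beta * q|) * r `^ (beta * q)))).
    rewrite mulrACA -!powRD ?subrr ?addNr ?powRr0 ?mulr1//.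
      by rewrite (lt0r_neq0 r0) implybT.
    by rewrite (lt0r_neq0 L0) implybT.
  by rewrite ler_wpM2l.
have T2 : (\int[mu]_(x in D) (`|v x - w| `^ q)%:E <=
    (CB * r `^ (- (beta * q) - N))%:E * weighted_int v r)%E.
  apply: (@le_trans _ _ (\int[mu]_(x in D)
      ((2 `^ q)%:E * ((`|v x| `^ q)%:E + (`|w| `^ q)%:E)))%E).
    apply: ge0_le_integral => //; first exact: mabs.
      apply: emeasurable_funM => //; apply: emeasurable_funD => //.
      exact: measurable_funS mvq.
    move=> x _; rewrite -EFinD -EFinM lee_fin.
    apply: (le_trans _ (powR_sum_le (normr_ge0 _) (normr_ge0 _))).
    by rewrite ge0_ler_powR ?nnegrE ?addr_ge0 ?(ltW q0)// ler_normB.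
  rewrite ge0_integralZl_EFin ?powR_ge0//; last 2 first.
  - by move=> x _; rewrite -EFinD lee_fin addr_ge0// powR_ge0.
  - apply: emeasurable_funD => //; exact: measurable_funS mvq.
  rewrite ge0_integralD//; last exact: measurable_funS mvq.
  rewrite ZE integral_cst// muD mule1 -EFinD -EFinM.
  apply: (@le_trans _ _ ((2 `^ q * 2)%:E * Z%:E)%E).
    by rewrite -EFinM lee_fin -mulrA ler_wpM2l ?powR_ge0//; lra.
  apply: (@le_trans _ _ ((2 `^ q * 2)%:E *
     ((V^-1 * (Lambda `^ `|beta * q| * r `^ (- (beta * q))))%:E *
       weighted_int v r))%E).
    by apply: lee_wpmul2l => //; rewrite lee_fin mulr_ge0 ?powR_ge0.
  rewrite muleA -EFinM le_eqVlt; apply/orP; left; apply/eqP; congr (_%:E * _)%E.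
  rewrite powRB ?(lt0r_neq0 r0) ?implybT// powR_mulrn ?(ltW r0)// /CB /V.
  by field; rewrite !lt0r_neq0// exprn_gt0.
have ap0 : 0 <= a / p by rewrite divr_ge0 ?(ltW a0) ?(ltW p0).
have aq0 : 0 <= (1 - a) / q by rewrite divr_ge0 ?subr_ge0 ?(ltW q0).
have X0 : (0 <= \int[lam]_(x in D) (`|v x - w| `^ tau)%:E)%E.
  by apply: integral_ge0 => x _; rewrite lee_fin powR_ge0.
have G0 : (0 <= \int[lam]_(y in D) gagliardo_int s p alpha Lambda v y)%E.
  by apply: integral_ge0 => y _; exact: gagliardo_int_ge0.
have Y0 : (0 <= weighted_int v r)%E.
  by apply: integral_ge0 => x _; rewrite lee_fin mulr_ge0// powR_ge0.
(* Up to the constant [V0], the normalizing power of [r] is the inverse measure of the shell; it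
   turns the integral for [lam] into one for [mu]. *)
have rV : (r `^ (- (N / tau)))%:E = ((V0 `^ tau^-1)%:E * (V^-1 `^ tau^-1)%:E)%E.
  rewrite -EFinM -powRM ?(ltW V00)//; congr EFin.
  have -> : V0 / V = (r ^+ n.+1)^-1.
    by rewrite /V; field; rewrite !lt0r_neq0// exprn_gt0.
  rewrite -powR_mulrn ?(ltW r0)// -powRN -powRrM; congr (_ `^ _).
  by rewrite mulNr.
(* The total exponent of [r] is the opposite of the left-hand side of [expE]. *)
have rE : (r `^ ((s - alpha) * p - N)) `^ (a / p) *
    (r `^ (- (beta * q) - N)) `^ ((1 - a) / q) = 1.
  rewrite -!powRrM -powRD ?(lt0r_neq0 r0) ?implybT//.
  have -> : ((s - alpha) * p - N) * (a / p) +
      (- (beta * q) - N) * ((1 - a) / q) =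
      - (a * (N / p + alpha - s) + (1 - a) * (N / q + beta)).
    by field; rewrite !lt0r_neq0.
  by rewrite expE oppr0 powRr0.
rewrite rV -muleA -(poweR_EFin V^-1) -poweRM ?lee_fin//.
rewrite -intmu//; last exact: mabs.
apply: (@le_trans _ _ ((V0 `^ tau^-1)%:E * (C1%:E *
   ((CA * r `^ ((s - alpha) * p - N))%:E *
   \int[lam]_(y in D) gagliardo_int s p alpha Lambda v y) `^ (a / p) *
   ((CB * r `^ (- (beta * q) - N))%:E * weighted_int v r) `^ ((1 - a) / q)))%E).
  apply: lee_wpmul2l; first by rewrite lee_fin powR_ge0.
  apply: (le_trans main); rewrite T1; apply: lee_wpmul2l.
    by rewrite mule_ge0 ?poweR_ge0// lee_fin ltW.
  apply: gt0_ler_poweR => //; rewrite in_itv/= leey andbT.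
    by apply: integral_ge0 => x _; rewrite lee_fin powR_ge0.
  by rewrite mule_ge0// lee_fin mulr_ge0 ?powR_ge0// ltW.
have rA0 : 0 <= r `^ ((s - alpha) * p - N) by exact: powR_ge0.
have rB0 : 0 <= r `^ (- (beta * q) - N) by exact: powR_ge0.
have cA0 : (0 <= (CA * r `^ ((s - alpha) * p - N))%:E)%E.
  by rewrite lee_fin; apply: mulr_ge0 => //; exact: ltW.
have cB0 : (0 <= (CB * r `^ (- (beta * q) - N))%:E)%E.
  by rewrite lee_fin; apply: mulr_ge0 => //; exact: ltW.
rewrite (poweRM _ cA0 G0) (poweRM _ cB0 Y0).
rewrite !poweR_EFin (powRM _ (ltW CA0) rA0) (powRM _ (ltW CB0) rB0).
by rewrite mule_regroup.
Qed.

End cell_inequality.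

(** * Summation over shells *)

Lemma minkowski_in d (T : measurableType d) (R : realType)
    (mu : {measure set T -> \bar R}) (E : set T) (f g : T -> R) (p : R) :
  1 <= p -> measurable E -> measurable_fun setT f -> measurable_fun setT g ->
  ((\int[mu]_(x in E) (`|f x + g x| `^ p)%:E) `^ p^-1 <=
   (\int[mu]_(x in E) (`|f x| `^ p)%:E) `^ p^-1 +
   (\int[mu]_(x in E) (`|g x| `^ p)%:E) `^ p^-1)%E.
Proof.
move=> p1 mE mf mg; have p0 : p != 0 by rewrite gt_eqF// (lt_le_trans ltr01).
have NE (h : T -> R) : ((\int[mu]_(x in E) (`|h x| `^ p)%:E) `^ p^-1)%E =
    Lnorm mu p%:E (EFin \o (h \_ E)).
  rewrite unlock /Lnorm integral_mkcond; congr (_ `^ _)%E.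
  apply: eq_integral => x _; rewrite /patch /=; case: ifPn => // _.
  by rewrite normr0 powR0.
rewrite (NE f) (NE g) (NE (fun x => f x + g x)).
have -> : EFin \o ((fun x => f x + g x) \_ E) = EFin \o ((f \_ E) \+ (g \_ E))%R.
  apply/funext => x; rewrite /= /patch; case: ifPn => // _; by rewrite addr0.
by apply: minkowski_EFin => //; apply/(measurable_restrictT _ _).1 => //;
  exact: measurable_funTS.
Qed.

Section shell_norm.
Context {R : realType} {n : nat}.
Local Notation lam := (lebesgue_rV R n.+1).
Variables (tau l : R).
Hypotheses (tau1 : 1 <= tau) (l1 : 1 < l).
Implicit Types (v : 'rV[R]_n.+1 -> R) (r : R).
Local Notation N := (n.+1%:R : R).

(* The power of [r] normalizes by the measure of the shell. *)
Definition shell_norm v r : \bar R :=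
  ((r `^ (- (N / tau)))%:E *
   (\int[lam]_(x in shell r (l * r)) (`|v x| `^ tau)%:E) `^ tau^-1)%E.

Lemma shell_norm_ge0 v r : (0 <= shell_norm v r)%E.
Proof. by rewrite mule_ge0 ?poweR_ge0// lee_fin powR_ge0. Qed.

Lemma shell_norm_triangle (v1 v2 : 'rV[R]_n.+1 -> R) r :
  measurable_fun setT v1 -> measurable_fun setT v2 ->
  (shell_norm (fun x => v1 x + v2 x)%R r <= shell_norm v1 r + shell_norm v2 r)%E.
Proof.
move=> m1 m2; rewrite /shell_norm -ge0_muleDr ?poweR_ge0//.
apply: lee_wpmul2l; first by rewrite lee_fin powR_ge0.
by apply: minkowski_in => //; exact: measurable_shell.
Qed.

(** This independence of the radius is what the normalization is for: a constant can be carried from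
    one shell to the next at no cost. *)
Lemma shell_norm_cst (w r : R) : 0 < r ->
  shell_norm (fun _ : 'rV[R]_n.+1 => w) r = shell_norm (fun _ : 'rV[R]_n.+1 => w) 1.
Proof.
have tau0 : 0 < tau by exact: lt_le_trans tau1.
suff E t : 0 < t -> shell_norm (fun=> w) t =
    (((l ^+ n.+1 - 1) * solid_angle [set: 'rV[R]_n.+1] * `|w| `^ tau) `^ tau^-1)%:E.
  by move=> r0; rewrite !E.
move=> t0; rewrite /shell_norm.
have := integral_cst lam (@measurable_shell R n t (l * t)) (`|w| `^ tau)%:E.
have tl : t <= l * t by rewrite ler_peMl ?(ltW t0) ?(ltW l1).
rewrite [X in (_ * X)%E](lebesgue_shell t0 tl).
move=> ->; rewrite -[X in (X `^ _)%E]EFinM poweR_EFin -EFinM; congr EFin.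
have -> : t `^ (- (N / tau)) = (t ^- n.+1) `^ tau^-1.
  by rewrite -powR_mulrn ?(ltW t0)// -powRN -powRrM mulNr.
have l0 : 0 < l by exact: lt_trans l1.
have lN : 0 <= l ^+ n.+1 - 1 by rewrite subr_ge0 exprn_ege1// ltW.
have s0 := ltW (@solid_angleT_gt0 R n.+1).
rewrite -powRM ?invr_ge0 ?exprn_ge0 ?(ltW t0)//; last first.
  rewrite mulr_ge0 ?powR_ge0// mulr_ge0// exprMn -{2}[t ^+ _]mul1r -mulrBl.
  by rewrite mulr_ge0// exprn_ge0// ltW.
congr (_ `^ _); rewrite exprMn; field.
by rewrite expf_neq0// lt0r_neq0.
Qed.

End shell_norm.

Section step.
Context {R : realType} {n : nat}.
Variables (s t p q tau a alpha beta l : R).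
Hypotheses (s0 : 0 < s) (t0 : 0 < t) (ts : t <= s) (p1 : 1 < p) (q1 : 1 <= q)
  (tau1 : 1 <= tau) (a0 : 0 < a) (a1 : a <= 1) (l1 : 1 < l).
Hypothesis tauE : tau^-1 = a * (p^-1 - t) + (1 - a) * q^-1.
Hypothesis expE : a * (n.+1%:R / p + alpha - s) +
  (1 - a) * (n.+1%:R / q + beta) = 0.
Local Notation lam := (lebesgue_rV R n.+1).
Local Notation N := (n.+1%:R : R).
Local Notation L := (l * l).
Implicit Types (v : 'rV[R]_n.+1 -> R) (r : R).

Definition step_bound v r : \bar R :=
  ((\int[lam]_(y in shell r (L * r)) gagliardo_int s p alpha L v y) `^ (a / p)
      * (weighted_int q beta L v r) `^ ((1 - a) / q))%E.

(** Both shells lie in the double shell, on which [v] is close to a single constant [w]; passing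
    from one norm to that of [w] and on to the other norm costs the oscillation twice. Both
    directions are needed, as the shells will be followed outwards and inwards. *)
Lemma shell_norm_step : exists2 C : R, 0 < C & forall v (M : R),
  measurable_fun setT v -> radial v -> (forall x, `|v x| <= M) ->
  forall r : R, 0 < r ->
  (shell_norm tau l v (l * r) <= shell_norm tau l v r + C%:E * step_bound v r)%E /\
  (shell_norm tau l v r <= shell_norm tau l v (l * r) + C%:E * step_bound v r)%E.
Proof.
have L1 : 1 < L by exact: mulr_egt1.
have [C C0 cell] := cell_inequality s0 t0 ts p1 q1 tau1 a0 a1 L1 tauE expE.
exists (2 * C); first by rewrite mulr_gt0.
move=> v M mv rv vM r r0.
have [w] := cell v M mv rv vM r r0; rewrite -muleA -/(step_bound v r) => hw.
have l0 : 0 < l by exact: lt_trans l1.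
have tau0 : 0 < tau by exact: lt_le_trans tau1.
have mvw : measurable_fun setT (fun x => v x - w) by exact: measurable_funB.
have vw0 x : (0 <= (`|v x - w| `^ tau)%:E)%E by rewrite lee_fin powR_ge0.
have mvwt : measurable_fun setT (fun x => (`|v x - w| `^ tau)%:E).
  apply/measurable_EFinP; apply: (measurableT_comp (@measurable_powR R tau)).
  exact: (measurableT_comp (@normr_measurable R setT)).
(* A shell of inner radius [rho] in this range is contained in the double shell, and its normalizing
   factor is no larger than the one at [r]. *)
have small rho : r <= rho -> rho <= l * r ->
    (shell_norm tau l (fun x => v x - w)%R rho <= C%:E * step_bound v r)%E.
  move=> r1 r2; apply: le_trans hw.
  have rho0 : 0 < rho by exact: lt_le_trans r1.
  apply: lee_pmul; rewrite ?lee_fin ?powR_ge0 ?poweR_ge0//.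
    rewrite !powRN lef_pV2 ?posrE ?powR_gt0//.
    rewrite ge0_ler_powR ?nnegrE ?(ltW r0) ?(ltW rho0)//.
    by rewrite divr_ge0// ltW.
  apply: gt0_ler_poweR; rewrite ?in_itv/= ?leey ?andbT ?integral_ge0//.
    by rewrite invr_ge0 ltW.
  apply: ge0_subset_integral => //.
  - exact: measurable_shell.
  - exact: measurable_shell.
  - exact: measurable_funS mvwt.
  - move=> x /andP[x1 x2]; apply/andP; split; first exact: le_trans x1.
    by apply: (lt_le_trans x2); rewrite -mulrA ler_pM2l.
pose cw := fun _ : 'rV[R]_n.+1 => w.
have up rho : r <= rho -> rho <= l * r ->
    (shell_norm tau l v rho <= C%:E * step_bound v r + shell_norm tau l cw 1)%E.
  move=> r1 r2; have rho0 : 0 < rho by exact: lt_le_trans r1.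
  rewrite /cw -(shell_norm_cst tau1 l1 w rho0).
  apply: (@le_trans _ _ (shell_norm tau l (fun x => v x - w)%R rho +
     shell_norm tau l cw rho)%E); last by apply: leeD => //; exact: small.
  have := @shell_norm_triangle R n tau l tau1 (fun x => v x - w) cw rho
    mvw (measurable_cst _).
  by under [X in shell_norm _ _ X _]eq_fun do rewrite subrK.
have down rho : r <= rho -> rho <= l * r ->
    (shell_norm tau l cw 1 <= C%:E * step_bound v r + shell_norm tau l v rho)%E.
  move=> r1 r2; have rho0 : 0 < rho by exact: lt_le_trans r1.
  rewrite /cw -(shell_norm_cst tau1 l1 w rho0).
  apply: (@le_trans _ _ (shell_norm tau l (fun x => v x - w)%R rho +
     shell_norm tau l v rho)%E); last by apply: leeD => //; exact: small.
  have -> : shell_norm tau l (fun x => v x - w)%R rho =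
      shell_norm tau l (fun x => w - v x)%R rho.
    by rewrite /shell_norm; under eq_integral do rewrite distrC.
  have mwv : measurable_fun setT (fun x => w - v x) by exact: measurable_funB.
  have := @shell_norm_triangle R n tau l tau1 (fun x => w - v x) v rho mwv mv.
  by under [X in shell_norm _ _ X _]eq_fun do rewrite subrK.
have rl : r <= l * r by rewrite ler_peMl ?(ltW r0) ?(ltW l1).
have Z0 : (0 <= step_bound v r)%E by rewrite mule_ge0// poweR_ge0.
have gen r1 r2 : r <= r1 -> r1 <= l * r -> r <= r2 -> r2 <= l * r ->
   (shell_norm tau l v r1 <= shell_norm tau l v r2 + (2 * C)%:E * step_bound v r)%E.
  move=> h1 h2 h3 h4; apply: (le_trans (up _ h1 h2)).
  apply: (le_trans (leeD2l _ (down _ h3 h4))).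
  rewrite addeA addeC -ge0_muleDl ?lee_fin ?(ltW C0)// -EFinD.
  by rewrite (_ : 2 * C = C + C)//; ring.
by split; exact: gen.
Qed.

End step.

Section sum_hoelder.
Context {R : realType}.
Variables (th1 th2 : R).
Hypotheses (th1_gt0 : 0 < th1) (th2_ge0 : 0 <= th2) (th12 : th1 + th2 <= 1).

(** Hoelder's inequality with the constant 1 as a third sequence, of exponent [1 - th1 - th2]; this
    one gives the power of [n]. Each term is estimated by [young2] after division of [A] and [B] by
    their averages. *)
Let sum_hoelder_pos n (A B : 'I_n -> R) :
  (forall j, 0 <= A j) -> (forall j, 0 <= B j) ->
  0 < \sum_j A j -> 0 < \sum_j B j ->
  \sum_j A j `^ th1 * B j `^ th2 <=
  n%:R `^ (1 - th1 - th2) * ((\sum_j A j) `^ th1 * (\sum_j B j) `^ th2).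
Proof.
case: n A B => [A B _ _|n A B A0 B0]; first by rewrite big_ord0 ltxx.
set X := \sum_j A j; set Y := \sum_j B j => X0 Y0.
set N : R := n.+1%:R; have N0 : 0 < N by rewrite ltr0n.
pose c := (X / N) `^ th1 * (Y / N) `^ th2.
have XN : 0 < X / N by rewrite divr_gt0.
have YN : 0 < Y / N by rewrite divr_gt0.
have c0 : 0 < c by rewrite mulr_gt0// powR_gt0.
have term j : A j `^ th1 * B j `^ th2 <=
    c * (th1 * (A j / (X / N)) + th2 * (B j / (Y / N)) + (1 - th1 - th2)).
  have a0 : 0 <= A j / (X / N) by rewrite divr_ge0// ltW.
  have b0 : 0 <= B j / (Y / N) by rewrite divr_ge0// ltW.
  have aE : A j `^ th1 = (A j / (X / N)) `^ th1 * (X / N) `^ th1.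
    by rewrite -powRM ?(ltW XN)// divfK// lt0r_neq0.
  have bE : B j `^ th2 = (B j / (Y / N)) `^ th2 * (Y / N) `^ th2.
    by rewrite -powRM ?(ltW YN)// divfK// lt0r_neq0.
  rewrite aE bE mulrACA [leLHS]mulrC -/c ler_pM2l//.
  by apply: young2 => //; exact: ltW.
apply: (le_trans (ler_sum _ (fun j _ => term j))).
rewrite -mulr_sumr big_split/= big_split/= -!mulr_sumr -!mulr_suml -/X -/Y.
rewrite sumr_const card_ord -[_ *+ n.+1]mulr_natr -/N.
rewrite (_ : th1 * (X / (X / N)) + th2 * (Y / (Y / N)) + (1 - th1 - th2) * N = N);
  last by field; rewrite !lt0r_neq0.
rewrite le_eqVlt; apply/orP; left; apply/eqP.
rewrite /c !powRM ?invr_ge0 ?(ltW X0) ?(ltW Y0) ?(ltW N0)//.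
rewrite -!(powR_inv1 (ltW N0)) -!powRrM !mulN1r.
have E : N `^ (1 - th1 - th2) = N `^ (- th1) * N `^ (- th2) * N.
  rewrite -[X in _ * _ * X]powRr1 ?(ltW N0)// -!powRD ?(lt0r_neq0 N0) ?implybT//.
  by congr (_ `^ _); ring.
by rewrite E; ring.
Qed.

Let sum_hoelder n (A B : 'I_n -> R) :
  (forall j, 0 <= A j) -> (forall j, 0 <= B j) ->
  \sum_j A j `^ th1 * B j `^ th2 <=
  n%:R `^ (1 - th1 - th2) * ((\sum_j A j) `^ th1 * (\sum_j B j) `^ th2).
Proof.
move=> A0 B0.
have R0 : 0 <= n%:R `^ (1 - th1 - th2) * ((\sum_j A j) `^ th1 * (\sum_j B j) `^ th2).
  by rewrite !mulr_ge0// powR_ge0.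
have [X0|X0] := eqVneq (\sum_j A j) 0.
  rewrite big1// => j _.
  have /psumr_eq0P := X0; move=> /(_ (fun i _ => A0 i)) -> //.
  by rewrite powR0 ?lt0r_neq0// mul0r.
have Xp : 0 < \sum_j A j by rewrite lt_neqAle eq_sym X0 sumr_ge0.
have [t2|t2] := eqVneq th2 0.
  case: n A B A0 B0 R0 X0 Xp => [A B _ _ _ _|n A B A0 B0 R0 X0 Xp].
    by rewrite big_ord0 ltxx.
  have E (B' : 'I_n.+1 -> R) :
      \sum_j A j `^ th1 * B' j `^ th2 = \sum_j A j `^ th1.
    by apply: eq_bigr => j _; rewrite t2 powRr0 mulr1.
  have := @sum_hoelder_pos n.+1 A (fun=> 1) A0 (fun=> ler01) Xp.
  rewrite sumr_const card_ord ltr0n => /(_ isT).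
  by rewrite !E t2 !powRr0.
have [Y0|Y0] := eqVneq (\sum_j B j) 0.
  rewrite big1// => j _.
  have /psumr_eq0P := Y0; move=> /(_ (fun i _ => B0 i)) -> //.
  by rewrite powR0// mulr0.
by apply: sum_hoelder_pos => //; rewrite lt_neqAle eq_sym Y0 sumr_ge0.
Qed.

Local Open Scope ereal_scope.

Lemma ereal_sum_hoelder n (A B : 'I_n -> \bar R) :
  (forall j, 0 <= A j) -> (forall j, 0 <= B j) ->
  \sum_j A j `^ th1 * B j `^ th2 <=
  (n%:R `^ (1 - th1 - th2))%:E * ((\sum_j A j) `^ th1 * (\sum_j B j) `^ th2).
Proof.
case: n A B => [|n] A B A0 B0.
  by rewrite big_ord0 !mule_ge0 ?poweR_ge0// lee_fin powR_ge0.
have AS0 : 0 <= \sum_j A j by exact: sume_ge0.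
have BS0 : 0 <= \sum_j B j by exact: sume_ge0.
have R0 : 0 <= (n.+1%:R `^ (1 - th1 - th2))%:E *
    ((\sum_j A j) `^ th1 * (\sum_j B j) `^ th2).
  by rewrite !mule_ge0 ?poweR_ge0// lee_fin powR_ge0.
have th1n : th1 != 0%R by exact: lt0r_neq0.
have npos : 0 < (n.+1%:R `^ (1 - th1 - th2))%:E :> \bar R.
  by rewrite lte_fin powR_gt0// ltr0n.
have A00 : \sum_j A j = 0 -> \sum_j A j `^ th1 * B j `^ th2 = 0.
  move=> h; apply: big1 => j _.
  have : A j = 0.
    apply/eqP; rewrite eq_le A0 andbT -h (bigD1 j)//=.
    by apply: leeDl; exact: sume_ge0.
  by move=> ->; rewrite poweR0r// mul0e.
have B00 : th2 != 0%R -> \sum_j B j = 0 -> \sum_j A j `^ th1 * B j `^ th2 = 0.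
  move=> t2 h; apply: big1 => j _.
  have : B j = 0.
    apply/eqP; rewrite eq_le B0 andbT -h (bigD1 j)//=.
    by apply: leeDl; exact: sume_ge0.
  by move=> ->; rewrite poweR0r// mule0.
have [Bz|Bz] := boolP ((th2 != 0%R) && (\sum_j B j == 0)).
  by case/andP: Bz => t2 /eqP /(B00 t2) ->.
have Bpos : 0 < (\sum_j B j) `^ th2.
  rewrite lt_neqAle poweR_ge0 andbT eq_sym poweR_eq0// andbC.
  by move: Bz.
have [Ay|Ay] := eqVneq (\sum_j A j) +oo.
  by rewrite Ay poweRyr// gt0_mulye// gt0_muley// leey.
have [Az|Az] := eqVneq (\sum_j A j) 0; first by rewrite A00.
have Apos : 0 < (\sum_j A j) `^ th1.
  by rewrite poweR_gt0// lt_neqAle eq_sym Az.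
have [By|By] := boolP ((th2 != 0%R) && (\sum_j B j == +oo)).
  case/andP: By => t2 /eqP ->.
  by rewrite poweRyr// gt0_muley// gt0_muley// leey.
have Afin j : A j \is a fin_num.
  rewrite ge0_fin_numE//; apply: (@le_lt_trans _ _ (\sum_j A j)).
    by rewrite (bigD1 j)//=; apply: leeDl; exact: sume_ge0.
  by rewrite lt_neqAle Ay leey.
(* When [th2] is zero, [B] may be infinite but occurs only to the power zero, so any finite value
   can stand for it. *)
pose A' j := fine (A j); pose B' j := if th2 == 0%R then 0%R else fine (B j).
have A'0 j : (0 <= A' j)%R by rewrite fine_ge0.
have B'0 j : (0 <= B' j)%R by rewrite /B'; case: ifP => // _; rewrite fine_ge0.
have AE j : A j = (A' j)%:E by rewrite fineK.
have ASE : \sum_j A j = (\sum_j A' j)%:E by rewrite -sumEFin; apply: eq_bigr.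
have BE : (forall j, B j `^ th2 = (B' j `^ th2)%:E) /\
    (\sum_j B j) `^ th2 = ((\sum_j B' j)%R `^ th2)%:E.
  have [t2|t2] := eqVneq th2 0%R.
    by split=> [j|]; rewrite t2 poweRe0 powRr0.
  rewrite t2/= in By.
  have Bfin j : B j \is a fin_num.
    rewrite ge0_fin_numE//; apply: (@le_lt_trans _ _ (\sum_j B j)).
      by rewrite (bigD1 j)//=; apply: leeDl; exact: sume_ge0.
    by rewrite lt_neqAle By leey.
  have BjE j : B j = (B' j)%:E by rewrite /B' (negbTE t2) fineK.
  split=> [j|]; first by rewrite BjE poweR_EFin.
  by rewrite (eq_bigr _ (fun j _ => BjE j)) sumEFin poweR_EFin.
have [BE1 BE2] := BE.
rewrite BE2 ASE poweR_EFin.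
under eq_bigr => j _ do rewrite AE BE1 poweR_EFin -EFinM.
by rewrite sumEFin -!EFinM lee_fin; exact: sum_hoelder.
Qed.

End sum_hoelder.

Section disjoint_shells.
Context {R : realType} {n : nat}.
Local Notation lam := (lebesgue_rV R n.+1).
Variables (l : R) (l1 : 1 < l).
Implicit Types (rho : nat -> R).
Local Open Scope ereal_scope.

Lemma trivIset_shell rho : (forall j, 0 < rho j)%R ->
  (forall j, rho j.+1 = l * rho j)%R \/ (forall j, rho j = l * rho j.+1)%R ->
  trivIset setT (fun j => shell (rho j) (l * rho j) : set 'rV[R]_n.+1).
Proof.
move=> rho0 H.
suff dis i j : (i < j)%N -> shell (rho i) (l * rho i) `&` shell (rho j) (l * rho j)
    = set0 :> set 'rV[R]_n.+1.
  apply/trivIsetP => i j _ _; rewrite neq_ltn => /orP[|] ij; first exact: dis.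
  by rewrite setIC dis.
move=> ij; rewrite -subset0 => x [/andP[x1 x2] /andP[x3 x4]].
case: H => H.
  have mono k : (l * rho i <= rho (i + k.+1)%N)%R.
    elim: k => [|k IH]; first by rewrite addn1 H.
    rewrite addnS H; apply: (le_trans IH).
    by rewrite ler_peMl ?(ltW l1)// ltW.
  have := mono (j - i.+1)%N.
  rewrite -addSnnS subnKC// => /(lt_le_trans x2)/lt_le_trans/(_ x3).
  by rewrite ltxx.
have mono k : (l * rho (i + k.+1)%N <= rho i)%R.
  elim: k => [|k IH]; first by rewrite addn1 -H.
  rewrite addnS -H; apply: le_trans IH.
  by rewrite ler_peMl ?(ltW l1)// ltW.
have := mono (j - i.+1)%N.
rewrite -addSnnS subnKC// => /(lt_le_trans x4)/lt_le_trans/(_ x1).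
by rewrite ltxx.
Qed.

Lemma sum_shell_le rho (F : 'rV[R]_n.+1 -> \bar R) m :
  trivIset setT (fun j => shell (rho j) (l * rho j) : set 'rV[R]_n.+1) ->
  measurable_fun setT F -> (forall x, 0 <= F x) ->
  \sum_(j < m) \int[lam]_(x in shell (rho j) (l * rho j)) F x <= \int[lam]_x F x.
Proof.
move=> tI mF F0.
rewrite -(big_mkord xpredT (fun j => \int[lam]_(x in shell (rho j) (l * rho j)) F x)).
have mS (j : nat) : measurable (shell (rho j) (l * rho j) : set 'rV[R]_n.+1).
  exact: measurable_shell.
rewrite /index_iota -ge0_integral_bigsetU//.
- apply: ge0_subset_integral => //.
  by apply: bigsetU_measurable.
- exact: iota_uniq.
- exact: sub_trivIset tI.
- exact: measurable_funS mF.
Qed.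

Lemma integral_double_shell (F : 'rV[R]_n.+1 -> \bar R) (r : R) : (0 < r)%R ->
  measurable_fun setT F -> (forall x, 0 <= F x) ->
  \int[lam]_(x in shell r (l * l * r)) F x =
  \int[lam]_(x in shell r (l * r)) F x +
  \int[lam]_(x in shell (l * r) (l * (l * r))) F x.
Proof.
move=> r0 mF F0.
have -> : shell r (l * l * r) = shell r (l * r) `|` shell (l * r) (l * (l * r))
    :> set 'rV[R]_n.+1.
  have l0 : (0 < l)%R by exact: lt_trans l1.
  have rl : (r <= l * r)%R by rewrite ler_peMl ?(ltW r0) ?(ltW l1).
  have rll : (l * r <= l * (l * r))%R by rewrite ler_pM2l.
  rewrite -mulrA; apply/seteqP; split => x /=.
    move=> /andP[x1 x2]; have [h|h] := ltP (enorm x) (l * r)%R.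
      by left; apply/andP.
    by right; apply/andP.
  move=> [] /andP[x1 x2]; apply/andP; split => //.
    exact: lt_le_trans rll.
  exact: le_trans x1.
rewrite ge0_integral_setU//.
- exact: measurable_shell.
- exact: measurable_shell.
- exact: measurable_funS mF.
- apply/disj_setPS => x [/andP[_ x1] /andP[x2 _]].
  by have := lt_le_trans x1 x2; rewrite ltxx.
Qed.

End disjoint_shells.

Section chain.
Context {R : realType} {n : nat}.
Variables (s t p q tau a alpha beta l : R).
Hypotheses (s0 : 0 < s) (t0 : 0 < t) (ts : t <= s) (p1 : 1 < p) (q1 : 1 <= q)
  (tau1 : 1 <= tau) (a0 : 0 < a) (a1 : a <= 1) (l1 : 1 < l).
Hypothesis tauE : tau^-1 = a * (p^-1 - t) + (1 - a) * q^-1.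
Hypothesis expE : a * (n.+1%:R / p + alpha - s) +
  (1 - a) * (n.+1%:R / q + beta) = 0.
Local Notation lam := (lebesgue_rV R n.+1).
Implicit Types (v : 'rV[R]_n.+1 -> R) (rho : nat -> R).

(** Increasing radii serve functions vanishing in a ball, decreasing ones functions supported in a
    ball; the chain argument is common to both. *)
Definition geometric_radii rho := (forall j, 0 < rho j) /\
  ((forall j, rho j.+1 = l * rho j) \/ (forall j, rho j = l * rho j.+1)).

(** The product of norms in the theorem, with the exponents of the norms merged into the outer ones;
    see [total_boundE]. *)
Definition total_bound v : \bar R :=
  ((\int[lam]_y gagliardo_int s p alpha (l * l) v y) `^ (a / p) *
   (\int[lam]_x (enorm x `^ (beta * q) * `|v x| `^ q)%:E) `^ ((1 - a) / q))%E.

(** [r j] is the inner radius of the j-th pair of neighbouring shells: [rho j] for increasing radii,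
    [rho j.+1] for decreasing ones. Splitting each pair leaves two families of disjoint shells,
    whence the factor 2. *)
Lemma sum_double_shell_le rho (F : 'rV[R]_n.+1 -> \bar R) m :
  geometric_radii rho -> measurable_fun setT F -> (forall x, 0 <= F x)%E ->
  exists2 r : nat -> R,
    (forall j, 0 < r j /\
      ((rho j = r j /\ rho j.+1 = l * r j) \/ (rho j = l * r j /\ rho j.+1 = r j))) &
    (\sum_(j < m) \int[lam]_(x in shell (r j) (l * l * r j)) F x <=
     2%:E * \int[lam]_x F x)%E.
Proof.
move=> [rho0 H] mF F0.
have tI := @trivIset_shell R n l l1 rho rho0 H.
have tI' := @trivIset_shell R n l l1 (rho \o S) (fun j => rho0 j.+1)
  (match H with or_introl h => or_introl (fun j => h j.+1)
              | or_intror h => or_intror (fun j => h j.+1) end).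
have I0 := @sum_shell_le R n l rho F m tI mF F0.
have I1 := @sum_shell_le R n l (rho \o S) F m tI' mF F0.
have two : (2%:E * \int[lam]_x F x = \int[lam]_x F x + \int[lam]_x F x)%E.
  by rewrite -[2]/(1 + 1) EFinD ge0_muleDl ?lee_fin// mul1e.
rewrite two.
case: H => H.
  exists rho; first by move=> j; split; [exact: rho0|left].
  apply: le_trans (leeD I0 I1); rewrite -big_split/= le_eqVlt; apply/orP; left.
  by apply/eqP/eq_bigr => j _; rewrite integral_double_shell// -H.
exists (rho \o S).
  by move=> j; split; [exact: (rho0 j.+1)|right; split; [exact: H|]].
apply: le_trans (leeD I1 I0); rewrite -big_split/= le_eqVlt; apply/orP; left.
by apply/eqP/eq_bigr => j _; rewrite integral_double_shell//= -H.
Qed.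

Lemma chain_bound : exists2 C : R, 0 < C & forall v (M : R),
  measurable_fun setT v -> radial v -> (forall x, `|v x| <= M) ->
  forall rho, geometric_radii rho -> shell_norm tau l v (rho 0%N) = 0%E ->
  forall m, (shell_norm tau l v (rho m) <=
    (C * m%:R `^ (1 - a / p - (1 - a) / q))%:E * total_bound v)%E.
Proof.
have [C C0 step] := shell_norm_step s0 t0 ts p1 q1 tau1 a0 a1 l1 tauE expE.
have p0 : 0 < p by exact: lt_trans p1.
have q0 : 0 < q by exact: lt_le_trans q1.
set th1 := a / p; set th2 := (1 - a) / q.
have th1_gt0 : 0 < th1 by rewrite divr_gt0.
have th2_ge0 : 0 <= th2 by rewrite divr_ge0 ?subr_ge0// ltW.
have th12 : th1 + th2 <= 1.
  have h1 : th1 <= a by rewrite ler_pdivrMr// ler_peMr// ltW.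
  have h2 : th2 <= 1 - a by rewrite ler_pdivrMr// ler_peMr// subr_ge0.
  by apply: (le_trans (lerD h1 h2)); rewrite subrKC.
exists (C * (2 `^ th1 * 2 `^ th2)); first by rewrite !mulr_gt0// powR_gt0.
move=> v M mv rv vM rho grho sn0 m.
have L1 : 1 < l * l by exact: mulr_egt1.
have mG : measurable_fun setT (gagliardo_int s p alpha (l * l) v).
  exact: measurable_gagliardo_int.
have mB : measurable_fun setT (fun x : 'rV[R]_n.+1 =>
    (enorm x `^ (beta * q) * `|v x| `^ q)%:E).
  apply/measurable_EFinP; apply: measurable_funM.
    exact: (measurableT_comp (@measurable_powR R _) (@measurable_enorm R n.+1)).
  apply: (measurableT_comp (@measurable_powR R _)).
  exact: (measurableT_comp (@normr_measurable R setT)).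
have G0 y : (0 <= gagliardo_int s p alpha (l * l) v y)%E.
  exact: gagliardo_int_ge0.
have B0 (x : 'rV[R]_n.+1) : (0 <= (enorm x `^ (beta * q) * `|v x| `^ q)%:E)%E.
  by rewrite lee_fin mulr_ge0// powR_ge0.
have [r rP sG] := sum_double_shell_le m grho mG G0.
have [r' r'P sB] := sum_double_shell_le m grho mB B0.
(* The two uses of [sum_double_shell_le] give a priori different radii, but the inner radius of a
   pair is determined by [rho]: in the mixed cases [rho] would both increase and decrease at [j]. *)
have rr' j : r' j = r j.
  have [r1 E1] := rP j; have [r2 E2] := r'P j.
  have l0 : 0 < l by exact: lt_trans l1.
  case: E1 E2 => [[e1 e2] [[e3 e4]|[e3 e4]]|[e1 e2] [[e3 e4]|[e3 e4]]].
  - by rewrite -e1 -e3.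
  - have h : rho j < rho j.+1 by rewrite e2 -e1 ltr_pMl// e1.
    have h' : rho j.+1 < rho j by rewrite e3 -e4 ltr_pMl// e4.
    by have := lt_trans h h'; rewrite ltxx.
  - have h : rho j < rho j.+1 by rewrite e4 -e3 ltr_pMl// e3.
    have h' : rho j.+1 < rho j by rewrite e1 -e2 ltr_pMl// e2.
    by have := lt_trans h h'; rewrite ltxx.
  - by rewrite -e2 -e4.
have Z0 j : (0 <= step_bound s p q a alpha beta l v (r j))%E.
  by rewrite mule_ge0// poweR_ge0.
(* The one-step estimates are added up from shell 0, where the norm is zero. *)
have sum_step k : (k <= m)%N -> (shell_norm tau l v (rho k) <=
    C%:E * \sum_(j < k) step_bound s p q a alpha beta l v (r j))%E.
  elim: k => [_|k IH km]; first by rewrite sn0 big_ord0 mule0.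
  rewrite big_ord_recr/= ge0_muleDr//; last by apply: sume_ge0.
  have [r1 E1] := rP k; have [u1 u2] := step v M mv rv vM (r k) r1.
  apply: (@le_trans _ _ (shell_norm tau l v (rho k) +
      C%:E * step_bound s p q a alpha beta l v (r k))%E).
    by case: E1 => -[-> ->].
  by apply: leeD2r; apply: IH; exact: ltnW.
apply: (le_trans (sum_step m (leqnn m))).
set A := (\int[lam]_y gagliardo_int s p alpha (l * l) v y)%E in sG *.
set B := (\int[lam]_x (enorm x `^ (beta * q) * `|v x| `^ q)%:E)%E in sB *.
have A0' : (0 <= A)%E by exact: integral_ge0.
have B0' : (0 <= B)%E by exact: integral_ge0.
have sumH := @ereal_sum_hoelder R th1 th2 th1_gt0 th2_ge0 th12 m
  (fun j => \int[lam]_(x in shell (r j) (l * l * r j))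
     gagliardo_int s p alpha (l * l) v x)%E
  (fun j => weighted_int q beta (l * l) v (r j))
  (fun j => integral_ge0 _ (fun y _ => G0 y))
  (fun j => integral_ge0 _ (fun y _ => B0 y)).
have {}sumH : (\sum_(j < m) step_bound s p q a alpha beta l v (r j) <=
    (m%:R `^ (1 - th1 - th2))%:E * ((2%:E * A) `^ th1 * (2%:E * B) `^ th2))%E.
  apply: (le_trans sumH); apply: lee_wpmul2l; first by rewrite lee_fin powR_ge0.
  apply: lee_pmul; rewrite ?poweR_ge0//.
    apply: gt0_ler_poweR; rewrite ?(ltW th1_gt0) ?in_itv/= ?leey ?andbT//.
      by apply: sume_ge0 => j _; apply: integral_ge0.
    by rewrite mule_ge0.
  apply: gt0_ler_poweR; rewrite ?in_itv/= ?leey ?andbT//.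
  - by apply: sume_ge0 => j _; apply: integral_ge0.
  - by rewrite mule_ge0.
  - by under eq_bigr do rewrite /weighted_int -rr'.
apply: (le_trans (lee_wpmul2l _ sumH)); first by rewrite lee_fin ltW.
rewrite !poweRM// !poweR_EFin /total_bound -/A -/B -/th1 -/th2.
move: (A `^ th1)%E (B `^ th2)%E => X Y.
rewrite muleACA !muleA -!EFinM le_eqVlt; apply/orP; left; apply/eqP.
congr (_%:E * _ * _)%E; ring.
Qed.

End chain.

(** * The logarithmic weight *)

(** Comparison with the integral of x^(-1 - eta), made discrete so that the bound telescopes. Each
    term reduces to 1 + eta / (x + 1) <= ((x + 1) / x)^eta, which follows from e^z >= 1 + z and
    ln((x + 1) / x) >= 1 / (x + 1). *)
Lemma riemann_sum_le (R : realType) (eta : R) (m : nat) : 0 < eta ->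
  \sum_(j < m) j.+1%:R `^ (- (1 + eta)) <= 1 + eta^-1.
Proof.
move=> eta0.
have pos (j : nat) : 0 < j.+1%:R :> R by rewrite ltr0n.
have term (j : nat) : j.+2%:R `^ (- (1 + eta)) <=
    eta^-1 * (j.+1%:R `^ (- eta) - j.+2%:R `^ (- eta)) :> R.
  set x : R := j.+1%:R; have xE : j.+2%:R = x + 1 by rewrite natr1.
  have x0 : 0 < x by exact: pos.
  have x10 : 0 < x + 1 by rewrite addr_gt0.
  rewrite xE ler_pdivlMl//.
  have -> : (x + 1) `^ (- (1 + eta)) = (x + 1) `^ (- eta) / (x + 1).
    rewrite opprD [- 1 + _]addrC powRD ?(lt0r_neq0 x10) ?implybT//.
    by rewrite powR_inv1 ?(ltW x10).
  have -> : x `^ (- eta) = (x + 1) `^ (- eta) * ((x + 1) / x) `^ eta.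
    rewrite powRM ?invr_ge0 ?(ltW x0) ?(ltW x10)//.
    rewrite mulrA -powRD ?(lt0r_neq0 x10) ?implybT// addNr powRr0 mul1r.
    by rewrite -(powR_inv1 (ltW x0)) -powRrM mulN1r.
  rewrite -{3}[(x + 1) `^ (- eta)]mulr1 -mulrBr mulrCA ler_pM2l ?powR_gt0//.
  have y0 : 0 < (x + 1) / x by rewrite divr_gt0.
  have -> : ((x + 1) / x) `^ eta = expR (eta * ln ((x + 1) / x)).
    by rewrite /powR (negbTE (lt0r_neq0 y0)).
  rewrite lerBrDl; apply: le_trans (expR_ge1Dx _).
  rewrite lerD2l ler_pM2l//.
  have h : ln (1 + (- (x + 1)^-1)) <= - (x + 1)^-1.
    apply: le_ln1Dx; rewrite ltrN2 invf_lt1//.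
    by rewrite ltrDr.
  have -> : (x + 1) / x = (1 + (- (x + 1)^-1))^-1.
    by field; rewrite !lt0r_neq0//; rewrite addrK.
  rewrite lnV ?posrE; last first.
    by rewrite subr_gt0 invf_lt1// ltrDr.
  by rewrite lerNr.
case: m => [|m]; first by rewrite big_ord0 addr_ge0// invr_ge0 ltW.
have : \sum_(j < m.+1) j.+1%:R `^ (- (1 + eta)) <=
    1 + eta^-1 * (1 - m.+1%:R `^ (- eta)) :> R.
  elim: m => [|m IH].
    by rewrite big_ord_recr big_ord0/= add0r !powR1 subrr mulr0 addr0.
  rewrite big_ord_recr/=; apply: (le_trans (lerD IH (term m))).
  by rewrite le_eqVlt; apply/orP; left; apply/eqP; ring.
move=> /le_trans; apply; rewrite lerD2l ler_piMr ?invr_ge0 ?(ltW eta0)//.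
Qed.

Section log_weight.
Context {R : realType} {n : nat}.
Variables (s t p q tau a alpha beta l mu : R).
Hypotheses (s0 : 0 < s) (t0 : 0 < t) (ts : t <= s) (p1 : 1 < p) (q1 : 1 <= q)
  (tau1 : 1 <= tau) (a0 : 0 < a) (a1 : a <= 1) (l1 : 1 < l) (taumu : tau <= mu).
Hypothesis tauE : tau^-1 = a * (p^-1 - t) + (1 - a) * q^-1.
Hypothesis expE : a * (n.+1%:R / p + alpha - s) +
  (1 - a) * (n.+1%:R / q + beta) = 0.
Local Notation lam := (lebesgue_rV R n.+1).
Local Notation N := (n.+1%:R : R).
Implicit Types (v : 'rV[R]_n.+1 -> R) (rho : nat -> R) (g : 'rV[R]_n.+1 -> R).

(** In the critical case [gamma * tau] equals [- N]; [g] stands for either logarithm. *)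
Definition log_integrand g v x : \bar R :=
  (enorm x `^ (- N) / g x `^ mu * `|v x| `^ tau)%:E.

Lemma log_integrand_ge0 g v x : (0 <= log_integrand g v x)%E.
Proof. by rewrite lee_fin !mulr_ge0 ?invr_ge0 ?powR_ge0. Qed.

Lemma measurable_log_integrand g v : measurable_fun setT g ->
  measurable_fun setT v -> measurable_fun setT (log_integrand g v).
Proof.
move=> mg mv; apply/measurable_EFinP; apply: measurable_funM.
  apply: measurable_funM.
    exact: (measurableT_comp (@measurable_powR R _) (@measurable_enorm R n.+1)).
  have mV : measurable_fun setT (fun x => g x `^ (- mu)).
    exact: (measurableT_comp (@measurable_powR R _) mg).
  by apply: eq_measurable_fun mV => x _; rewrite powRN.
apply: (measurableT_comp (@measurable_powR R _)).
exact: (measurableT_comp (@normr_measurable R setT)).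
Qed.

Lemma log_shell_le g v (c r : R) : measurable_fun setT g ->
  measurable_fun setT v -> 0 < r -> 0 < c ->
  (forall x, r <= enorm x < l * r -> c <= g x) ->
  (\int[lam]_(x in shell r (l * r)) log_integrand g v x <=
   (c `^ (- mu))%:E * shell_norm tau l v r `^ tau)%E.
Proof.
move=> mg mv r0 c0 gc.
have tau0 : 0 < tau by exact: lt_le_trans tau1.
have mvt : measurable_fun (shell r (l * r)) (fun x => (`|v x| `^ tau)%:E).
  apply/measurable_EFinP; apply: (measurableT_comp (@measurable_powR R _)).
  apply: (measurableT_comp (@normr_measurable R setT)).
  exact: measurable_funTS.
have mS := @measurable_shell R n r (l * r).
have v0 x : (0 <= (`|v x| `^ tau)%:E)%E by rewrite lee_fin powR_ge0.
apply: (@le_trans _ _ (\int[lam]_(x in shell r (l * r))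
    ((c `^ (- mu) * r `^ (- N))%:E * (`|v x| `^ tau)%:E))%E).
  apply: ge0_le_integral => //.
  - by move=> x _; exact: log_integrand_ge0.
  - by apply: measurable_funTS; exact: measurable_log_integrand.
  - exact: emeasurable_funM.
  - move=> x xr; rewrite -EFinM lee_fin ler_wpM2r ?powR_ge0//.
    have /andP[x1 x2] := xr; have gx := gc x xr.
    have x0 : 0 < enorm x by exact: lt_le_trans x1.
    have g0 : 0 < g x by exact: lt_le_trans gx.
    have mu0 : 0 <= mu by rewrite (le_trans _ taumu)// ltW.
    rewrite mulrC; apply: ler_pM; rewrite ?invr_ge0 ?powR_ge0//.
      rewrite powRN lef_pV2 ?posrE ?powR_gt0//.
      by rewrite ge0_ler_powR ?nnegrE ?(ltW c0) ?(ltW g0).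
    rewrite !powRN lef_pV2 ?posrE ?powR_gt0//.
    by rewrite ge0_ler_powR ?nnegrE ?(ltW r0) ?(ltW x0).
rewrite ge0_integralZl_EFin ?mulr_ge0 ?powR_ge0//.
have I0 : (0 <= \int[lam]_(x in shell r (l * r)) (`|v x| `^ tau)%:E)%E.
  exact: integral_ge0.
rewrite /shell_norm poweRM ?poweR_ge0 ?lee_fin ?powR_ge0//.
rewrite -poweRrM mulVf ?lt0r_neq0// poweRe1// poweR_EFin -powRrM.
by rewrite mulNr divfK ?lt0r_neq0// EFinM muleA.
Qed.

Lemma log_bound_bounded (c : R) : 0 < c -> exists2 C : R, 0 < C & forall v (M : R) g,
  measurable_fun setT v -> radial v -> (forall x, `|v x| <= M) ->
  measurable_fun setT g ->
  forall rho, geometric_radii l rho -> shell_norm tau l v (rho 0%N) = 0%E ->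
  (forall j x, rho j.+1 <= enorm x < l * rho j.+1 -> c * j.+1%:R <= g x) ->
  (\int[lam]_(x in \bigcup_j shell (rho j.+1) (l * rho j.+1)) log_integrand g v x <=
   C%:E * total_bound s p q a alpha beta l v `^ tau)%E.
Proof.
move=> c0.
have [C C0 chain] := chain_bound s0 t0 ts p1 q1 tau1 a0 a1 l1 tauE expE.
have tau0 : 0 < tau by exact: lt_le_trans tau1.
have p0 : 0 < p by exact: lt_trans p1.
have q0 : 0 < q by exact: lt_le_trans q1.
set th := 1 - a / p - (1 - a) / q in chain.
(* By [tauE] the growth exponent [th * tau] is tau - 1 - a t tau, so [1 + eta] is the decay left by
   the weight; [eta] is positive even when [mu = tau]. *)
pose eta := mu - tau + a * t * tau.
have eta0 : 0 < eta by rewrite ltr_wpDl ?subr_ge0// !mulr_gt0.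
have etaE : - mu + th * tau = - (1 + eta).
  have : (a * (p^-1 - t) + (1 - a) / q) * tau = 1.
    by rewrite -tauE mulVf// lt0r_neq0.
  rewrite /th /eta => h.
  have -> : (1 - a / p - (1 - a) / q) * tau =
     tau - (a * (p^-1 - t) + (1 - a) / q) * tau - a * t * tau by ring.
  by rewrite h; ring.
pose K := c `^ (- mu) * C `^ tau.
have K0 : 0 < K by rewrite mulr_gt0// powR_gt0.
exists (K * (1 + eta^-1)).
  by rewrite mulr_gt0// addr_gt0// invr_gt0.
move=> v M g mv rv vM mg rho grho sn0 hg.
have [rho0 rhoH] := grho.
set Z := total_bound s p q a alpha beta l v.
have Z0 : (0 <= Z)%E by rewrite mule_ge0// poweR_ge0.
have term j : (\int[lam]_(x in shell (rho j.+1) (l * rho j.+1)) log_integrand g v x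
   <= (K * j.+1%:R `^ (- (1 + eta)))%:E * Z `^ tau)%E.
  have cj : 0 < c * j.+1%:R by rewrite mulr_gt0// ltr0n.
  apply: (le_trans (log_shell_le mg mv (rho0 j.+1) cj (hg j))).
  have j0 : 0 < j.+1%:R :> R by rewrite ltr0n.
  have := chain v M mv rv vM rho grho sn0 j.+1; rewrite -/Z => h.
  have Cj0 : 0 <= C * j.+1%:R `^ th by rewrite mulr_ge0 ?powR_ge0// ltW.
  apply: (@le_trans _ _ (((c * j.+1%:R) `^ (- mu))%:E *
     ((C * j.+1%:R `^ th)%:E * Z) `^ tau)%E).
    apply: lee_wpmul2l; first by rewrite lee_fin powR_ge0.
    apply: gt0_ler_poweR => //; rewrite ?(ltW tau0) ?in_itv/= ?leey ?andbT//.
      exact: shell_norm_ge0.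
    by rewrite mule_ge0.
  rewrite poweRM ?lee_fin// poweR_EFin muleA -EFinM.
  rewrite le_eqVlt; apply/orP; left; apply/eqP; congr (_%:E * _)%E.
  rewrite (powRM _ (ltW c0) (ltW j0)) (powRM _ (ltW C0) (powR_ge0 _ _)).
  rewrite -powRrM /K -etaE powRD ?(lt0r_neq0 j0) ?implybT//.
  by ring.
have tI := @trivIset_shell R n l l1 (rho \o S) (fun j => rho0 j.+1)
  (match rhoH with or_introl h => or_introl (fun j => h j.+1)
              | or_intror h => or_intror (fun j => h j.+1) end).
rewrite ge0_integral_bigcup//.
- apply: lime_le.
    apply: is_cvg_nneseries => j _ _; apply: integral_ge0 => x _.
    exact: log_integrand_ge0.
  apply: nearW => m; rewrite big_mkord.
  apply: (le_trans (lee_sum _ (fun (j : 'I_m) _ => term j))).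
  rewrite -ge0_sume_distrl; last first.
    by move=> j _; rewrite lee_fin mulr_ge0 ?powR_ge0// ltW.
  apply: lee_wpmul2r; first exact: poweR_ge0.
  rewrite sumEFin lee_fin -mulr_sumr ler_pM2l//.
  exact: riemann_sum_le.
- by move=> j; exact: measurable_shell.
- by apply: measurable_funTS; exact: measurable_log_integrand.
- by move=> x _; exact: log_integrand_ge0.
Qed.

End log_weight.

(** * Truncation and removal of the boundedness assumption *)

Section clip.
Context {R : realType}.
Implicit Types (k a b : R).

Definition clip k a : R := Num.max (- k) (Num.min k a).

Lemma norm_clip k a : 0 <= k -> `|clip k a| = Num.min k `|a|.
Proof.
move=> k0; rewrite /clip.
have [ka|ak] := leP k a.
  have -> : Num.max (- k) k = k by apply/max_idPr; lra.
  rewrite (ger0_norm k0) ger0_norm; last exact: le_trans ka.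
  by apply/esym/min_idPl.
have [ka|ka] := leP (- k) a.
  by rewrite min_r// ler_norml ka ltW.
rewrite normrN (ger0_norm k0) min_l// ltr0_norm; last by lra.
by lra.
Qed.

Lemma le_norm_clip k a : 0 <= k -> `|clip k a| <= `|a|.
Proof. by move=> k0; rewrite norm_clip// ge_min lexx orbT. Qed.

Lemma clip_lipschitz k a b : 0 <= k -> `|clip k a - clip k b| <= `|a - b|.
Proof.
move=> k0; rewrite /clip ler_norml.
have h1 := ler_norm (a - b); have h2 := ler_norm (b - a).
rewrite distrC in h2.
by case: (leP k a) => ?; case: (leP k b) => ?; case: (leP (- k) k) => ?;
  case: (leP (- k) a) => ?; case: (leP (- k) b) => ?; apply/andP; split; lra.
Qed.

Lemma measurable_clip k : measurable_fun setT (clip k).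
Proof. by apply: measurable_maxr => //; exact: measurable_minr. Qed.

End clip.

(* [cell_bound] absorbs a power of an [L^tau] norm, which therefore has to be
   finite; hence the truncation of [u]. *)
Section log_bound.
Context {R : realType} {n : nat}.
Variables (s t p q tau a alpha beta l mu : R).
Hypotheses (s0 : 0 < s) (t0 : 0 < t) (ts : t <= s) (p1 : 1 < p) (q1 : 1 <= q)
  (tau1 : 1 <= tau) (a0 : 0 < a) (a1 : a <= 1) (l1 : 1 < l) (taumu : tau <= mu).
Hypothesis tauE : tau^-1 = a * (p^-1 - t) + (1 - a) * q^-1.
Hypothesis expE : a * (n.+1%:R / p + alpha - s) +
  (1 - a) * (n.+1%:R / q + beta) = 0.
Local Notation lam := (lebesgue_rV R n.+1).
Local Notation N := (n.+1%:R : R).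
Implicit Types (v : 'rV[R]_n.+1 -> R) (rho : nat -> R) (g : 'rV[R]_n.+1 -> R).

Let tau0 : 0 < tau. Proof. exact: lt_le_trans tau1. Qed.
Let p0 : 0 < p. Proof. exact: lt_trans p1. Qed.
Let q0 : 0 < q. Proof. exact: lt_le_trans q1. Qed.

Let clipu (u : 'rV[R]_n.+1 -> R) (k : nat) x := clip k%:R (u x).

Let mclipu u k : measurable_fun setT u -> measurable_fun setT (clipu u k).
Proof. by move=> mu'; exact: (measurableT_comp (measurable_clip _) mu'). Qed.

Let total_bound_clip u k : measurable_fun setT u ->
  (total_bound s p q a alpha beta l (clipu u k) <=
   total_bound s p q a alpha beta l u)%E.
Proof.
move=> mu'; have mc := mclipu k mu'.
have me := @measurable_enorm R n.+1.
have mB v : measurable_fun setT v -> measurable_fun setT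
    (fun x : 'rV[R]_n.+1 => (enorm x `^ (beta * q) * `|v x| `^ q)%:E).
  move=> mv; apply/measurable_EFinP; apply: measurable_funM.
    exact: (measurableT_comp (@measurable_powR R _) me).
  apply: (measurableT_comp (@measurable_powR R _)).
  exact: (measurableT_comp (@normr_measurable R setT)).
rewrite /total_bound; apply: lee_pmul; [exact: poweR_ge0|exact: poweR_ge0| |].
  apply: gt0_ler_poweR; rewrite ?in_itv/= ?leey ?andbT.
  - by rewrite divr_ge0 ?(ltW a0) ?(ltW p0).
  - by apply: integral_ge0 => y _; exact: gagliardo_int_ge0.
  - by apply: integral_ge0 => y _; exact: gagliardo_int_ge0.
  apply: ge0_le_integral; first exact: measurableT.
  - by move=> y _; exact: gagliardo_int_ge0.
  - exact: measurable_gagliardo_int.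
  - exact: measurable_gagliardo_int.
  move=> y _; apply: ge0_le_integral; first exact: measurableT.
  - by move=> x _; rewrite lee_fin gagliardo_ge0.
  - exact: (measurableT_comp (measurable_gagliardo _ _ _ _ mc) (measurable_pair2 y)).
  - exact: (measurableT_comp (measurable_gagliardo _ _ _ _ mu') (measurable_pair2 y)).
  move=> x _; rewrite lee_fin /gagliardo.
  rewrite ler_wpM2r ?chi_ge0// ler_wpM2r ?invr_ge0 ?powR_ge0//.
  rewrite ler_wpM2r ?powR_ge0// ge0_ler_powR ?nnegrE ?(ltW p0)//.
  exact: clip_lipschitz.
apply: gt0_ler_poweR; rewrite ?in_itv/= ?leey ?andbT.
- by rewrite divr_ge0 ?subr_ge0 ?(ltW q0).
- by apply: integral_ge0 => y _; rewrite lee_fin mulr_ge0// powR_ge0.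
- by apply: integral_ge0 => y _; rewrite lee_fin mulr_ge0// powR_ge0.
apply: ge0_le_integral => //.
- by move=> y _; rewrite lee_fin mulr_ge0// powR_ge0.
- exact: mB.
- exact: mB.
move=> x _; rewrite lee_fin ler_wpM2l ?powR_ge0//.
by rewrite ge0_ler_powR ?nnegrE ?(ltW q0)//; exact: le_norm_clip (ler0n _ _).
Qed.

(** The constant for bounded functions does not depend on their bound [M], and truncation, being
    1-Lipschitz and decreasing absolute values, does not increase [total_bound]. The truncations of
    [u] are eventually equal to [u] at each point with increasing modulus, so monotone convergence
    concludes. *)
Lemma log_bound (c : R) : 0 < c -> exists2 C : R, 0 < C & forall u g,
  measurable_fun setT u -> radial u -> measurable_fun setT g ->
  forall rho, geometric_radii l rho ->
  {ae lam, forall x, shell (rho 0%N) (l * rho 0%N) x -> u x = 0} ->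
  (forall j x, rho j.+1 <= enorm x < l * rho j.+1 -> c * j.+1%:R <= g x) ->
  (\int[lam]_(x in \bigcup_j shell (rho j.+1) (l * rho j.+1))
     log_integrand tau mu g u x <=
   C%:E * total_bound s p q a alpha beta l u `^ tau)%E.
Proof.
move=> c0.
have [C C0 bnd] := log_bound_bounded s0 t0 ts p1 q1 tau1 a0 a1 l1 taumu tauE expE c0.
exists C => // u g mu' ru mg rho grho ae0 hg.
set E := \bigcup_j _.
have mE : measurable E.
  by apply: bigcup_measurable => j _; exact: measurable_shell.
have bk k : (\int[lam]_(x in E) log_integrand tau mu g (clipu u k) x <=
    C%:E * total_bound s p q a alpha beta l u `^ tau)%E.
  have mc := mclipu k mu'.
  apply: (@le_trans _ _ (C%:E * total_bound s p q a alpha beta l (clipu u k) `^ tau)%E).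
    apply: (bnd _ k%:R g) => //.
    - by move=> x y xy; rewrite /clipu (ru x y xy).
    - by move=> x; rewrite /clipu norm_clip// ge_min lexx.
    - rewrite /shell_norm (_ : (\int[lam]_(x in _) _)%E = 0%E).
        by rewrite poweR0r ?mule0// invr_eq0 lt0r_neq0.
      apply: ae0_integral => //.
      - exact: measurable_shell.
      - apply/measurable_EFinP; apply: (measurableT_comp (@measurable_powR R _)).
        apply: (measurableT_comp (@normr_measurable R setT)).
        exact: measurable_funTS.
      apply: filterS ae0 => x hx /hx ux.
      have : `|clipu u k x| <= 0.
        by apply: (le_trans (le_norm_clip (u x) (ler0n _ k))); rewrite ux normr0.
      by rewrite normr_le0 => /eqP ->; rewrite normr0 powR0// lt0r_neq0.
  apply: lee_wpmul2l; first by rewrite lee_fin ltW.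
  apply: gt0_ler_poweR; rewrite ?in_itv/= ?leey ?andbT.
  - exact: ltW.
  - by rewrite mule_ge0// poweR_ge0.
  - by rewrite mule_ge0// poweR_ge0.
  - exact: total_bound_clip.
have limE x : (limn (fun k => log_integrand tau mu g (clipu u k) x) =
    log_integrand tau mu g u x)%E.
  apply: lim_near_cst => //.
  exists (Num.bound `|u x|) => // k /= kb.
  have ku : `|u x| <= k%:R.
    rewrite ltW// (lt_le_trans (archi_boundP (normr_ge0 _)))// ler_nat//.
  by rewrite /log_integrand /clipu norm_clip// min_r.
rewrite (eq_integral (fun x =>
    limn (fun k => log_integrand tau mu g (clipu u k) x))); last first.
  by move=> x _; rewrite limE.
have mL k : measurable_fun E (log_integrand tau mu g (clipu u k)).
  by apply: measurable_funTS; apply: measurable_log_integrand => //; exact: mclipu.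
rewrite monotone_convergence//.
- apply: lime_le.
    apply: ereal_nondecreasing_is_cvgn => k m km; apply: ge0_le_integral => //.
      by move=> x _; exact: log_integrand_ge0.
    move=> x _; rewrite lee_fin ler_wpM2l ?mulr_ge0 ?invr_ge0 ?powR_ge0//.
    rewrite ge0_ler_powR ?nnegrE ?(ltW tau0)// /clipu !norm_clip//.
    by rewrite le_min !ge_min lexx orbT andbT ler_nat km.
  by apply: nearW => k; exact: bk.
- by move=> k x _; exact: log_integrand_ge0.
- move=> x _ k m km; rewrite lee_fin ler_wpM2l ?mulr_ge0 ?invr_ge0 ?powR_ge0//.
  rewrite ge0_ler_powR ?nnegrE ?(ltW tau0)// /clipu !norm_clip//.
  by rewrite le_min !ge_min lexx orbT andbT ler_nat km.
Qed.

End log_bound.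

(** * Essential support *)

Section ess_support.
Context {R : realType} {n : nat}.
Local Notation lam := (lebesgue_rV R n).
Implicit Types (u : 'rV[R]_n -> R).

Lemma enorm_le_norm (x : 'rV[R]_n) : enorm x <= n%:R * `|x|.
Proof.
apply: enorm_le_coord => // i.
rewrite [leRHS]/Num.norm/= mx_normrE.
by apply/bigmax_geP; right; exists (ord0, i).
Qed.

Lemma continuous_enorm : continuous (@enorm R n).
Proof.
move=> x; apply/(@cvgrPdist_lt _ _ _ _ (nbhs_filter x)) => e e0.
have e1 : 0 < e / n.+1%:R by rewrite divr_gt0// ltr0n.
have := nbhsx_ballx x _ e1; rewrite mx_norm_ball; apply: filterS => y /= xy.
apply: (le_lt_trans (enorm_dist _ _)).
apply: (le_lt_trans (enorm_le_norm _)).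
apply: (@le_lt_trans _ _ (n.+1%:R * `|x - y|)).
  by rewrite ler_wpM2r// ler_nat.
by rewrite mulrC -ltr_pdivlMr ?ltr0n.
Qed.

Lemma compact_closed_shell (a b : R) :
  compact [set x : 'rV[R]_n | a <= enorm x <= b].
Proof.
apply: bounded_closed_compact.
  exists b; split; first exact: num_real.
  move=> M bM x /andP[_ xb]; rewrite /= [leLHS]/Num.norm/= mx_normrE.
  apply/bigmax_leP; split.
    by rewrite (le_trans (enorm_ge0 x))// (le_trans xb)// ltW.
  move=> [i j] _ /=; rewrite (ord1 i) (le_trans (enorm_coord x j))//.
  by rewrite (le_trans xb)// ltW.
rewrite (_ : [set x | _] = @enorm R n @^-1` `[a, b]%classic).
  by apply: closed_comp; [move=> x _; exact: continuous_enorm|exact: itv_closed].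
by apply/seteqP; split => x /=; rewrite in_itv.
Qed.

(** Each point of [K] has an open neighbourhood on which [u] vanishes almost everywhere, and
    finitely many of them cover [K]. *)
Lemma ess_support_compact0 u (K : set 'rV[R]_n) : compact K ->
  ess_support u `&` K = set0 -> {ae lam, forall x, K x -> u x = 0}.
Proof.
rewrite compact_cover => cK suK.
have P x : exists U : set 'rV[R]_n, K x ->
    [/\ open U, U x & {ae lam, forall y, U y -> u y = 0}].
  have [Kx|nK] := pselect (K x); last by exists set0.
  have : ~ ess_support u x.
    by move=> sx; have : set0 x by rewrite -suK.
  move=> /existsNP[U] /not_implyP[oU] /not_implyP[Ux] /contrapT h.
  by exists U.
pose f x := sval (cid (P x)).
have fP x : K x -> [/\ open (f x), f x x & {ae lam, forall y, f x y -> u y = 0}].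
  by rewrite /f; case: cid.
have [|x Kx|D DK KD] := cK _ K f.
- by move=> x /fP[].
- by exists x => //; have [] := fP x Kx.
have /filter_bigI : forall x, x \in D ->
    almost_everywhere lam [set y | f x y -> u y = 0].
  by move=> x /DK; rewrite inE => /fP[].
by apply: filterS => y hy /KD[x Dx fxy]; exact: (hy x Dx).
Qed.

Lemma ess_support_bigcup0 u (A : set 'rV[R]_n) (K : nat -> set 'rV[R]_n) :
  (forall j, compact (K j)) -> A `<=` \bigcup_j K j ->
  (forall j, ess_support u `&` K j = set0) ->
  {ae lam, forall x, A x -> u x = 0}.
Proof.
move=> cK AK suK.
have ae0 : {ae lam, forall x, forall j, K j x -> u x = 0}.
  by apply: ae_foralln => j; exact: ess_support_compact0.
by apply: filterS ae0 => x hx /AK[j _ /hx].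
Qed.

Lemma ess_support_sub_eball u r : ess_support u `<=` eball r ->
  {ae lam, forall x, r <= enorm x -> u x = 0}.
Proof.
move=> su.
apply: (@ess_support_bigcup0 u [set x | r <= enorm x]
  (fun j => [set x : 'rV[R]_n | r <= enorm x <= j%:R])).
- by move=> j; exact: compact_closed_shell.
- move=> x /= rx; exists (Num.bound (enorm x)) => //=.
  by rewrite rx ltW// archi_boundP// enorm_ge0.
- move=> j; rewrite -subset0 => x [/su + /andP[rx _]].
  by rewrite /eball/= ltNge rx.
Qed.

(** The open ball is exhausted by the compact balls of radius r - 1 / (j + 1). *)
Lemma ess_support_eball0 u r : ess_support u `&` eball r = set0 ->
  {ae lam, forall x, enorm x < r -> u x = 0}.
Proof.
move=> su.
apply: (@ess_support_bigcup0 u [set x | enorm x < r]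
  (fun j => [set x : 'rV[R]_n | 0 <= enorm x <= r - j.+1%:R^-1])).
- by move=> j; exact: compact_closed_shell.
- move=> x /= rx; have h : 0 < r - enorm x by rewrite subr_gt0.
  exists (Num.bound (r - enorm x)^-1) => //=; rewrite enorm_ge0/=.
  rewrite lerBrDr -lerBrDl invf_ple ?posrE ?ltr0n//.
  rewrite ltW// (lt_trans (archi_boundP _)) ?invr_ge0 ?(ltW h)//.
  by rewrite ltr_nat.
- move=> j; rewrite -subset0 => x [sx /andP[_ xr]].
  have : (ess_support u `&` eball r) x.
    split => //; rewrite /eball/=; apply: (le_lt_trans xr).
    by rewrite ltrBlDr ltrDl invr_gt0 ltr0n.
  by rewrite su.
Qed.

End ess_support.

(** * Locating a number between consecutive powers *)

Section powers.
Context {R : realType}.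
Implicit Types (l y : R).

Lemma exp_unbounded l y : 1 < l -> exists j : nat, y < l ^+ j.
Proof.
move=> l1; have h0 : 0 < l - 1 by rewrite subr_gt0.
exists (Num.bound (`|y| / (l - 1))).
set k := Num.bound _.
have hk : `|y| / (l - 1) < k%:R.
  by apply: archi_boundP; rewrite divr_ge0// ltW.
have B m : 1 + m%:R * (l - 1) <= l ^+ m.
  elim: m => [|m IH]; first by rewrite mul0r addr0 expr0.
  rewrite exprS -natr1.
  have m0 : 0 <= m%:R :> R by [].
  have := ler_pM2l (lt_trans ltr01 l1) (1 + m%:R * (l - 1)) (l ^+ m).
  rewrite IH => h; apply: le_trans h; rewrite -subr_ge0.
  rewrite (_ : _ - _ = m%:R * (l - 1) ^+ 2); last by ring.
  by rewrite mulr_ge0// sqr_ge0.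
apply: lt_le_trans (B k); rewrite ltr_pdivrMr// in hk.
have := ler_norm y; lra.
Qed.

Lemma exp_bracket l y : 1 < l -> 1 <= y ->
  exists j : nat, l ^+ j <= y < l ^+ j.+1.
Proof.
move=> l1 y1; have := exp_unbounded y l1; move=> ex.
have [j hj jmin] := ex_minnP ex.
case: j hj jmin => [|j] hj jmin; first by move: hj; rewrite expr0 ltNge y1.
exists j; rewrite hj andbT leNgt; apply/negP => /jmin.
by rewrite ltnn.
Qed.

(** The variant for y = r / |x|: inversion exchanges the closed and the open end of a shell. *)
Lemma exp_bracketW l y : 1 < l -> 1 < y ->
  exists j : nat, l ^+ j < y <= l ^+ j.+1.
Proof.
move=> l1 y1.
have ex : exists j : nat, y <= l ^+ j.
  by have [j /ltW] := exp_unbounded y l1; exists j.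
have [j hj jmin] := ex_minnP ex.
case: j hj jmin => [|j] hj jmin; first by move: hj; rewrite expr0 leNgt y1.
exists j; rewrite hj andbT ltNge; apply/negP => /jmin.
by rewrite ltnn.
Qed.

(** The factor 2 in the logarithm supplies the extra unit in [j.+1], so that the weight is already
    bounded below on the first shell. *)
Lemma ln_exp_ge l y (j : nat) : 1 < l -> 2 * l ^+ j <= y ->
  Num.min (ln 2) (ln l) * j.+1%:R <= ln y.
Proof.
move=> l1 yj; have l0 : 0 < l by exact: lt_trans l1.
have lj : 0 < 2 * l ^+ j by rewrite mulr_gt0// exprn_gt0.
apply: (@le_trans _ _ (ln (2 * l ^+ j))); last first.
  by rewrite ler_ln ?posrE// (lt_le_trans lj).
rewrite lnM ?posrE ?exprn_gt0// lnXn// -[ln l *+ j]mulr_natr.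
set m := Num.min _ _; rewrite (_ : m * _ = m + m * j%:R); last first.
  by rewrite -natr1; ring.
rewrite {}/m.
apply: lerD; first by rewrite ge_min lexx.
by apply: ler_wpM2r => //; rewrite ge_min lexx orbT.
Qed.

End powers.

(** * The theorem *)

(** Local integrability away from the origin gives measurability only there, whereas the integrals
    run over the whole space. *)
Lemma measurable_fun_punctured (R : realType) (n : nat) (u : 'rV[R]_n -> R) :
  measurable_fun (~` [set (0 : 'rV[R]_n)]) u -> measurable_fun setT u.
Proof.
move=> mu'.
have m0 : measurable [set (0 : 'rV[R]_n)].
  rewrite (_ : [set 0] = @enorm R n @^-1` [set 0]).
    by rewrite -[X in measurable X]setTI; exact: measurable_enorm.
  by apply/seteqP; split => x /= => [->|/enorm_eq0//]; rewrite enorm0.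
rewrite -(setUv [set (0 : 'rV[R]_n)]); apply/measurable_funU => //.
  exact: measurableC.
split => //; exact: measurable_fun_set1.
Qed.

Section total_bound.
Context {R : realType} {n : nat}.
Local Notation lam := (lebesgue_rV R n.+1).

Lemma total_boundE (s p q a alpha beta l : R) (u : 'rV[R]_n.+1 -> R) :
  q != 0 ->
  total_bound s p q a alpha beta l u =
  (sobolev_seminorm s p alpha (l * l) setT u `^ a *
   'N[lam]_(q%:E)[(fun x => (enorm x `^ beta * u x)%:E)] `^ (1 - a))%E.
Proof.
move=> q0; rewrite /total_bound; congr (_ * _)%E.
  by rewrite /sobolev_seminorm -poweRrM [p^-1 * a]mulrC.
rewrite unlock /Lnorm -poweRrM [q^-1 * _]mulrC; congr (_ `^ _)%E.
apply: eq_integral => x _; rewrite abse_EFin poweR_EFin; congr EFin.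
by rewrite normrM ger0_norm ?powR_ge0// powRM ?powR_ge0// -powRrM.
Qed.

Lemma integral_shells_le (s p q tau a alpha beta l mu C : R) rho
    (u g : 'rV[R]_n.+1 -> R) :
  0 < tau -> 0 < C -> measurable_fun setT u -> measurable_fun setT g ->
  {ae lam, forall x, (forall j, ~ shell (rho j.+1) (l * rho j.+1) x) ->
     log_integrand tau mu g u x = 0%E} ->
  (\int[lam]_(x in \bigcup_j shell (rho j.+1) (l * rho j.+1))
     log_integrand tau mu g u x <=
   C%:E * total_bound s p q a alpha beta l u `^ tau)%E ->
  ((\int[lam]_x log_integrand tau mu g u x) `^ tau^-1 <=
   (C `^ tau^-1)%:E * total_bound s p q a alpha beta l u)%E.
Proof.
move=> tau0 C0 mu' mg ae0; set E := \bigcup_j _ => h.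
have mE : measurable E.
  by apply: bigcup_measurable => j _; exact: measurable_shell.
have mL := measurable_log_integrand tau mu mg mu'.
have L0 x := log_integrand_ge0 tau mu g u x.
have -> : (\int[lam]_x log_integrand tau mu g u x =
    \int[lam]_(x in E) log_integrand tau mu g u x)%E.
  rewrite -[in LHS](setUv E) ge0_integral_setU//; last 3 first.
  - exact: measurableC.
  - by rewrite setUv.
  - by apply/disj_setPS; rewrite setICr.
  rewrite [X in (_ + X)%E](_ : _ = 0%E) ?adde0//.
  apply: ae0_integral => //; first exact: measurableC.
    exact: measurable_funTS.
  apply: filterS ae0 => x hx nE; apply: hx => j xj.
  by apply: nE; exists j.
have T0 : (0 <= total_bound s p q a alpha beta l u)%E.
  by rewrite mule_ge0// poweR_ge0.
apply: (@le_trans _ _ ((C%:E * total_bound s p q a alpha beta l u `^ tau) `^ tau^-1)%E).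
  apply: gt0_ler_poweR; rewrite ?in_itv/= ?leey ?andbT//.
  - by rewrite invr_ge0 ltW.
  - exact: integral_ge0.
  - by rewrite mule_ge0 ?poweR_ge0// lee_fin ltW.
rewrite poweRM ?poweR_ge0 ?lee_fin ?(ltW C0)// poweR_EFin -poweRrM.
by rewrite mulfV ?lt0r_neq0// poweRe1.
Qed.

End total_bound.

Section cases.
Context {R : realType} {n : nat}.
Variables (l : R).
Hypothesis (l1 : 1 < l).
Local Notation lam := (lebesgue_rV R n.+1).
Implicit Types (x : 'rV[R]_n.+1).

Let l0 : 0 < l. Proof. exact: lt_trans l1. Qed.

(** With the start [r / l], shell 0 is the last one inside the ball of radius [r], where [u]
    vanishes, and shell 1 begins at [r]. *)
Lemma geometric_radii_up (r : R) : 0 < r ->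
  geometric_radii l (fun j => r / l * l ^+ j).
Proof.
move=> r0; split=> [j|]; first by rewrite mulr_gt0 ?exprn_gt0// divr_gt0.
by left=> j; rewrite exprS mulrCA.
Qed.

(** Here shell 0 begins at [r], just outside the ball that contains the support, and shell 1 ends at
    [r]. *)
Lemma geometric_radii_down (r : R) : 0 < r ->
  geometric_radii l (fun j => r / l ^+ j).
Proof.
move=> r0; split=> [j|]; first by rewrite divr_gt0// exprn_gt0.
right=> j; rewrite exprS; field.
by rewrite !lt0r_neq0// exprn_gt0.
Qed.

Lemma shells_up (r : R) x : 0 < r -> r <= enorm x ->
  exists j : nat, shell (r / l * l ^+ j.+1) (l * (r / l * l ^+ j.+1)) x.
Proof.
move=> r0 rx; have y1 : 1 <= enorm x / r by rewrite ler_pdivlMr// mul1r.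
have [j /andP[j1 j2]] := exp_bracket l1 y1; exists j.
have e1 : r / l * l ^+ j.+1 = r * l ^+ j.
  by rewrite exprS; field; exact: lt0r_neq0.
rewrite /shell/= e1; apply/andP; split.
  by rewrite mulrC -ler_pdivlMr.
by rewrite mulrCA -exprS mulrC -ltr_pdivrMr.
Qed.

Lemma shells_down (r : R) x : 0 < r -> 0 < enorm x < r ->
  exists j : nat, shell (r / l ^+ j.+1) (l * (r / l ^+ j.+1)) x.
Proof.
move=> r0 /andP[x0 xr]; have y1 : 1 < r / enorm x by rewrite ltr_pdivlMr// mul1r.
have [j /andP[j1 j2]] := exp_bracketW l1 y1; exists j.
have e1 : l * (r / l ^+ j.+1) = r / l ^+ j.
  by rewrite exprS; field; rewrite !lt0r_neq0// exprn_gt0.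
rewrite /shell/= e1; apply/andP; split.
  by rewrite ler_pdivrMr ?exprn_gt0// mulrC -ler_pdivrMr.
by rewrite ltr_pdivlMr ?exprn_gt0// mulrC -ltr_pdivlMr.
Qed.

Lemma measurable_ln_up (r : R) :
  measurable_fun setT (fun x : 'rV[R]_n.+1 => ln (2 * enorm x / r)).
Proof.
apply: measurableT_comp; first exact: measurable_ln.
apply: measurable_funM => //; apply: measurable_funM => //.
exact: measurable_enorm.
Qed.

Lemma measurable_ln_down (r : R) :
  measurable_fun setT (fun x : 'rV[R]_n.+1 => ln (2 * r / enorm x)).
Proof.
apply: measurableT_comp; first exact: measurable_ln.
apply: measurable_funM => //.
have mV : measurable_fun setT (fun x : 'rV[R]_n.+1 => enorm x `^ (- 1)).
  exact: (measurableT_comp (@measurable_powR R _) (@measurable_enorm R n.+1)).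
by apply: eq_measurable_fun mV => x _; rewrite powR_inv1// enorm_ge0.
Qed.

Lemma ln_up_ge (r : R) (j : nat) x : 0 < r -> r / l * l ^+ j.+1 <= enorm x ->
  Num.min (ln 2) (ln l) * j.+1%:R <= ln (2 * enorm x / r).
Proof.
move=> r0 rx; apply: ln_exp_ge => //.
rewrite -mulrA ler_pM2l// ler_pdivlMr//; apply: le_trans rx.
rewrite le_eqVlt; apply/orP; left; apply/eqP.
by rewrite exprS; field; exact: lt0r_neq0.
Qed.

Lemma ln_down_ge (r : R) (j : nat) x : 0 < r ->
  r / l ^+ j.+1 <= enorm x < l * (r / l ^+ j.+1) ->
  Num.min (ln 2) (ln l) * j.+1%:R <= ln (2 * r / enorm x).
Proof.
move=> r0 /andP[x1 x2]; apply: ln_exp_ge => //.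
have x0 : 0 < enorm x.
  by apply: lt_le_trans x1; rewrite divr_gt0// exprn_gt0.
rewrite -mulrA ler_pM2l// ler_pdivlMr// mulrC -ler_pdivlMr ?exprn_gt0//.
apply: (le_trans (ltW x2)); rewrite le_eqVlt; apply/orP; left; apply/eqP.
by rewrite exprS; field; rewrite !lt0r_neq0// exprn_gt0.
Qed.

End cases.

Unset Implicit Arguments.

Theorem theorem1p2 (R : realType) (d : nat)
  (s p q tau a alpha beta gamma sigma mu Lambda : R)
  (hd : (2 <= d)%N) (hs0 : 0 < s) (hs1 : s < 1) (hp : 1 < p) (hq : 1 <= q)
  (htau : 1 <= tau) (ha0 : 0 < a) (ha1 : a <= 1) (hmu : 1 < mu)
  (hLambda : 1 < Lambda) (htaumu : tau <= mu)
  (hsigma : gamma = a * sigma + (1 - a) * beta)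
  (hbalance : 1 / tau + gamma / d%:R =
     a * (1 / p + (alpha - s) / d%:R) + (1 - a) * (1 / q + beta / d%:R))
  (halpha1 : - ((d%:R - 1) * s) <= alpha - sigma)
  (halpha2 : alpha - sigma < 0) :
  exists2 C : R, 0 < C &
    forall u : 'rV[R]_d -> R,
      radial u -> locally_integrable_rV (~` [set 0]) u ->
      forall R1 R2 : R, 0 < R1 -> 0 < R2 ->
      (1 / tau + gamma / d%:R = 0 -> ess_support u `<=` eball R2 ->
        ((\int[lebesgue_rV R d]_x
            (enorm x `^ (gamma * tau) / ln (2 * R2 / enorm x) `^ mu
              * `|u x| `^ tau)%:E) `^ tau^-1
         <= C%:E * sobolev_seminorm s p alpha Lambda setT u `^ a
            * 'N[lebesgue_rV R d]_(q%:E)[(fun x => (enorm x `^ beta * u x)%:E)]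
                `^ (1 - a))%E)
      /\
      (1 / tau + gamma / d%:R = 0 -> ess_support u `&` eball R1 = set0 ->
        ((\int[lebesgue_rV R d]_x
            (enorm x `^ (gamma * tau) / ln (2 * enorm x / R1) `^ mu
              * `|u x| `^ tau)%:E) `^ tau^-1
         <= C%:E * sobolev_seminorm s p alpha Lambda setT u `^ a
            * 'N[lebesgue_rV R d]_(q%:E)[(fun x => (enorm x `^ beta * u x)%:E)]
                `^ (1 - a))%E).
Proof.
(* Both claims assume the critical relation, so without it any constant serves. *)
have [crit|ncrit] := eqVneq (1 / tau + gamma / d%:R) 0; last first.
  exists 1 => // u _ _ R1 R2 _ _.
  by split=> h; move: ncrit; rewrite h eqxx.
case: d hd hbalance halpha1 crit => [//|n] _ hbalance halpha1 crit.
set N : R := n.+1%:R in hbalance halpha1 crit *.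
have N0 : 0 < N by rewrite ltr0n.
have p0 : 0 < p by exact: lt_trans hp.
have q0 : 0 < q by exact: lt_le_trans hq.
have tau0 : 0 < tau by exact: lt_le_trans htau.
pose l := Num.sqrt Lambda.
have lE : l * l = Lambda by rewrite -expr2 sqr_sqrtr// ltW// (lt_trans ltr01).
have l1 : 1 < l by rewrite -sqrtr1 ltr_sqrt// (lt_trans ltr01).
(* The upper bound on [alpha - sigma] makes [t] positive, the lower bound makes it at most [s]. *)
pose t := (s + sigma - alpha) / N.
have t0 : 0 < t by rewrite divr_gt0//; lra.
have ts : t <= s by rewrite ler_pdivrMr//; lra.
have tauE : tau^-1 = a * (p^-1 - t) + (1 - a) * q^-1.
  have : tau^-1 = 1 / tau + gamma / N - gamma / N by rewrite div1r addrK.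
  rewrite hbalance hsigma => ->; rewrite /t; field.
  by rewrite !lt0r_neq0.
have expE : a * (N / p + alpha - s) + (1 - a) * (N / q + beta) = 0.
  transitivity (N * (1 / tau + gamma / N)); last by rewrite crit mulr0.
  by rewrite hbalance; field; rewrite !lt0r_neq0.
have gtE : gamma * tau = - N.
  have : (1 / tau + gamma / N) * (tau * N) = N + gamma * tau.
    by field; rewrite !lt0r_neq0.
  by rewrite crit mul0r => /esym/eqP; rewrite addrC addr_eq0 => /eqP.
pose c := Num.min (ln 2) (ln l).
have c0 : 0 < c by rewrite lt_min !ln_gt0// ltr1n.
have [C C0 bnd] := log_bound hs0 t0 ts hp hq htau ha0 ha1 l1 htaumu tauE expE c0.
exists (C `^ tau^-1); first by rewrite powR_gt0.
move=> u ru [mu0 _ _] R1 R2 R10 R20.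
have mu' := measurable_fun_punctured mu0.
have u0 g x : u x = 0 -> log_integrand tau mu g u x = 0%E.
  by move=> ux; rewrite /log_integrand ux normr0 powR0 ?mulr0// lt0r_neq0.
split=> _ su; rewrite -muleA -lE -total_boundE ?lt0r_neq0//; rewrite gtE.
- have ae0 := ess_support_sub_eball su.
  pose rho (j : nat) := R2 / l ^+ j.
  have grho := geometric_radii_down l1 R20.
  apply: (@integral_shells_le _ _ _ _ _ _ _ _ _ _ _ _ rho) => //.
  + exact: measurable_ln_down.
  + apply: filterS ae0 => x hx nsh.
    (* The origin lies in no shell; there the integrand is 0, because zero to the nonzero power
       [- N] is 0 by convention. *)
    have [x0|x0] := eqVneq (enorm x) 0.
      rewrite /log_integrand x0 powR0 ?mul0r// oppr_eq0; exact: lt0r_neq0.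
    have xp : 0 < enorm x by rewrite lt_neqAle eq_sym x0 enorm_ge0.
    have [rx|xr] := leP R2 (enorm x); first by apply: u0; exact: hx.
    have [|j xj] := @shells_down R n l l1 R2 x R20; first by rewrite xp.
    by case: (nsh j xj).
  + apply: bnd => //; first exact: measurable_ln_down.
      apply: filterS ae0 => x hx /andP[x1 _]; apply: hx.
      by rewrite /rho expr0 divr1 in x1.
    by move=> j x; exact: ln_down_ge.
- have ae0 := ess_support_eball0 su.
  pose rho (j : nat) := R1 / l * l ^+ j.
  have grho := geometric_radii_up l1 R10.
  apply: (@integral_shells_le _ _ _ _ _ _ _ _ _ _ _ _ rho) => //.
  + exact: measurable_ln_up.
  + apply: filterS ae0 => x hx nsh.
    have [rx|xr] := leP R1 (enorm x); last by apply: u0; exact: hx.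
    by have [j xj] := shells_up l1 R10 rx; case: (nsh j xj).
  + apply: bnd => //; first exact: measurable_ln_up.
      apply: filterS ae0 => x hx /andP[_ x1]; apply: hx.
      move: x1; rewrite /rho expr0 mulr1 mulrCA divff ?mulr1//.
      by rewrite lt0r_neq0// (lt_trans ltr01).
    by move=> j x /andP[x1 _]; exact: ln_up_ge.
Qed.
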